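(* Let $\Omega\subset\mathbb{R}^n$, $n\geq 3$, be a strictly convex bounded smooth domain, write $M=\bar\Omega$, and let $N\geq 2$. Suppose the sets $\mathscr{I},\mathscr{F}\subset\mathbb{C}^N$ give ideal data. Fix any $\alpha>0$. Let $H_0,G\colon M\to\mathbb{C}^{N\times N}$ be $C^{1,\alpha}$-smooth and pointwise hermitean, and suppose that $G(x)$ is not a multiple of the identity matrix for any $x\in M$. Then, with $H_0$ and $G$ known, a real valued function $f\in C^{1,\alpha}(M)$ is uniquely determined by the quantities $|a^*U_H^\gamma b|$, where $H(x)=H_0(x)+f(x)G(x)$, for all $a\in\mathscr{F}$, $b\in\mathscr{I}$ and every line $\gamma\colon[0,T]\to\bar\Omega$ through $\Omega$. That is, if $f,\tilde f\in C^{1,\alpha}(M)$ are real valued, $H=H_0+fG$, $\tilde H=H_0+\tilde fG$, and $|a^*U_H^\gamma b|=|a^*U_{\tilde H}^\gamma b|$ for all such $a,b,\gamma$, then $f=\tilde f$.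
   Context: A line through $\Omega$ is a unit speed line segment $\gamma\colon[0,T]\to\bar\Omega$ with endpoints on $\partial\Omega$. The time evolution operator $U_H^\gamma(t_2,t_1)\in U(N)$ is the solution operator of $i\Psi'(t)=H(\gamma(t))\Psi(t)$, $\Psi(t)\in\mathbb{C}^N$, so that $\Psi(t_2)=U_H^\gamma(t_2,t_1)\Psi(t_1)$ for every solution; $U_H^\gamma:=U_H^\gamma(T,0)$. A pair of subsets $\mathscr{I},\mathscr{F}\subset\mathbb{C}^N$ gives ideal data if for any two unitary $N\times N$ matrices $U$ and $V$, the condition $|a^*Ub|=|a^*Vb|$ for all $a\in\mathscr{F}$ and $b\in\mathscr{I}$ implies $U=e^{i\phi}V$ for some $\phi\in\mathbb{R}$. *)

(* Defs.v *)
From HB Require Import structures.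
From mathcomp Require Import all_boot all_order all_algebra complex.
From mathcomp Require Import all_classical all_reals all_analysis.

Set Implicit Arguments.
Unset Strict Implicit.
Unset Printing Implicit Defensive.

Import Order.TTheory GRing.Theory Num.Theory.
Import numFieldNormedType.Exports.

Local Open Scope classical_set_scope.
Local Open Scope ring_scope.
Local Open Scope sesquilinear_scope.
Local Open Scope complex_scope.

(* The library norm on 'rV[R]_n is the sup norm.  It induces the usual topology,
   but lengths and unit vectors have to be measured with the Euclidean norm. *)
Definition enorm (R : realType) (n : nat) (v : 'rV[R]_n) : R :=
  Num.sqrt (\sum_i v 0 i ^+ 2).

Definition boundary (T : topologicalType) (A : set T) : set T :=
  closure A `\` interior A.

Definition partial (R : realType) (n : nat) (i : 'I_n) (f : 'rV[R]_n -> R) :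
  'rV[R]_n -> R := 'D_(delta_mx 0 i : 'rV[R]_n) f.

Definition has_partial (R : realType) (n : nat) (i : 'I_n)
    (f : 'rV[R]_n -> R) (x : 'rV[R]_n) : Prop :=
  derivable f x (delta_mx 0 i : 'rV[R]_n).

(* Meant for an open set U: partial derivatives at points of U then only depend
   on the values of f on U. *)
Fixpoint Ck_on (R : realType) (n k : nat) (U : set 'rV[R]_n)
    (f : 'rV[R]_n -> R) : Prop :=
  match k with
  | 0%N => {within U, continuous f}
  | k'.+1 => {within U, continuous f} /\
      forall i : 'I_n,
        (forall x, U x -> has_partial i f x) /\ Ck_on k' U (partial i f)
  end.

Definition smooth_on (R : realType) (n : nat) (U : set 'rV[R]_n)
    (f : 'rV[R]_n -> R) : Prop := forall k, Ck_on k U f.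

Definition domain (R : realType) (n : nat) (Omega : set 'rV[R]_n) : Prop :=
  [/\ open Omega, connected Omega & Omega !=set0].

(* Local defining functions: near each boundary point p, Omega is {rho < 0} for
   a smooth rho whose differential does not vanish at p. *)
Definition smooth_boundary (R : realType) (n : nat) (Omega : set 'rV[R]_n) :
    Prop :=
  forall p, boundary Omega p ->
    exists (U : set 'rV[R]_n) (rho : 'rV[R]_n -> R),
      [/\ open U, U p, smooth_on U rho,
          exists i : 'I_n, partial i rho p != 0 &
          Omega `&` U = [set x | rho x < 0] `&` U].

(* Strict (not strong) convexity: no curvature of the boundary is required. *)
Definition strictly_convex (R : realType) (n : nat) (Omega : set 'rV[R]_n) :
    Prop :=
  forall (x y : 'rV[R]_n) (t : R),
    closure Omega x -> closure Omega y -> x != y -> 0 < t < 1 ->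
    Omega ((1 - t) *: x + t *: y).

Definition holder_on (R : realType) (n : nat) (alpha : R) (A : set 'rV[R]_n)
    (g : 'rV[R]_n -> R) : Prop :=
  exists C : R, forall x y, A x -> A y ->
    `|g x - g y| <= C * enorm (x - y) `^ alpha.

(* C^{1,alpha} on the closure M of Omega: f is C^1 in Omega, and f and its first
   partial derivatives extend continuously to M, the latter being
   alpha-Hoelder there.  Values of f outside M are irrelevant. *)
Definition C1holder (R : realType) (n : nat) (alpha : R)
    (Omega : set 'rV[R]_n) (f : 'rV[R]_n -> R) : Prop :=
  {within closure Omega, continuous f} /\
  forall i : 'I_n,
    (forall x, Omega x -> has_partial i f x) /\
    exists g : 'rV[R]_n -> R,
      [/\ forall x, Omega x -> g x = partial i f x,
          {within closure Omega, continuous g} &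
          holder_on alpha (closure Omega) g].

Definition C1holder_mx (R : realType) (n N : nat) (alpha : R)
    (Omega : set 'rV[R]_n) (H : 'rV[R]_n -> 'M[R[i]]_N) : Prop :=
  forall j k : 'I_N,
    C1holder alpha Omega (fun x => complex.Re (H x j k)) /\
    C1holder alpha Omega (fun x => complex.Im (H x j k)).

(* Only the values of gamma on [0, T] matter. *)
Definition line_through (R : realType) (n : nat) (Omega : set 'rV[R]_n)
    (T : R) (gamma : R -> 'rV[R]_n) : Prop :=
  [/\ 0 < T,
      exists x v : 'rV[R]_n,
        enorm v = 1 /\ forall t, 0 <= t <= T -> gamma t = x + t *: v,
      forall t, 0 <= t <= T -> closure Omega (gamma t),
      boundary Omega (gamma 0) &
      boundary Omega (gamma T)].

(* Real and imaginary parts are treated separately since R[i] carries no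
   topology in the library. *)
Definition is_deriv_cV (R : realType) (N : nat) (Psi : R -> 'cV[R[i]]_N)
    (t : R) (dPsi : 'cV[R[i]]_N) : Prop :=
  forall k : 'I_N,
    is_derive t (1 : R) (fun s => complex.Re (Psi s k 0))
      (complex.Re (dPsi k 0)) /\
    is_derive t (1 : R) (fun s => complex.Im (Psi s k 0))
      (complex.Im (dPsi k 0)).

(* i Psi' = H(gamma) Psi on ]0, T[ with Psi continuous on [0, T]; for H o gamma
   continuous on [0, T] this is the same as being a C^1 solution on [0, T]. *)
Definition schrodinger_solution (R : realType) (n N : nat)
    (H : 'rV[R]_n -> 'M[R[i]]_N) (T : R) (gamma : R -> 'rV[R]_n)
    (Psi : R -> 'cV[R[i]]_N) : Prop :=
  (forall k : 'I_N,
    {within `[0, T], continuous (fun t => complex.Re (Psi t k 0))} /\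
    {within `[0, T], continuous (fun t => complex.Im (Psi t k 0))}) /\
  forall t, 0 < t < T ->
    exists dPsi : 'cV[R[i]]_N,
      is_deriv_cV Psi t dPsi /\ 'i%C *: dPsi = H (gamma t) *m Psi t.

(* U_H^gamma(t2, t1).  For t1, t2 in [0, T] and H o gamma continuous and
   hermitean on [0, T], exactly one
   matrix satisfies the defining property; the default 1%:M is never used. *)
Definition time_evolution (R : realType) (n N : nat)
    (H : 'rV[R]_n -> 'M[R[i]]_N) (T : R) (gamma : R -> 'rV[R]_n) (t2 t1 : R) :
    'M[R[i]]_N :=
  xget 1%:M [set U : 'M[R[i]]_N | U \is unitarymx /\
    forall Psi, schrodinger_solution H T gamma Psi ->
      Psi t2 = U *m Psi t1].

(* The modulus of a^* U b, as a (real) element of R[i]. *)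
Definition amplitude (R : realType) (N : nat) (a : 'cV[R[i]]_N)
    (U : 'M[R[i]]_N) (b : 'cV[R[i]]_N) : R[i] :=
  `|(a ^t* *m U *m b) 0 0|.

Definition ideal_data (R : realType) (N : nat) (I F : set 'cV[R[i]]_N) :
    Prop :=
  forall U V : 'M[R[i]]_N, U \is unitarymx -> V \is unitarymx ->
    (forall a b, F a -> I b -> amplitude a U b = amplitude a V b) ->
    exists phi : R, U = (cos phi +i* sin phi) *: V.

(* Main.v *)
Require Import Defs.
From HB Require Import structures.
From mathcomp Require Import all_boot all_order all_algebra complex.
From mathcomp Require Import all_classical all_reals all_analysis.
From mathcomp Require Import ring lra zify.

Set Implicit Arguments.
Unset Strict Implicit.
Unset Printing Implicit Defensive.

Import Order.TTheory GRing.Theory Num.Theory.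
Import numFieldNormedType.Exports.

Local Open Scope classical_set_scope.
Local Open Scope ring_scope.

(* Let X and Y be the propagators of H and H' along a line.  Then D = Y^* X
   satisfies i D' = |d| h Y^* G X with h = f - f', and ideal data force D to be
   a scalar matrix over each chord.  Pairing with a traceless P such that
   tr (P G(p)) = 1 removes the unknown phase: the integral of h over a chord,
   against the weight w = Re tr (P Y^* G X), vanishes, and w is close to 1 along
   short lines near p.

   Chords near an exposed boundary point are short, so h vanishes there by
   Rolle's theorem, hence on the whole boundary; thus h extends by 0 to a
   Lipschitz function.  If h <> 0, let p be a point of its support farthest from
   the origin.  As n >= 3, there is a plane almost tangent at p to the sphere
   through p, and it cuts the support in a small piece.

   In such a plane, h has zero integrals over all lines, against weights close
   to 1 and varying slowly with the direction.  Hence each Fourier coefficient of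
   h equals that of h (1 - w_tau), where tau is the slope of the lines on which
   the phase is constant.  Telescoping in tau bounds the sum of the squares of
   the latter by a small multiple of the squared norm of h, so h = 0 there.
   Everything is done with Fejer-weighted finite sums over a grid, where Bessel's
   inequality is elementary and Lipschitz regularity controls the error. *)

(** * Fourier sums on a grid *)

(** Why the planar estimate closes: the entries of a frequency [p - q] are smaller than [K], so the
    slopes used in one chart are multiples of 1/K! in [-1, 1]. The weights start within [d] of 1 and
    make 2 K! jumps of size at most d/K!, hence a total of 3d that does not grow with [K]. Slopes of
    modulus at most 1 miss some frequencies; these are reached by exchanging the two coordinates.
    The two charts together use up 36 d^2 of the energy, so 72 d^2 <= 1 leaves half of it, and d =
    1/10 will do. The other errors have two scales. The Fejer loss is of order K n^4 against a main
    term of order K^2 n^4, while the Riemann sums cost n^2 times a constant that depends on [K]. So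
    [K] is fixed first and the grid size [n] afterwards. A separate obstacle is that lines leave the
    domain, where the coefficients carry no information. They are extended to bounded Lipschitz
    hermitian fields on the whole space and the propagators are solved on whole lines; as h vanishes
    outside the domain, the arbitrary extension has no effect on [Y^* X] there. *)

Section Kernel.
Variables (R : realType) (X P : finType) (phi : P -> X -> R).
Implicit Types g h : X -> R.

(** Squared modulus of the sum over [p] of exp(i (phi p x - phi p y)), kept in real form. *)
Definition fejer (x y : X) : R :=
  (\sum_p cos (phi p x - phi p y)) ^+ 2 + (\sum_p sin (phi p x - phi p y)) ^+ 2.

(** Squared modulus of the Fourier coefficient of [g] at the frequency [p - q]. Indexing by pairs
    instead of differences produces the Fejer weights: a frequency counts as often as it occurs as a
    difference. *)
Definition power g (p q : P) : R :=
  (\sum_x g x * cos (phi p x - phi q x)) ^+ 2 +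
  (\sum_x g x * sin (phi p x - phi q x)) ^+ 2.

Lemma fejer_ge0 x y : 0 <= fejer x y.
Proof. by rewrite addr_ge0 ?sqr_ge0. Qed.

Lemma power_ge0 g p q : 0 <= power g p q.
Proof. by rewrite addr_ge0 ?sqr_ge0. Qed.

Lemma fejerC x y : fejer x y = fejer y x.
Proof.
rewrite /fejer; congr (_ + _).
  by congr (_ ^+ 2); apply: eq_bigr => p _; rewrite -cosN opprB.
rewrite -sqrrN -sumrN; congr (_ ^+ 2).
by apply: eq_bigr => p _; rewrite -sinN opprB.
Qed.

Lemma sqr_sum_cos_sin (I : finType) (a t : I -> R) :
  (\sum_i a i * cos (t i)) ^+ 2 + (\sum_i a i * sin (t i)) ^+ 2 =
  \sum_i \sum_j a i * a j * cos (t i - t j).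
Proof.
rewrite !expr2 !big_distrlr -big_split; apply: eq_bigr => i _ /=.
rewrite -big_split; apply: eq_bigr => j _ /=.
by rewrite cosB; ring.
Qed.

(** The phase (phi p x - phi q x) - (phi p y - phi q y) can also be grouped as (phi p x - phi p y) -
    (phi q x - phi q y). So [sqr_sum_cos_sin], read once over points and once over frequencies,
    expands both sides to the same fourfold sum. *)
Lemma sum_power g :
  \sum_p \sum_q power g p q = \sum_x \sum_y g x * g y * fejer x y.
Proof.
transitivity (\sum_p \sum_q \sum_x \sum_y
    g x * g y * cos ((phi p x - phi q x) - (phi p y - phi q y))).
  by do 2!(apply: eq_bigr => ? _); rewrite /power sqr_sum_cos_sin.
transitivity (\sum_x \sum_y \sum_p \sum_q
    g x * g y * cos ((phi p x - phi q x) - (phi p y - phi q y))).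
  rewrite (eq_bigr _ (fun p _ => exchange_big _ _ _ _ _ _)) exchange_big.
  apply: eq_bigr => x _.
  by rewrite (eq_bigr _ (fun p _ => exchange_big _ _ _ _ _ _)) exchange_big.
apply: eq_bigr => x _; apply: eq_bigr => y _; rewrite /fejer.
have -> : forall C S : P -> R, (\sum_p C p) ^+ 2 + (\sum_p S p) ^+ 2 =
    (\sum_p 1 * C p) ^+ 2 + (\sum_p 1 * S p) ^+ 2.
  by move=> C S; congr (_ ^+ 2 + _ ^+ 2); apply: eq_bigr => p _; rewrite mul1r.
rewrite sqr_sum_cos_sin.
rewrite mulr_sumr; apply: eq_bigr => p _.
rewrite mulr_sumr; apply: eq_bigr => q _.
by rewrite !mul1r; congr (_ * cos _); ring.
Qed.

Variable Psi : R.
Hypothesis sum_fejer : forall x, \sum_y fejer x y = Psi.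

(** Polarisation: 2 [g x] [g y] is the sum of the squares minus the square of the difference, and
    the constant row sums take care of the squares. Being an identity, it gives Bessel's upper bound
    as well as the lower bound in [sample_energy]. *)
Lemma sum_powerE g :
  \sum_p \sum_q power g p q =
  Psi * \sum_x g x ^+ 2 - 2^-1 * \sum_x \sum_y (g x - g y) ^+ 2 * fejer x y.
Proof.
have A : \sum_x \sum_y g x ^+ 2 * fejer x y = Psi * \sum_x g x ^+ 2.
  rewrite mulr_sumr; apply: eq_bigr => x _.
  by rewrite -mulr_sumr sum_fejer mulrC.
have B : \sum_x \sum_y g y ^+ 2 * fejer x y = Psi * \sum_x g x ^+ 2.
  rewrite exchange_big mulr_sumr; apply: eq_bigr => x _ /=.
  by under eq_bigr do rewrite fejerC; rewrite -mulr_sumr sum_fejer mulrC.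
rewrite sum_power.
have -> : \sum_x \sum_y (g x - g y) ^+ 2 * fejer x y =
    2 * (Psi * \sum_x g x ^+ 2) - 2 * \sum_x \sum_y g x * g y * fejer x y.
  rewrite [2 * (Psi * _)]mulr_natl mulr2n -{1}A -B -!big_split /= mulr_sumr.
  rewrite -sumrB; apply: eq_bigr => x _.
  rewrite -big_split mulr_sumr -sumrB; apply: eq_bigr => y _ /=; ring.
lra.
Qed.

Lemma bessel g : \sum_p \sum_q power g p q <= Psi * \sum_x g x ^+ 2.
Proof.
rewrite sum_powerE gerBl mulr_ge0 ?invr_ge0 ?ler0n//.
by do 2!(apply: sumr_ge0 => ? _); rewrite mulr_ge0 ?sqr_ge0 ?fejer_ge0.
Qed.

Lemma Psi_ge0 (x : X) : 0 <= Psi.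
Proof. by rewrite -(sum_fejer x); apply: sumr_ge0 => y _; apply: fejer_ge0. Qed.


(** Cauchy-Schwarz with weights [e], from Lagrange's identity: twice the gap is a sum of squares
    divided by [e i * e j]. *)
Lemma sqr_sum_le (I : finType) (e a : I -> R) : (forall i, 0 < e i) ->
  (\sum_i a i) ^+ 2 <= (\sum_i e i) * (\sum_i a i ^+ 2 / e i).
Proof.
move=> e0; rewrite -(ler_pM2l (ltr0n R 2)).
have -> : 2 * ((\sum_i e i) * (\sum_i a i ^+ 2 / e i)) =
    \sum_i \sum_j (e i * (a j ^+ 2 / e j) + e j * (a i ^+ 2 / e i)).
  rewrite mulr_natl mulr2n {1}big_distrlr mulrC big_distrlr -big_split /=.
  apply: eq_bigr => i _; rewrite -big_split; apply: eq_bigr => j _ /=.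
  by congr (_ + _); rewrite mulrC.
rewrite expr2 big_distrlr mulr_sumr; apply: ler_sum => i _.
rewrite mulr_sumr; apply: ler_sum => j _ /=.
rewrite -subr_ge0; have ei := e0 i; have ej := e0 j.
have -> : e i * (a j ^+ 2 / e j) + e j * (a i ^+ 2 / e i) - 2 * (a i * a j) =
    (e i * a j - e j * a i) ^+ 2 / (e i * e j).
  by field; rewrite !gt_eqF.
by rewrite mulr_ge0 ?sqr_ge0// invr_ge0 ltW// mulr_gt0.
Qed.

Lemma power_sum_le m (e : nat -> R) (g : nat -> X -> R) p q :
  (forall i, 0 < e i) ->
  power (fun x => \sum_(i < m) g i x) p q <=
  (\sum_(i < m) e i) * \sum_(i < m) power (g i) p q / e i.
Proof.
move=> e0; rewrite {1}/power.
have sum_swap (t : X -> R) : \sum_x (\sum_(i < m) g i x) * t x =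
    \sum_(i < m) \sum_x g i x * t x.
  by rewrite exchange_big; apply: eq_bigr => x _; rewrite mulr_suml.
have -> : \sum_(i < m) power (g i) p q / e i =
    \sum_(i < m) (\sum_x g i x * cos (phi p x - phi q x)) ^+ 2 / e i +
    \sum_(i < m) (\sum_x g i x * sin (phi p x - phi q x)) ^+ 2 / e i.
  by rewrite -big_split; apply: eq_bigr => i _ /=; rewrite -mulrDl.
rewrite !sum_swap mulrDr; apply: lerD;
  exact: (@sqr_sum_le _ (fun i : 'I_m => e i)).
Qed.

(* The weight [b (idx p q)] depends on the frequency, so Bessel's inequality
   applies only after telescoping it into increments that do not. *)
Lemma multiplier_bound (h : X -> R) (b : nat -> X -> R) (idx : P -> P -> nat)
    (L : nat) (d : R) :
  0 < d -> (0 < L)%N -> (forall p q, (idx p q <= L.*2)%N) ->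
  (forall x, `|b 0%N x * h x| <= d * `|h x|) ->
  (forall i x, (i < L.*2)%N ->
    `|(b i.+1 x - b i x) * h x| <= d / L%:R * `|h x|) ->
  \sum_p \sum_q power (fun x => b (idx p q) x * h x) p q <=
  9 * d ^+ 2 * (Psi * \sum_x h x ^+ 2).
Proof.
move=> d0 L0 idxL b0 bS.
(* The telescoped pieces, none of which depends on the frequency. [e] bounds their relative size and
   is also the Cauchy-Schwarz weight; its total d + 2L (d / L) = 3d is the origin of 9 d^2. *)
pose g i x := (if i is j.+1 then b i x - b j x else b 0%N x) * h x.
pose e i : R := if i is _.+1 then d / L%:R else d.
have LR0 : 0 < L%:R :> R by rewrite ltr0n.
have e0 i : 0 < e i by case: i => //= i; rewrite divr_gt0.
have bE m x : b m x * h x = \sum_(i < m.+1) g i x.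
  rewrite /g -mulr_suml; congr (_ * _).
  elim: m => [|m IH]; first by rewrite big_ord1.
  by rewrite big_ord_recr /= -IH addrC subrK.
have gle i x : (i <= L.*2)%N -> g i x ^+ 2 <= e i ^+ 2 * h x ^+ 2.
  move=> iL; rewrite -[g i x ^+ 2]real_normK ?num_real// -[h x ^+ 2]real_normK ?num_real//.
  rewrite -exprMn ler_sqr ?nnegrE ?mulr_ge0 ?(ltW (e0 i))//.
  by case: i iL => [|i] iL /=; [exact: b0 | exact: bS].
have sume : \sum_(i < L.*2.+1) e i = 3 * d.
  rewrite big_ord_recl /= sumr_const card_ord -mul2n mulrnA.
  by rewrite -(mulr_natr _ L); field; rewrite gt_eqF.
have stepA p q : power (fun x => b (idx p q) x * h x) p q <=
    3 * d * \sum_(i < L.*2.+1) power (g i) p q / e i.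
  have -> : power (fun x => b (idx p q) x * h x) p q =
      power (fun x => \sum_(i < (idx p q).+1) g i x) p q.
    by rewrite /power; congr (_ ^+ 2 + _ ^+ 2); apply: eq_bigr => x _; rewrite bE.
  apply: le_trans (power_sum_le _ _ _ _ e0) _.
  (* Enlarging the partial sum up to [idx p q] to all increments removes the last dependence on [p]
     and [q]. *)
  have leS (a : nat -> R) : (forall i, 0 <= a i) ->
      \sum_(i < (idx p q).+1) a i <= \sum_(i < L.*2.+1) a i.
    move=> a0; rewrite (big_ord_widen L.*2.+1 a) ?ltnS //.
    rewrite [leRHS](bigID (fun i : 'I__ => (i < (idx p q).+1)%N)) /=.
    by rewrite lerDl sumr_ge0.
  rewrite -sume; apply: ler_pM.
  - by apply: sumr_ge0 => i _; exact: ltW.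
  - by apply: sumr_ge0 => i _; rewrite divr_ge0 ?power_ge0 ?ltW.
  - by apply: (leS e) => i; exact: ltW.
  - by apply: (leS (fun i => power (g i) p q / e i)) => i; rewrite divr_ge0 ?power_ge0 ?ltW.
apply: le_trans (ler_sum _ (fun p _ => ler_sum _ (fun q _ => stepA p q))) _.
have -> : \sum_p \sum_q 3 * d * \sum_(i < L.*2.+1) power (g i) p q / e i =
    3 * d * \sum_(i < L.*2.+1) (\sum_p \sum_q power (g i) p q) / e i.
  rewrite mulr_sumr; under eq_bigr do rewrite -mulr_sumr; rewrite -mulr_sumr.
  rewrite -mulr_sumr; congr (_ * _); under eq_bigr do rewrite exchange_big.
  rewrite exchange_big; apply: eq_bigr => i _.
  by rewrite mulr_suml; apply: eq_bigr => p _; rewrite mulr_suml.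
have -> : 9 * d ^+ 2 * (Psi * \sum_x h x ^+ 2) =
    3 * d * \sum_(i < L.*2.+1) e i * (Psi * \sum_x h x ^+ 2).
  by rewrite -mulr_suml sume; ring.
rewrite ler_pM2l ?mulr_gt0// ?ltr0n//; apply: ler_sum => i _.
rewrite ler_pdivrMr// mulrAC -expr2; apply: le_trans (bessel _) _.
rewrite mulrCA; have [x|X0] := pickP X; last first.
  by rewrite !big_pred0 ?mulr0 // => y; have := X0 y.
rewrite ler_wpM2l ?(Psi_ge0 x)// mulr_sumr; apply: ler_sum => y _.
by apply: gle; rewrite -ltnS.
Qed.

End Kernel.

(** * The Fejer kernel on a periodic grid *)

Section Torus.
Variable R : realType.
Implicit Types (n K : nat) (a t x y : R).

(** The period is 8 although the functions of interest live on [-1, 1]: the margin allows shifts by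
    up to 1 without wrapping around. [angle] rescales the period to 2 pi. *)
Definition grid n (i : nat) : R := -4 + 8 * i%:R / n%:R.

Definition angle n (i : nat) : R := pi / 4 * grid n i.

Definition phase1 n K (p : 'I_K) (i : 'I_n) : R := p%:R * angle n i.

Definition phase2 n K (p : 'I_K * 'I_K) (x : 'I_n * 'I_n) : R :=
  p.1%:R * angle n x.1 + p.2%:R * angle n x.2.

(** The two-dimensional exponential sum is the product of (C1 + i S1) and (C2 + i S2), and moduli
    multiply. *)
Lemma fejer_prod n K (x y : 'I_n * 'I_n) :
  fejer (@phase2 n K) x y =
  fejer (@phase1 n K) x.1 y.1 * fejer (@phase1 n K) x.2 y.2.
Proof.
rewrite /fejer /phase1 /phase2.
set a := angle n x.1; set a' := angle n y.1.
set b := angle n x.2; set b' := angle n y.2.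
set C1 := \sum_(p < K) cos (p%:R * a - _); set S1 := \sum_(p < K) sin (p%:R * a - _).
set C2 := \sum_(p < K) cos (p%:R * b - _); set S2 := \sum_(p < K) sin (p%:R * b - _).
have argE (p : 'I_K * 'I_K) :
    p.1%:R * a + p.2%:R * b - (p.1%:R * a' + p.2%:R * b') =
    (p.1%:R * a - p.1%:R * a') + (p.2%:R * b - p.2%:R * b') by ring.
have -> : \sum_(p : 'I_K * 'I_K)
    cos (p.1%:R * a + p.2%:R * b - (p.1%:R * a' + p.2%:R * b')) =
    C1 * C2 - S1 * S2.
  rewrite !big_distrlr /= !pair_big -sumrB; apply: eq_bigr => p _ /=.
  by rewrite argE cosD.
have -> : \sum_(p : 'I_K * 'I_K)
    sin (p.1%:R * a + p.2%:R * b - (p.1%:R * a' + p.2%:R * b')) =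
    S1 * C2 + C1 * S2.
  rewrite !big_distrlr /= !pair_big -big_split; apply: eq_bigr => p _ /=.
  by rewrite argE sinD.
ring.
Qed.

(** Real form of |1 + z + ... + z^(K-1)|^2 |z - 1|^2 = |z^K - 1|^2 for z = exp(i a), where |z - 1|^2
    = 2 (1 - cos a). It is kept multiplied out since cos a may be 1. [E1] and [E2] are the real and
    imaginary parts of the geometric sum. *)
Lemma sum_geom_cos_sin K a :
  ((\sum_(k < K) cos (k%:R * a)) ^+ 2 + (\sum_(k < K) sin (k%:R * a)) ^+ 2) *
  (1 - cos a) = 1 - cos (K%:R * a).
Proof.
have [E1 E2] : (\sum_(k < K) cos (k%:R * a)) * (cos a - 1) -
      (\sum_(k < K) sin (k%:R * a)) * sin a = cos (K%:R * a) - 1 /\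
    (\sum_(k < K) cos (k%:R * a)) * sin a +
      (\sum_(k < K) sin (k%:R * a)) * (cos a - 1) = sin (K%:R * a).
  elim: K => [|K [IH1 IH2]].
    by rewrite !big_ord0 !(mul0r, cos0, sin0); split; ring.
  have -> : K.+1%:R * a = K%:R * a + a by rewrite -natr1 mulrDl mul1r.
  rewrite !big_ord_recr /= cosD sinD.
  by split; lra.
have := cos2Dsin2 a; have := cos2Dsin2 (K%:R * a); move: E1 E2.
set A := \sum_(k < K) _; set B := \sum_(k < K) _.
set c := cos a; set s := sin a; set c' := cos (K%:R * a).
set s' := sin (K%:R * a) => E1 E2 P1 P2.
have : (A * (c - 1) - B * s) ^+ 2 + (A * s + B * (c - 1)) ^+ 2 =
    (c' - 1) ^+ 2 + s' ^+ 2 by rewrite E1 E2.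
move=> E; have : 2 * ((A ^+ 2 + B ^+ 2) * (1 - c)) = 2 * (1 - c').
  have -> : 2 * (1 - c') = (c' - 1) ^+ 2 + s' ^+ 2 by lra.
  by rewrite -E; nra.
lra.
Qed.

(** Concentration near the diagonal, with a bound free of [K]: this is what makes the loss in
    [sample_energy] smaller than the main term by a factor [K]. *)
Lemma fejer1_cos n K (i j : 'I_n) :
  fejer (@phase1 n K) i j * (1 - cos (angle n i - angle n j)) <= 2.
Proof.
have -> : fejer (@phase1 n K) i j =
    (\sum_(k < K) cos (k%:R * (angle n i - angle n j))) ^+ 2 +
    (\sum_(k < K) sin (k%:R * (angle n i - angle n j))) ^+ 2.
  by rewrite /fejer; congr (_ ^+ 2 + _ ^+ 2); apply: eq_bigr => k _;
    rewrite mulrBr.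
by rewrite sum_geom_cos_sin; have := cos_geN1 (K%:R * (angle n i - angle n j));
  lra.
Qed.

(** Multiplying by sin c, where c = m pi / n is half the phase step, turns each term into a
    difference, and the telescoped sum runs over whole periods. The bound m < n keeps sin c
    positive. *)
Lemma sum_cos_grid n m b : (0 < m < n)%N ->
  \sum_(i < n) cos (m%:R * angle n i + b) = 0.
Proof.
move=> /andP[m0 mn]; have n0 : 0 < n%:R :> R by rewrite ltr0n (ltn_trans m0).
pose c : R := m%:R * pi / n%:R.
have s0 : 0 < sin c.
  apply: sin_gt0_pi; apply/andP; split.
    by rewrite divr_gt0// mulr_gt0 ?ltr0n// pi_gt0.
  by rewrite ltr_pdivrMr// mulrC ltr_pM2l ?pi_gt0// ltr_nat.
apply/eqP; rewrite -(mulIr_eq0 _ (mulIf (lt0r_neq0 s0))).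
apply/eqP; rewrite mulr_suml.
pose f i := sin (m%:R * angle n i + b - c) / 2.
have argE i : m%:R * angle n i.+1 + b - c = m%:R * angle n i + b + c.
  by rewrite /angle /grid /c -natr1; field; rewrite gt_eqF.
under eq_bigr => i _.
  have -> : cos (m%:R * angle n i + b) * sin c = f i.+1 - f i.
    by rewrite /f argE sinD sinB; field.
  over.
rewrite -(big_mkord xpredT (fun i => f i.+1 - f i)) telescope_sumr// /f.
have -> : m%:R * angle n n + b - c = m%:R * angle n 0 + b - c + (pi *+ 2) *+ m.
  rewrite /angle /grid -(mulr_natr _ m) mulr2n; field; by rewrite gt_eqF.
by rewrite (periodicn (@sinD2pi R)) subrr.
Qed.

(** Orthogonality leaves only the pairs with p = q; [K <= n] rules out aliasing between distinct
    frequencies. *)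
Lemma sum_fejer1 n K (i : 'I_n) : (K <= n)%N ->
  \sum_j fejer (@phase1 n K) i j = n%:R * K%:R.
Proof.
move=> Kn.
have E j : fejer (@phase1 n K) i j =
    \sum_(p < K) \sum_(q < K) cos (p%:R * (angle n i - angle n j) - q%:R * (angle n i - angle n j)).
  transitivity (\sum_(p < K) \sum_(q < K) 1 * 1 *
      cos (p%:R * (angle n i - angle n j) - q%:R * (angle n i - angle n j))).
    rewrite -(sqr_sum_cos_sin (fun=> 1)
      (fun p : 'I_K => p%:R * (angle n i - angle n j))).
    by rewrite /fejer /phase1; congr (_ ^+ 2 + _ ^+ 2);
      apply: eq_bigr => p _; rewrite mul1r mulrBr.
  by apply: eq_bigr => p _; apply: eq_bigr => q _; rewrite !mul1r.
under eq_bigr do rewrite E.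
rewrite exchange_big /=; under eq_bigr do rewrite exchange_big /=.
have F (p q : 'I_K) : \sum_(j < n)
     cos (p%:R * (angle n i - angle n j) - q%:R * (angle n i - angle n j)) =
    if q == p then n%:R else 0.
  case: eqP => [->|/eqP pq].
    under eq_bigr do rewrite subrr cos0; by rewrite sumr_const card_ord.
  wlog ltpq : p q pq / (p < q)%N.
    move=> W; case: (ltngtP p q) => [|qp|/val_inj e]; first exact: W.
      apply: etrans (W q p _ qp); last by rewrite eq_sym.
      by apply: eq_bigr => j _; rewrite -cosN opprB.
    by rewrite e eqxx in pq.
  apply: etrans (@sum_cos_grid n (q - p) (- (q - p)%N%:R * angle n i) _).
    by apply: eq_bigr => j _; congr cos; rewrite natrB ?(ltnW ltpq)//; ring.
  by rewrite subn_gt0 ltpq/= (leq_ltn_trans (leq_subr _ _))// (leq_trans _ Kn).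
under eq_bigr do under eq_bigr do rewrite F.
under eq_bigr do rewrite -big_mkcond /= big_pred1_eq.
by rewrite sumr_const card_ord mulr_natr.
Qed.

Lemma sum_fejer2 n K (x : 'I_n * 'I_n) : (K <= n)%N ->
  \sum_y fejer (@phase2 n K) x y = (n%:R * K%:R) ^+ 2.
Proof.
move=> Kn; under eq_bigr do rewrite fejer_prod.
rewrite -(pair_big xpredT xpredT (fun i j =>
  fejer (@phase1 n K) x.1 i * fejer (@phase1 n K) x.2 j)) /=.
by rewrite -big_distrlr /= !sum_fejer1.
Qed.

End Torus.

(** * Riemann sums of functions with vanishing line integrals *)

Section GridSums.
Variable R : realType.
Implicit Types (n K : nat) (a t x y C : R).

Lemma gridS n i : grid R n i.+1 = grid R n i + 8 / n%:R.
Proof. by rewrite /grid -[i.+1]addn1 natrD mulrDr mulr1 mulrDl addrA. Qed.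

Lemma grid0 n : grid R n 0 = -4.
Proof. by rewrite /grid mulr0 mul0r addr0. Qed.

Lemma gridn n : (0 < n)%N -> grid R n n = 4.
Proof. by move=> n0; rewrite /grid mulfK ?pnatr_eq0 ?gt_eqF//; ring. Qed.

(** One more grid step changes only the two end terms, taken within distance 1 of 4 and -4, where
    [f] vanishes. *)
Lemma sum_shift_int n c (f : R -> R) : (0 < n)%N ->
  c%:R * (8 / n%:R) <= 1 :> R -> (forall x, 2 < `|x| -> f x = 0) ->
  \sum_(i < n) f (grid R n i + c%:R * (8 / n%:R)) = \sum_(i < n) f (grid R n i).
Proof.
move=> n0; have e0 : 0 < 8 / n%:R :> R by rewrite divr_gt0 ?ltr0n.
elim: c => [|c IH] cle f0; first by under eq_bigr do rewrite mul0r addr0.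
have cle' : c%:R * (8 / n%:R) <= 1 :> R.
  by apply: le_trans cle; rewrite ler_pM2r// ler_nat.
rewrite -IH //.
apply/eqP; rewrite -subr_eq0 -sumrB; apply/eqP.
pose g i := f (grid R n i + c%:R * (8 / n%:R)).
transitivity (\sum_(i < n) (g i.+1 - g i)).
  apply: eq_bigr => i _; rewrite /g gridS -[c.+1]addn1 natrD mulrDl mul1r addrA.
  by rewrite addrAC.
rewrite -(big_mkord xpredT (fun i => g i.+1 - g i)) telescope_sumr// /g.
have c0 : 0 <= c%:R * (8 / n%:R) :> R by rewrite mulr_ge0// ltW.
rewrite gridn// grid0 !f0 ?subrr//; rewrite lter_normr; apply/orP.
  by right; lra.
by left; lra.
Qed.

(** The shift is rounded down to a multiple of the mesh 8/n, which costs at most C (8/n) at each of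
    the n points. *)
Lemma sum_shift_pos n a C (f : R -> R) : (8 <= n)%N -> 0 <= a <= 1 ->
  (forall x y, `|f x - f y| <= C * `|x - y|) ->
  (forall x, 2 < `|x| -> f x = 0) ->
  `|\sum_(i < n) f (grid R n i + a) - \sum_(i < n) f (grid R n i)| <= 8 * C.
Proof.
move=> n8 /andP[a0 a1] fC f0.
have n0 : 0 < n%:R :> R by rewrite ltr0n (leq_trans _ n8).
pose e : R := 8 / n%:R; have e0 : 0 < e by rewrite divr_gt0.
pose c := Num.truncn (a / e).
have /andP[c1 c2] : c%:R <= a / e < c.+1%:R.
  by apply: truncn_itv; rewrite divr_ge0 ?(ltW e0).
have ce : c%:R * e <= a by rewrite -ler_pdivlMr.
have ce' : a - c%:R * e <= e.
  by move: c2; rewrite ltr_pdivrMr// -[c.+1]addn1 natrD mulrDl mul1r; lra.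
have C0 : 0 <= C.
  by have := fC 1 0; rewrite subr0 normr1 mulr1; apply: le_trans.
rewrite -(@sum_shift_int n c f) ?(leq_trans _ n8)//; last by rewrite -/e; lra.
rewrite -sumrB; apply: le_trans (ler_norm_sum _ _ _) _.
apply: (@le_trans _ _ (\sum_(i < n) C * e)).
  apply: ler_sum => i _; apply: le_trans (fC _ _) _; rewrite ler_wpM2l//.
  by have -> : grid R n i + a - (grid R n i + c%:R * (8 / n%:R)) =
    a - c%:R * e; [rewrite /e; ring | rewrite ger0_norm; lra].
rewrite sumr_const card_ord -(mulr_natr _ n) /e.
suff -> : C * (8 / n%:R) * n%:R = 8 * C by [].
by field; rewrite gt_eqF.
Qed.

Lemma sum_shift n a C (f : R -> R) : (8 <= n)%N -> `|a| <= 1 ->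
  (forall x y, `|f x - f y| <= C * `|x - y|) ->
  (forall x, 1 < `|x| -> f x = 0) ->
  `|\sum_(i < n) f (grid R n i + a) - \sum_(i < n) f (grid R n i)| <= 8 * C.
Proof.
move=> n8 a1 fC f0; have [a0|a0] := leP 0 a.
  apply: sum_shift_pos => //; first by rewrite a0 -(ger0_norm a0).
  by move=> x x2; apply: f0; lra.
rewrite distrC; move: a1; rewrite ltr0_norm// => a1.
(* A negative shift is undone by a positive one applied to the translated function. That one is
   supported in |x| <= 2, which is why the positive case allows this radius. *)
have := @sum_shift_pos n (- a) C (fun x => f (x + a)) n8.
under eq_bigr do rewrite subrK; apply.
- by lra.
- by move=> x y; apply: le_trans (fC _ _) _; rewrite opprD addrACA subrr addr0.
- move=> x x2; apply: f0; have := ler_distD a x 0; move: x2.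
  have := ler_normB (x + a) a; rewrite addrK (ltr0_norm a0); lra.
Qed.

(** [D] stands for the integral: it is constant on each side of [-1, 1], so D 4 = D (-4) and its
    increments over the cells add up to 0. By the mean value theorem, a cell of width e = 8/n
    differs from its Riemann term by at most C e^2. *)
Lemma sum_line n C (D G : R -> R) : (0 < n)%N ->
  (forall t, is_derive t 1 D (G t)) ->
  (forall s t, `|G s - G t| <= C * `|s - t|) ->
  (forall t, 1 < `|t| -> G t = 0) -> D (-1) = D 1 ->
  `|\sum_(i < n) G (grid R n i)| <= 8 * C.
Proof.
move=> n0 dD GC G0 D11.
have cD t : {for t, continuous D}.
  by apply/differentiable_continuous/derivable1_diffP; have [] := dD t.
have mvt a b : a < b -> exists2 c, c \in `]a, b[ & D b - D a = G c * (b - a).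
  move=> ab; apply: (MVT ab (fun x _ => dD x)).
  by apply: continuous_subspaceT => x; exact: cD.
have D4 : D 4 = D (-4).
  have H a b : a < b -> (forall t, t \in `]a, b[ -> 1 < `|t|) -> D b = D a.
    move=> ab h; have [c /h c1] := mvt a b ab.
    by rewrite G0// mul0r => /eqP; rewrite subr_eq0 => /eqP.
  rewrite (H 1 4) -?D11 ?(H (-4) (-1)) //; try lra.
    by move=> t; rewrite in_itv/= => /andP[? ?]; rewrite lter_normr; apply/orP; right; lra.
  by move=> t; rewrite in_itv/= => /andP[? ?]; rewrite lter_normr; apply/orP; left; lra.
have nR : 0 < n%:R :> R by rewrite ltr0n.
pose e : R := 8 / n%:R; have e0 : 0 < e by rewrite divr_gt0.
rewrite -(ler_pM2l e0) -{1}(gtr0_norm e0) -normrM.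
have -> : e * \sum_(i < n) G (grid R n i) =
    \sum_(i < n) (e * G (grid R n i) - (D (grid R n i.+1) - D (grid R n i))).
  rewrite sumrB -(big_mkord xpredT (fun i => D (grid R n i.+1) - D (grid R n i))).
  by rewrite telescope_sumr// gridn// grid0 D4 subrr subr0 mulr_sumr.
apply: le_trans (ler_norm_sum _ _ _) _.
apply: (@le_trans _ _ (\sum_(i < n) e * (C * e))); last first.
  rewrite sumr_const card_ord -(mulr_natr _ n).
  suff -> : e * (C * e) * n%:R = e * (8 * C) by [].
  by rewrite /e; field; rewrite gt_eqF.
apply: ler_sum => i _.
have [|c] := mvt (grid R n i) (grid R n i.+1); first by rewrite gridS -/e; lra.
rewrite in_itv/= => /andP[c1 c2]; have ge := gridS n i; rewrite -/e in ge.
move=> ->; have -> : grid R n i.+1 - grid R n i = e by rewrite ge; ring.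
rewrite [_ * e]mulrC -mulrBr normrM (gtr0_norm e0) ler_pM2l//.
have C0 : 0 <= C.
  by have := GC 1 0; rewrite subr0 normr1 mulr1; apply: le_trans.
apply: le_trans (GC _ _) _; rewrite ler_wpM2l// distrC gtr0_norm; lra.
Qed.

(** The grid is sheared so that its columns become lines of slope [tau], each contributing at most
    8C by [sum_line]. Undoing the shear shifts every relevant row by at most 1, again at a cost of
    8C. The gain is a bound of order n for a sum of n^2 terms. *)
Lemma sum_grid2 n C tau (g : R -> R -> R) : (8 <= n)%N -> `|tau| <= 1 ->
  (forall x y, 1 < `|x| -> g x y = 0) -> (forall x y, 1 < `|y| -> g x y = 0) ->
  (forall x x' y, `|g x y - g x' y| <= C * `|x - x'|) ->
  (forall u s t, `|g (u + s * tau) s - g (u + t * tau) t| <= C * `|s - t|) ->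
  (forall u, exists D : R -> R,
     (forall t, is_derive t 1 D (g (u + t * tau) t)) /\ D (-1) = D 1) ->
  `|\sum_(i < n) \sum_(j < n) g (grid R n i) (grid R n j)| <= 16 * C * n%:R.
Proof.
move=> n8 t1 gx gy gr gl gD; have n0 : (0 < n)%N by exact: leq_trans n8.
have C0 : 0 <= C.
  by have := gr 1 0 0; rewrite subr0 normr1 mulr1; apply: le_trans.
pose S := \sum_(i < n) \sum_(j < n) g (grid R n i + grid R n j * tau) (grid R n j).
have S1 : `|S| <= 8 * C * n%:R.
  apply: le_trans (ler_norm_sum _ _ _) _.
  rewrite -[n in leRHS]card_ord mulr_natr -sumr_const; apply: ler_sum => i _.
  have [D [dD D11]] := gD (grid R n i).
  apply: (sum_line n0 dD) => // t t1'; exact: gy.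
have S2 : `|S - \sum_(i < n) \sum_(j < n) g (grid R n i) (grid R n j)| <=
    8 * C * n%:R.
  rewrite /S exchange_big [X in _ - X]exchange_big -sumrB /=.
  apply: le_trans (ler_norm_sum _ _ _) _.
  rewrite -[n in leRHS]card_ord mulr_natr -sumr_const; apply: ler_sum => j _.
  have [j1|j1] := leP `|grid R n j| 1; last first.
    by rewrite !big1 ?subrr ?normr0 ?mulr_ge0// => i _; rewrite gy.
  apply: (@sum_shift n (grid R n j * tau) C (fun x => g x (grid R n j))) => //.
    by rewrite normrM mulr_ile1.
  by move=> x x1; exact: gx.
move: S1 S2; rewrite -mulrA; set X := \sum_(i < n) _ => S1 S2.
have := ler_normB S (S - X); rewrite subKr; lra.
Qed.

End GridSums.

(** * Fourier coefficients with frequencies in one chart of slopes *)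

Section ChartBound.
Variable R : realType.
Implicit Types (n K : nat) (d C u s t tau : R) (h : R -> R -> R).

Lemma cos_lip s t : `|cos s - cos t| <= `|s - t|.
Proof.
wlog st : s t / s < t.
  move=> W; have [st|ts|->] := ltgtP s t; first exact: W.
    by rewrite distrC [leRHS]distrC; exact: W.
  by rewrite !subrr.
have [c _ E] := MVT st (fun x _ => is_derive_cos x)
  (continuous_subspaceT (@continuous_cos R)).
by rewrite distrC [leRHS]distrC E normrM normrN ler_piMl// sin_max.
Qed.

Lemma sin_lip s t : `|sin s - sin t| <= `|s - t|.
Proof.
have := cos_lip (s - pi / 2) (t - pi / 2); rewrite !cosBpihalf.
by have -> : s - pi / 2 - (t - pi / 2) = s - t by ring.
Qed.

(** A product rule for a factor [b] that is controlled only on [P], off which [a] vanishes. If just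
    [s] lies in [P], the difference is (a s - a t) b s, so [b t] never enters. *)
Lemma lip_mul_cutoff (P : R -> Prop) (A B Ca Cb : R) (a b : R -> R) :
  0 <= A -> 0 <= B -> 0 <= Cb ->
  (forall s, ~ P s -> a s = 0) -> (forall s, `|a s| <= A) ->
  (forall s t, `|a s - a t| <= Ca * `|s - t|) ->
  (forall s, P s -> `|b s| <= B) ->
  (forall s t, P s -> P t -> `|b s - b t| <= Cb * `|s - t|) ->
  forall s t, `|a s * b s - a t * b t| <= (Ca * B + A * Cb) * `|s - t|.
Proof.
move=> A0 B0 Cb0 aP aA aC bB bC.
have half s t : P s -> ~ P t ->
    `|a s * b s - a t * b t| <= (Ca * B + A * Cb) * `|s - t|.
  move=> Ps nPt; have E : a s * b s - a t * b t = (a s - a t) * b s.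
    by rewrite (aP t nPt); ring.
  rewrite E normrM mulrDl; apply: (@le_trans _ _ (Ca * B * `|s - t|)).
    by rewrite mulrAC; apply: ler_pM => //; exact: bB.
  by rewrite lerDl !mulr_ge0.
move=> s t; have [Ps|nPs] := pselect (P s); have [Pt|nPt] := pselect (P t).
- have -> : a s * b s - a t * b t = (a s - a t) * b s + a t * (b s - b t) by ring.
  apply: le_trans (ler_normD _ _) _; rewrite !normrM mulrDl; apply: lerD.
    by rewrite mulrAC; apply: ler_pM => //; exact: bB.
  by rewrite -mulrA; apply: ler_pM => //; exact: bC.
- exact: half.
- by rewrite distrC [`|s - t|]distrC; exact: half.
- rewrite (aP s nPs) (aP t nPt) !mul0r subrr normr0.
  have Ca0 : 0 <= Ca * `|s - t| by apply: le_trans (aC s t).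
  by rewrite mulrDl mulrAC addr_ge0 //; [exact: mulr_ge0|rewrite !mulr_ge0].
Qed.

Definition box_supported h :=
  forall x y, 1 < `|x| \/ 1 < `|y| -> h x y = 0.

Definition lip2 C h :=
  forall x x' y y', `|h x y - h x' y'| <= C * (`|x - x'| + `|y - y'|).

Lemma lip2_ge0 C h : lip2 C h -> 0 <= C.
Proof.
move=> hC; have := hC 1 0 0 0; rewrite subr0 normr1 subrr normr0 addr0 mulr1.
exact: le_trans.
Qed.

Lemma lip2_bound C h : box_supported h -> lip2 C h ->
  forall x y, `|h x y| <= 3 * C.
Proof.
move=> h0 hC x y; have C0 := lip2_ge0 hC.
have [y1|y1] := leP `|y| 1; last by rewrite h0 ?normr0 ?mulr_ge0//; right.
have h2 : h x 2 = 0 by apply: h0; right; rewrite ger0_norm; lra.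
have := hC x x y 2; rewrite h2 subr0 subrr normr0 add0r => /le_trans; apply.
rewrite mulrC ler_wpM2r//; apply: le_trans (ler_normB _ _) _.
by rewrite (@ger0_norm _ 2)//; lra.
Qed.

(* Weights on the lines [t |-> (u + t tau, t)], [|tau| <= 1]: uniformly close to
   1, with a small Lipschitz constant in the slope [tau]; the last clause says
   that the weighted integral of [h] over each such line vanishes. *)
Definition chart_weight d C h (w : R -> R -> R -> R) : Prop :=
  [/\ forall x y tau, `|x| <= 1 -> `|y| <= 1 -> `|tau| <= 1 ->
        `|w x y tau - 1| <= d,
      forall x y tau tau', `|x| <= 1 -> `|y| <= 1 -> `|tau| <= 1 ->
        `|tau'| <= 1 -> `|w x y tau - w x y tau'| <= d * `|tau - tau'|,
      forall x x' y tau, `|x| <= 1 -> `|x'| <= 1 -> `|y| <= 1 -> `|tau| <= 1 ->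
        `|w x y tau - w x' y tau| <= C * `|x - x'|,
      forall u s t tau, `|tau| <= 1 -> `|s| <= 1 -> `|t| <= 1 ->
        `|u + s * tau| <= 1 -> `|u + t * tau| <= 1 ->
        `|w (u + s * tau) s tau - w (u + t * tau) t tau| <= C * `|s - t| &
      forall u tau, `|tau| <= 1 -> exists D : R -> R,
        (forall t, is_derive t 1 D (h (u + t * tau) t * w (u + t * tau) t tau)) /\
        D (-1) = D 1].

Section Frequency.
Variable K : nat.
Implicit Types p q : 'I_K * 'I_K.

Definition freq1 p q : R := p.1%:R - q.1%:R.
Definition freq2 p q : R := p.2%:R - q.2%:R.
(** Frequencies whose lines of constant phase have the form x = u + t tau with |tau| <= 1. The
    remaining ones satisfy this after exchanging the coordinates. *)
Definition in_chart p q := `|freq2 p q| <= `|freq1 p q|.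
(* On the lines of this slope the phase of frequency [p - q] is constant.  For
   [p = q] the convention [0 / 0 = 0] gives the slope 0. *)
Definition slope p q := - freq2 p q / freq1 p q.

Lemma slope_le1 p q : in_chart p q -> `|slope p q| <= 1.
Proof.
rewrite /in_chart /slope => pq; rewrite normrM normrN normfV.
have [->|f0] := eqVneq (freq1 p q) 0; first by rewrite normr0 invr0 mulr0.
by rewrite ler_pdivrMr ?normr_gt0// mul1r.
Qed.

Lemma slopeP p q : in_chart p q -> freq2 p q = - (freq1 p q * slope p q).
Proof.
rewrite /in_chart /slope => pq; have [f0|f0] := eqVneq (freq1 p q) 0.
  by move: pq; rewrite f0 normr0 mul0r oppr0 normr_le0 => /eqP.
by field.
Qed.

Lemma freq1_le p q : `|freq1 p q| <= K%:R.
Proof.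
rewrite /freq1; have H (i : 'I_K) : 0 <= (i%:R : R) <= K%:R.
  by rewrite ler0n ler_nat ltnW.
by have := H p.1; have := H q.1; rewrite ler_norml; lra.
Qed.

(** A nonzero [freq1 p q] is an integer of modulus below [K], hence divides K!. All slopes thus lie
    on one finite grid of 2 K! steps, the range of the telescoping. *)
Lemma slope_grid p q : in_chart p q ->
  exists2 i, (i <= K`!.*2)%N & slope p q = -1 + i%:R / K`!%:R.
Proof.
move=> pq; have F0 : 0 < K`!%:R :> R by rewrite ltr0n fact_gt0.
have [z zE] : exists z : int, slope p q * K`!%:R = z%:~R.
  have f1E : freq1 p q = ((p.1 : nat)%:Z - (q.1 : nat)%:Z)%:~R.
    by rewrite /freq1 intrB.
  have f2E : freq2 p q = ((p.2 : nat)%:Z - (q.2 : nat)%:Z)%:~R.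
    by rewrite /freq2 intrB.
  have [f0|f0] := eqVneq (freq1 p q) 0.
    by exists 0; rewrite /slope f0 invr0 mulr0 mul0r.
  set a := (p.1 : nat)%:Z - (q.1 : nat)%:Z in f1E.
  have a0 : a != 0 by apply: contraNneq f0 => a0; rewrite f1E a0.
  have : (a %| K`!%:Z)%Z.
    rewrite /dvdz; apply: dvdn_fact; rewrite absz_gt0 a0/=.
    by rewrite /a; have := ltn_ord p.1; have := ltn_ord q.1; lia.
  move=> /dvdzP[b bE]; exists (- ((p.2 : nat)%:Z - (q.2 : nat)%:Z) * b).
  have -> : K`!%:R = b%:~R * freq1 p q :> R.
    by rewrite f1E -intrM -bE pmulrn.
  by rewrite intrM mulrNz -f2E /slope; field.
have := slope_le1 pq; rewrite ler_norml => /andP[s1 s2].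
have z1 : - K`!%:Z <= z.
  rewrite -(ler_int R) -zE mulrNz -pmulrn -mulN1r ler_pM2r//.
have z2 : z <= K`!%:Z.
  by rewrite -(ler_int R) -zE -pmulrn -[leRHS]mul1r ler_pM2r//.
exists (absz (z + K`!%:Z)); first by lia.
have -> : (absz (z + K`!%:Z))%:R = (z + K`!%:Z)%:~R :> R.
  by rewrite pmulrn gez0_abs//; lia.
by rewrite intrD -zE -pmulrn; field; rewrite gt_eqF.
Qed.

End Frequency.

Definition sample n h (x : 'I_n * 'I_n) : R := h (grid R n x.1) (grid R n x.2).

Lemma power_split n K (p q : 'I_K * 'I_K) (a b c : 'I_n * 'I_n -> R) :
  (forall x, a x = b x - c x) ->
  power (@phase2 R n K) a p q <=
  2 * power (@phase2 R n K) b p q + 2 * power (@phase2 R n K) c p q.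
Proof.
move=> abc; rewrite /power.
have E (T : 'I_n * 'I_n -> R) :
    \sum_x a x * T x = \sum_x b x * T x - \sum_x c x * T x.
  by rewrite -sumrB; apply: eq_bigr => x _; rewrite abc mulrBl.
have sq (r s : R) : (r - s) ^+ 2 <= 2 * r ^+ 2 + 2 * s ^+ 2.
  by have := sqr_ge0 (r + s); nra.
rewrite !E !mulrDr addrACA; apply: lerD; exact: sq.
Qed.

(** On lines of slope [slope p q] the cosine or sine is constant and factors out of the weighted
    line integral, which vanishes by the last clause of [chart_weight]. So [sum_grid2] makes the
    coefficient O(n), where the trivial bound is of order n^2. *)
Lemma power_weighted n K (p q : 'I_K * 'I_K) d C h w : (8 <= n)%N ->
  0 <= d <= 1 -> box_supported h -> lip2 C h -> chart_weight d C h w ->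
  in_chart p q ->
  power (@phase2 R n K)
    (fun x => sample h x * w (grid R n x.1) (grid R n x.2) (slope p q)) p q <=
  2 * (16 * (4 * C + 3 * C * C + 6 * C * K%:R) * n%:R) ^+ 2.
Proof.
move=> n8 /andP[d0 d1] h0 hC [w1 _ w3 w4 w5] pq; have C0 := lip2_ge0 hC.
have s1 := slope_le1 pq; set tau := slope p q in s1 *.
have hb := lip2_bound h0 hC.
pose hw x y := h x y * w x y tau.
have w2 x y : `|x| <= 1 -> `|y| <= 1 -> `|w x y tau| <= 2.
  move=> x1 y1; have := w1 x y tau x1 y1 s1; have := ler_normD (w x y tau - 1) 1.
  by rewrite subrK normr1; lra.
have hwb x y : `|hw x y| <= 6 * C.
  rewrite /hw; have [x1|x1] := leP `|x| 1; last by rewrite h0 ?mul0r ?normr0 ?mulr_ge0//; left.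
  have [y1|y1] := leP `|y| 1; last by rewrite h0 ?mul0r ?normr0 ?mulr_ge0//; right.
  have -> : 6 * C = 3 * C * 2 by ring.
  by rewrite normrM ler_pM// w2.
have box s t : ~ (`|s| <= 1 /\ `|t| <= 1) -> h s t = 0.
  move=> nst; apply: h0; have [s1'|] := leP `|s| 1; last by left.
  by have [t1|] := leP `|t| 1; [have := nst (conj s1' t1) | right].
have hwr x x' y : `|hw x y - hw x' y| <= (C * 2 + 3 * C * C) * `|x - x'|.
  apply: (@lip_mul_cutoff (fun s => `|s| <= 1 /\ `|y| <= 1) _ _ _ _
    (fun s => h s y) (fun s => w s y tau)) => //; rewrite ?mulr_ge0//.
  - by move=> s /box.
  - by move=> s t; have := hC s t y y; rewrite subrr normr0 addr0.
  - by move=> s [? ?]; exact: w2.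
  - by move=> s t [? ?] [? _]; exact: w3.
have hwl u s t : `|hw (u + s * tau) s - hw (u + t * tau) t| <=
    (2 * C * 2 + 3 * C * C) * `|s - t|.
  apply: (@lip_mul_cutoff (fun s => `|u + s * tau| <= 1 /\ `|s| <= 1) _ _ _ _
    (fun s => h (u + s * tau) s) (fun s => w (u + s * tau) s tau)) => //;
    rewrite ?mulr_ge0//.
  - by move=> {}s /box.
  - move=> {}s {}t; apply: le_trans (hC _ _ _ _) _.
    rewrite opprD addrACA subrr add0r -mulrBl normrM -mulrA mulrCA ler_wpM2l//.
    by have := ler_piMr (normr_ge0 (s - t)) s1; lra.
  - by move=> {}s [? ?]; exact: w2.
  - by move=> {}s {}t [? ?] [? ?]; exact: w4.
(* A common Lipschitz constant for [hw] times the cosine or sine, along the lines and across them;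
   the oscillation across the lines contributes 6 C K. *)
pose C' := 4 * C + 3 * C * C + 6 * C * K%:R.
pose ph x y : R := freq1 p q * (pi / 4) * x + freq2 p q * (pi / 4) * y.
have phE (x : 'I_n * 'I_n) : phase2 R p x - phase2 R q x =
    ph (grid R n x.1) (grid R n x.2).
  by rewrite /phase2 /ph /freq1 /freq2 /angle; ring.
have phl u t : ph (u + t * tau) t = freq1 p q * (pi / 4) * u.
  by rewrite /ph (slopeP pq) -/tau; ring.
have pi4 : pi / 4 <= 1 :> R by have := @pihalf_lt2 R; lra.
have pi40 : 0 <= pi / 4 :> R by have := @pi_ge0 R; lra.
have phr x x' y : `|ph x y - ph x' y| <= K%:R * `|x - x'|.
  have -> : ph x y - ph x' y = freq1 p q * (pi / 4) * (x - x') by rewrite /ph; ring.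
  rewrite normrM ler_wpM2r// normrM (ger0_norm pi40) -[leRHS]mulr1.
  by apply: ler_pM => //; exact: freq1_le.
have key (T : R -> R) : (forall s, `|T s| <= 1) ->
    (forall s t, `|T s - T t| <= `|s - t|) ->
    `|\sum_(x : 'I_n * 'I_n) (sample h x * w (grid R n x.1) (grid R n x.2) tau) *
       T (phase2 R p x - phase2 R q x)| <= 16 * C' * n%:R.
  move=> T1 TL; under eq_bigr do rewrite phE.
  rewrite -(pair_bigA _ (fun i j : 'I_n => hw (grid R n i) (grid R n j) *
    T (ph (grid R n i) (grid R n j)))) /=.
  have box' x y : 1 < `|x| \/ 1 < `|y| -> hw x y * T (ph x y) = 0.
    by move=> xy; rewrite /hw h0// !mul0r.
  apply: (@sum_grid2 _ _ _ tau (fun x y => hw x y * T (ph x y))) => //.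
  - by move=> x y x1; apply: box'; left.
  - by move=> x y x1; apply: box'; right.
  - move=> x x' y.
    have L : `|hw x y * T (ph x y) - hw x' y * T (ph x' y)| <=
        ((C * 2 + 3 * C * C) * 1 + 6 * C * K%:R) * `|x - x'|.
      apply: (@lip_mul_cutoff (fun=> True) _ _ _ _
        (fun s => hw s y) (fun s => T (ph s y))) => //; rewrite ?mulr_ge0//.
      by move=> s t _ _; apply: le_trans (TL _ _) _; exact: phr.
    by apply: le_trans L _; rewrite ler_wpM2r// /C'; lra.
  - move=> u s t; rewrite !phl -mulrBl normrM.
    apply: (@le_trans _ _ (`|hw (u + s * tau) s - hw (u + t * tau) t| * 1)).
      by rewrite ler_wpM2l.
    rewrite mulr1; apply: le_trans (hwl _ _ _) _; rewrite ler_wpM2r// /C'.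
    by have : 0 <= C * K%:R; [rewrite mulr_ge0|lra].
  - move=> u; have [D [dD D11]] := w5 u tau s1.
    exists (fun t => T (freq1 p q * (pi / 4) * u) * D t); split; last by rewrite D11.
    move=> t; rewrite phl [X in is_derive _ _ _ X]mulrC; have dDt := dD t.
    exact: is_deriveZ.
have sq (r : R) : `|r| <= 16 * C' * n%:R -> r ^+ 2 <= (16 * C' * n%:R) ^+ 2.
  move=> rC; rewrite -[r ^+ 2]real_normK ?num_real// ler_sqr ?nnegrE//.
  exact: le_trans rC.
rewrite /power mulr_natl mulr2n.
by apply: lerD; apply: sq; apply: key; [exact: cos_max | exact: cos_lip |
  exact: sin_max | exact: sin_lip].
Qed.

(** Write h = h w_tau - (w_tau - 1) h with tau the slope of the frequency. The first term falls
    under [power_weighted], the second under [multiplier_bound] on the grid of slopes; squaring the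
    difference doubles 9 d^2 to 18 d^2. The constant [C'] depends on [K] but not on [n]. *)
Lemma chart_bound K d C h w : 0 < d <= 1 -> box_supported h -> lip2 C h ->
  chart_weight d C h w -> exists C', forall n, (8 <= n)%N -> (K <= n)%N ->
  \sum_p \sum_(q | @in_chart K p q) power (@phase2 R n K) (@sample n h) p q <=
  18 * d ^+ 2 * ((n%:R * K%:R) ^+ 2 * \sum_x (@sample n h) x ^+ 2) +
  C' * n%:R ^+ 2.
Proof.
move=> /andP[d0 d1] h0 hC hw.
pose Cw := 16 * (4 * C + 3 * C * C + 6 * C * K%:R).
exists (K%:R ^+ 4 * (4 * Cw ^+ 2)) => n n8 Kn.
(* Pairs outside the chart get the default index 0. They only add nonnegative terms to the upper
   bound, where Bessel's inequality needs the sum over all pairs. *)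
pose idx (p q : 'I_K * 'I_K) : nat := if pselect (in_chart p q) is left H
  then s2val (cid2 (slope_grid H)) else 0%N.
have idxP p q : in_chart p q -> slope p q = -1 + (idx p q)%:R / K`!%:R.
  by rewrite /idx; case: pselect => // H _; case: cid2.
have idxL p q : (idx p q <= K`!.*2)%N.
  by rewrite /idx; case: pselect => // H; case: cid2.
pose b i (x : 'I_n * 'I_n) :=
  w (grid R n x.1) (grid R n x.2) (-1 + i%:R / K`!%:R) - 1.
have F0 : 0 < K`!%:R :> R by rewrite ltr0n fact_gt0.
have slope1 i : (i <= K`!.*2)%N -> `|-1 + i%:R / K`!%:R| <= 1 :> R.
  move=> iK; have : i%:R / K`!%:R <= 2 :> R.
    by rewrite ler_pdivrMr// -natrM ler_nat mul2n.
  have : 0 <= i%:R / K`!%:R :> R by rewrite divr_ge0// ltW.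
  by rewrite ler_norml; lra.
have [w1 w2 _ _ _] := hw.
have supp (x : 'I_n * 'I_n) (r e : R) : 0 <= e -> (`|grid R n x.1| <= 1 ->
    `|grid R n x.2| <= 1 -> `|r| <= e) -> `|r * sample h x| <= e * `|sample h x|.
  move=> e0 H; have [x1|x1] := leP `|grid R n x.1| 1; last first.
    by rewrite /sample h0 ?mulr0 ?normr0 ?mulr0//; left.
  have [x2|x2] := leP `|grid R n x.2| 1; last first.
    by rewrite /sample h0 ?mulr0 ?normr0 ?mulr0//; right.
  by rewrite normrM ler_wpM2r// H.
have MB := @multiplier_bound R _ _ (@phase2 R n K) ((n%:R * K%:R) ^+ 2)
  (fun x => @sum_fejer2 R n K x Kn) (@sample n h) b idx K`! d d0 (fact_gt0 K) idxL.
apply: (@le_trans _ _ (\sum_p \sum_q (4 * (Cw * n%:R) ^+ 2 +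
    2 * power (@phase2 R n K) (fun x => b (idx p q) x * sample h x) p q))).
  apply: ler_sum => p _; rewrite big_mkcond; apply: ler_sum => q _.
  case: ifP => [pq|_]; last first.
    by apply: addr_ge0; apply: mulr_ge0 => //; [exact: sqr_ge0|exact: power_ge0].
  apply: le_trans (@power_split n K p q (@sample n h)
    (fun x => sample h x * w (grid R n x.1) (grid R n x.2) (slope p q))
    (fun x => b (idx p q) x * sample h x) _) _.
    by move=> x; rewrite /b -idxP//; ring.
  rewrite lerD2r; have := power_weighted n8 _ h0 hC hw pq.
  by rewrite (ltW d0) d1 => /(_ isT); rewrite -/Cw; lra.
under eq_bigr do rewrite big_split /= sumr_const -mulr_sumr.
rewrite big_split /= sumr_const -mulr_sumr.
rewrite !card_prod !card_ord [leRHS]addrC; apply: lerD.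
  rewrite -!mulrnA -(mulr_natr _ (_ * _)%N) !natrM.
  suff -> : K%:R ^+ 4 * (4 * Cw ^+ 2) * n%:R ^+ 2 =
    4 * (Cw * n%:R) ^+ 2 * (K%:R * K%:R * (K%:R * K%:R)) by [].
  ring.
have b0 x : `|b 0%N x * sample h x| <= d * `|sample h x|.
  by apply: supp => [|x1 x2]; [exact: ltW | rewrite /b; apply: w1 => //; exact: slope1].
have bS i x : (i < K`!.*2)%N ->
    `|(b i.+1 x - b i x) * sample h x| <= d / K`!%:R * `|sample h x|.
  move=> iK.
  apply: supp => [|x1 x2]; first by rewrite divr_ge0 ?ltW.
  have -> : b i.+1 x - b i x = w (grid R n x.1) (grid R n x.2) (-1 + i.+1%:R / K`!%:R)
      - w (grid R n x.1) (grid R n x.2) (-1 + i%:R / K`!%:R) by rewrite /b; ring.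
  apply: le_trans (w2 _ _ _ _ x1 x2 (slope1 _ iK) (slope1 _ (ltnW iK))) _.
  have -> : -1 + i.+1%:R / K`!%:R - (-1 + i%:R / K`!%:R) = K`!%:R^-1 :> R.
    by rewrite -[i.+1]addn1 natrD; ring.
  by rewrite gtr0_norm// invr_gt0.
apply: (@le_trans _ _ (2 * (9 * d ^+ 2 *
    ((n%:R * K%:R) ^+ 2 * \sum_(x : 'I_n * 'I_n) sample h x ^+ 2)))).
  by rewrite ler_pM2l//; exact: (MB b0 bS).
by rewrite le_eqVlt; apply/orP; left; apply/eqP; ring.
Qed.

End ChartBound.

(** * Uniqueness in the plane *)

Section PlaneUniqueness.
Variable R : realType.
Implicit Types (n K : nat) (d C u s t tau : R) (h : R -> R -> R).

Lemma cos_pi4_ge : 2^-1 <= cos (pi / 4) :> R.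
Proof.
have c0 : 0 <= cos (pi / 4) :> R.
  by apply: cos_ge0_pihalf; have := @pi_ge0 R; lra.
have : cos (pi / 4 *+ 2) = 0 :> R.
  by rewrite -mulrnAr -(mulr_natr _ 2) mulrA (_ : pi / 4 * 2 = pi / 2) ?cos_pihalf//; field.
rewrite cos_mulr2n mulr2n => E; rewrite leNgt; apply/negP => c1; nra.
Qed.

(** The range 5 is the largest distance from a point of [-1, 1] to one of [-4, 4]. For z <= 2 the
    half-angle formula and sin s >= s/2 on [0, pi/4] give 1 - cos >= 2 (z/8)^2; for z > 2 the cosine
    is not positive and z^2 <= 25. *)
Lemma sqr_le_1subcos z : `|z| <= 5 -> z ^+ 2 <= 32 * (1 - cos (pi / 4 * z)) :> R.
Proof.
wlog z0 : z / 0 <= z.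
  move=> W; have [z0|z0] := leP 0 z; first exact: W.
  rewrite -normrN -sqrrN -cosN -mulrN; apply: W; lra.
rewrite ger0_norm// => z5; have p0 := @pi_gt0 R; have p2 := @pi_ge2 R.
have [z2|z2] := leP z 2; last first.
  have : 0 <= cos (pi / 4 * z - pi).
    by apply: cos_ge0_pihalf; nra.
  have -> : cos (pi / 4 * z - pi) = - cos (pi / 4 * z).
    by rewrite -[in RHS](subrK pi (pi / 4 * z)) cosDpi opprK.
  by move=> ?; nra.
pose s : R := pi / 8 * z.
have s0 : 0 <= s by rewrite /s mulr_ge0// divr_ge0// ltW.
have s1 : s <= pi / 4 by rewrite /s; nra.
have sin_s : s / 2 <= sin s.
  have [->|sn0] := eqVneq s 0; first by rewrite sin0 mul0r.
  have sp : 0 < s by rewrite lt_def sn0.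
  have [c + E] := MVT sp (fun x _ => is_derive_sin x)
    (continuous_subspaceT (@continuous_sin R)).
  rewrite in_itv/= => /andP[c0 c1].
  move: E; rewrite sin0 !subr0 => ->; rewrite mulrC ler_pM2r//.
  apply: le_trans cos_pi4_ge _; apply: ltW.
  by rewrite ltr_cos// ?in_itv/=; lra.
have -> : cos (pi / 4 * z) = 1 - 2 * sin s ^+ 2.
  have -> : pi / 4 * z = s *+ 2 by rewrite /s mulr2n; field.
  by rewrite cos_mulr2n cos2sin2 mulr2n; ring.
have : z / 8 <= sin s.
  by apply: le_trans sin_s; rewrite /s; nra.
nra.
Qed.

(** With mesh 8/n, the floor [M] of r n / 8 consecutive indices starting just after a - r stay
    within r of a; r n >= 16 makes M at least r n / 16. *)
Lemma sum_grid_ge n a c r (F : nat -> R) : `|a| <= 1 -> 0 < r <= 1 ->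
  (8 <= n)%N -> 16 <= r * n%:R ->
  (forall i, 0 <= F i) -> 0 <= c -> (forall i, `|grid R n i - a| <= r -> c <= F i) ->
  r * n%:R / 16 * c <= \sum_(i < n) F i.
Proof.
rewrite ler_norml => /andP[a1 a2] /andP[r0 r1] n8 rn F0 c0 Fc.
have n0 : 0 < n%:R :> R by rewrite ltr0n (leq_trans _ n8).
pose i0 := (Num.truncn ((a + 4 - r) * n%:R / 8)).+1.
pose M := Num.truncn (r * n%:R / 8).
have /andP[i1 i2] : (i0.-1)%:R <= (a + 4 - r) * n%:R / 8 < i0%:R.
  by apply: truncn_itv; rewrite divr_ge0// mulr_ge0 ?ltW//; lra.
have /andP[M1 M2] : M%:R <= r * n%:R / 8 < M.+1%:R.
  by apply: truncn_itv; rewrite divr_ge0// mulr_ge0 ?ltW//; lra.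
have i3 : i0%:R <= (a + 4 - r) * n%:R / 8 + 1.
  by rewrite -[i0]prednK// -[i0.-1.+1]addn1 natrD; lra.
have iMn : (i0 + M <= n)%N.
  rewrite -(ler_nat R) natrD.
  have : 8 <= n%:R :> R by rewrite ler_nat.
  nra.
rewrite -(big_mkord xpredT F) (@big_cat_nat _ _ _ i0 0 n) //=; last first.
  exact: leq_trans (leq_addr _ _) iMn.
rewrite (@big_cat_nat _ _ _ (i0 + M) i0 n) //=; last exact: leq_addr.
have : r * n%:R / 16 * c <= \sum_(i0 <= i < i0 + M) F i.
  apply: (@le_trans _ _ (\sum_(i0 <= i < i0 + M) c)).
    rewrite sumr_const_nat addKn -(mulr_natl _ M) ler_wpM2r//.
    by move: M2; rewrite -[M.+1]addn1 natrD; lra.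
  rewrite big_nat [leRHS]big_nat; apply: ler_sum => i /andP[ii iM]; apply: Fc.
  have gE : grid R n i - a = 8 / n%:R * (i%:R - (a + 4) * n%:R / 8).
    by rewrite /grid; field; rewrite gt_eqF.
  have -> : r = 8 / n%:R * (r * n%:R / 8) by field; rewrite gt_eqF.
  rewrite gE normrM gtr0_norm ?divr_gt0// ler_pM2l ?divr_gt0// ler_norml.
  have ir : i0%:R <= i%:R :> R by rewrite ler_nat.
  have iR : i%:R <= i0%:R + M%:R :> R by rewrite -natrD ler_nat ltnW.
  by apply/andP; split; nra.
have H a' b' : 0 <= \sum_(a' <= i < b') F i by apply: sumr_ge0.
have := H 0%N i0; have := H (i0 + M)%N n.
set S1 := \sum_(_ <= i < _) _; set S2 := \sum_(_ <= i < _) _.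
set S3 := \sum_(_ <= i < _) _; lra.
Qed.

(** A nonzero value persists, up to a factor 1/2, on a square of fixed radius, which contains a
    fixed proportion of the grid points. *)
Lemma sample_mass h C : box_supported h -> lip2 C h ->
  (exists x y, h x y != 0) ->
  exists2 c, 0 < c & exists n0, forall n, (n0 <= n)%N ->
    c * n%:R ^+ 2 <= \sum_x (@sample R n h) x ^+ 2.
Proof.
move=> h0 hC [a [b hab]]; have C0 := lip2_ge0 hC.
have a1 : `|a| <= 1.
  by rewrite leNgt; apply: contra hab => a1; rewrite h0//; left.
have b1 : `|b| <= 1.
  by rewrite leNgt; apply: contra hab => b1; rewrite h0//; right.
have k0 : 0 < `|h a b| by rewrite normr_gt0.
pose r := Num.min 1 (`|h a b| / (4 * C + 1)).
have r0 : 0 < r by rewrite /r lt_min ltr01 divr_gt0//; lra.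
have r1 : r <= 1 by rewrite /r ge_min lexx.
have rC : 2 * C * r <= `|h a b| / 2.
  have : r * (4 * C + 1) <= `|h a b|.
    by rewrite -ler_pdivlMr; [rewrite /r ge_min lexx orbT|lra].
  by nra.
have near x y : `|x - a| <= r -> `|y - b| <= r -> (`|h a b| / 2) ^+ 2 <= h x y ^+ 2.
  move=> xa yb; rewrite -[h x y ^+ 2]real_normK ?num_real// ler_sqr ?nnegrE ?divr_ge0//.
  have := hC a x b y; have := ler_normD (h a b - h x y) (h x y); rewrite subrK.
  rewrite (distrC a) (distrC b).
  have : C * (`|x - a| + `|y - b|) <= C * (r + r) by rewrite ler_wpM2l// lerD.
  lra.
exists ((r / 16) ^+ 2 * (`|h a b| / 2) ^+ 2); first by rewrite mulr_gt0 ?exprn_gt0 ?divr_gt0.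
exists (8 + (Num.truncn (16 / r)).+1)%N => n nn.
have n8 : (8 <= n)%N by exact: leq_trans (leq_addr _ _) nn.
have rn : 16 <= r * n%:R.
  rewrite mulrC -ler_pdivrMr//; apply: ltW.
  have /andP[_ /lt_le_trans] : (Num.truncn (16 / r))%:R <= 16 / r < (Num.truncn (16 / r)).+1%:R.
    by apply: truncn_itv; rewrite divr_ge0// ltW.
  by apply; rewrite ler_nat (leq_trans (leq_addl _ _) nn).
rewrite -(pair_bigA _ (fun i j : 'I_n => h (grid R n i) (grid R n j) ^+ 2)) /=.
have -> : (r / 16) ^+ 2 * (`|h a b| / 2) ^+ 2 * n%:R ^+ 2 =
  r * n%:R / 16 * (r * n%:R / 16 * (`|h a b| / 2) ^+ 2) by ring.
have c0 : 0 <= (`|h a b| / 2) ^+ 2 by exact: sqr_ge0.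
have rn0 : 0 <= r * n%:R / 16 by rewrite divr_ge0// mulr_ge0// ltW.
apply: (sum_grid_ge a1 _ n8 rn (F := fun i => \sum_(j < n) h (grid R n i) (grid R n j) ^+ 2)).
- by rewrite r0.
- by move=> i; apply: sumr_ge0 => j _; exact: sqr_ge0.
- exact: mulr_ge0.
move=> i ia; apply: (sum_grid_ge b1 _ n8 rn (F := fun j => h (grid R n i) (grid R n j) ^+ 2)) => //.
- by rewrite r0.
- by move=> j; exact: sqr_ge0.
- by move=> j jb; exact: near.
Qed.

Lemma grid_itv n (i : 'I_n) : -4 <= grid R n i <= 4.
Proof.
have n0 : 0 < n%:R :> R by rewrite ltr0n (leq_ltn_trans _ (ltn_ord i)).
have : 8 * i%:R / n%:R <= 8 :> R.
  by rewrite ler_pdivrMr// ler_pM2l// ler_nat ltnW.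
have : 0 <= 8 * i%:R / n%:R :> R by rewrite divr_ge0// ?mulr_ge0// ltW.
by rewrite /grid; lra.
Qed.

(** The quadratic form in [sum_powerE] is the loss. Lipschitz regularity bounds the squared
    differences by 1 - cos of the coordinate angles, and [fejer1_cos] then saves a factor [K] in one
    of the two variables. *)
Lemma sample_energy h C n K : box_supported h -> lip2 C h -> (K <= n)%N ->
  (n%:R * K%:R) ^+ 2 * \sum_x (@sample R n h) x ^+ 2 -
    128 * C ^+ 2 * n%:R ^+ 4 * K%:R <=
  \sum_p \sum_q power (@phase2 R n K) (@sample R n h) p q.
Proof.
move=> h0 hC Kn; have C0 := lip2_ge0 hC.
rewrite (@sum_powerE _ _ _ _ _ (fun x => @sum_fejer2 R n K x Kn)) lerD2l lerN2.
pose c1 (i j : 'I_n) := 1 - cos (angle R n i - angle R n j).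
pose f1 (i j : 'I_n) := fejer (@phase1 R n K) i j.
have sub_le (r s x y : R) : `|r - s| <= C * (`|x| + `|y|) -> 
    (r - s) ^+ 2 <= 2 * C ^+ 2 * (x ^+ 2 + y ^+ 2).
  move=> rs; have : `|r - s| ^+ 2 <= (C * (`|x| + `|y|)) ^+ 2.
    by rewrite ler_sqr ?nnegrE//; exact: le_trans rs.
  rewrite real_normK ?num_real// => /le_trans; apply.
  rewrite -[x ^+ 2]real_normK ?num_real// -[y ^+ 2]real_normK ?num_real//.
  have -> : 2 * C ^+ 2 * (`|x| ^+ 2 + `|y| ^+ 2) =
    (C * (`|x| + `|y|)) ^+ 2 + C ^+ 2 * (`|x| - `|y|) ^+ 2 by ring.
  by rewrite lerDl mulr_ge0 ?sqr_ge0.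
have far (r s : R) : -4 <= r <= 4 -> `|s| <= 1 -> `|r - s| <= 5.
  by move=> r4; rewrite !ler_norml; lra.
have argE (i j : 'I_n) :
    pi / 4 * (grid R n i - grid R n j) = angle R n i - angle R n j.
  by rewrite /angle mulrBr.
(* Unless both values vanish, one of the two points lies in the unit box, so the coordinates differ
   by at most 5. *)
have diff (x y : 'I_n * 'I_n) : (sample h x - sample h y) ^+ 2 <=
    64 * C ^+ 2 * (c1 x.1 y.1 + c1 x.2 y.2).
  have hxy := hC (grid R n x.1) (grid R n y.1) (grid R n x.2) (grid R n y.2).
  have c0 i j : 0 <= c1 i j by rewrite subr_ge0 cos_le1.
  have in_box (z z' : 'I_n * 'I_n) : sample h z != 0 ->
      `|grid R n z'.1 - grid R n z.1| <= 5 /\ `|grid R n z'.2 - grid R n z.2| <= 5.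
    move=> hz; split; apply: far (grid_itv _) _; rewrite leNgt;
      by apply: contra hz => z1; rewrite /sample h0//; first [by left|by right].
  have [hx|hx] := eqVneq (sample h x) 0; last first.
    have [d1 d2] := in_box x y hx.
    apply: le_trans (sub_le _ _ _ _ hxy) _.
    move: d1 d2; rewrite distrC => /sqr_le_1subcos d1; rewrite distrC => /sqr_le_1subcos d2.
    rewrite argE in d1; rewrite argE in d2.
    have -> : 64 * C ^+ 2 * (c1 x.1 y.1 + c1 x.2 y.2) =
      2 * C ^+ 2 * (32 * c1 x.1 y.1 + 32 * c1 x.2 y.2) by ring.
    by rewrite ler_wpM2l ?mulr_ge0 ?sqr_ge0//; rewrite /c1; lra.
  have [hy|hy] := eqVneq (sample h y) 0.
    by rewrite hx hy subrr expr0n/= !mulr_ge0 ?sqr_ge0// addr_ge0.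
  have [d1 d2] := in_box y x hy.
  apply: le_trans (sub_le _ _ _ _ hxy) _.
  move: d1 d2 => /sqr_le_1subcos d1 /sqr_le_1subcos d2.
  rewrite argE in d1; rewrite argE in d2.
  have -> : 64 * C ^+ 2 * (c1 x.1 y.1 + c1 x.2 y.2) =
    2 * C ^+ 2 * (32 * c1 x.1 y.1 + 32 * c1 x.2 y.2) by ring.
  by rewrite ler_wpM2l ?mulr_ge0 ?sqr_ge0//; rewrite /c1; lra.
have f0 i j : 0 <= f1 i j by exact: fejer_ge0.
have sum1 : \sum_i \sum_j f1 i j * c1 i j <= 2 * n%:R ^+ 2.
  apply: (@le_trans _ _ (\sum_(i < n) \sum_(j < n) 2)).
    by apply: ler_sum => i _; apply: ler_sum => j _; exact: fejer1_cos.
  rewrite !sumr_const !card_ord -mulrnA -(mulr_natr _ (_ * _)%N) natrM.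
  by rewrite expr2.
have sum2 : \sum_i \sum_j f1 i j = n%:R ^+ 2 * K%:R.
  under eq_bigr do rewrite sum_fejer1//.
  by rewrite sumr_const card_ord -(mulr_natr _ n); ring.
have prodE (a b : 'I_n -> 'I_n -> R) :
    \sum_(x : 'I_n * 'I_n) \sum_(y : 'I_n * 'I_n) a x.1 y.1 * b x.2 y.2 =
    (\sum_i \sum_j a i j) * (\sum_i \sum_j b i j).
  rewrite big_distrlr /= [RHS]pair_bigA; apply: eq_bigr => x _ /=.
  by rewrite big_distrlr /= [RHS]pair_bigA.
apply: (@le_trans _ _ (2^-1 * (64 * C ^+ 2 * (2 *
    ((\sum_i \sum_j f1 i j * c1 i j) * (\sum_i \sum_j f1 i j)))))).
  rewrite ler_pM2l ?invr_gt0//.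
  rewrite (mulr_natl _ 2) mulr2n -{1}prodE [X in _ + X]mulrC -prodE -big_split /=.
  rewrite mulr_sumr; apply: ler_sum => x _.
  rewrite -big_split mulr_sumr; apply: ler_sum => y _ /=.
  rewrite fejer_prod -/(f1 _ _) -/(f1 _ _).
  have -> : 64 * C ^+ 2 * (f1 x.1 y.1 * c1 x.1 y.1 * f1 x.2 y.2 +
      f1 x.1 y.1 * (f1 x.2 y.2 * c1 x.2 y.2)) =
      64 * C ^+ 2 * (c1 x.1 y.1 + c1 x.2 y.2) * (f1 x.1 y.1 * f1 x.2 y.2) by ring.
  by rewrite ler_wpM2r ?mulr_ge0.
rewrite sum2.
have -> : 128 * C ^+ 2 * n%:R ^+ 4 * K%:R =
  2^-1 * (64 * C ^+ 2 * (2 * (2 * n%:R ^+ 2 * (n%:R ^+ 2 * K%:R)))) by field.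
by rewrite !ler_wpM2l// ?mulr_ge0 ?sqr_ge0 ?ler_wpM2r ?mulr_ge0 ?exprn_ge0.
Qed.

Lemma power_swap n K h (p q : 'I_K * 'I_K) :
  power (@phase2 R n K) (@sample R n h) p q =
  power (@phase2 R n K) (@sample R n (fun x y => h y x)) (p.2, p.1) (q.2, q.1).
Proof.
have sK : involutive (fun x : 'I_n * 'I_n => (x.2, x.1)) by case.
rewrite /power; congr (_ ^+ 2 + _ ^+ 2); rewrite (reindex_inj (inv_inj sK)).
  apply: eq_bigr => x _; rewrite /sample /phase2 /=; congr (_ * cos _).
  by congr (_ - _); exact: addrC.
apply: eq_bigr => x _; rewrite /sample /phase2 /=; congr (_ * sin _).
by congr (_ - _); exact: addrC.
Qed.

Theorem plane_uniqueness d C h w w' : 0 < d -> 72 * d ^+ 2 <= 1 ->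
  box_supported h -> lip2 C h ->
  chart_weight d C h w -> chart_weight d C (fun x y => h y x) w' ->
  forall x y, h x y = 0.
Proof.
move=> d0 d1 h0 hC hw hw' a b; apply/eqP/negPn/negP => hab.
have C0 := lip2_ge0 hC.
have dd : 0 < d <= 1 by rewrite d0; apply/idP; nra.
have h0' : box_supported (fun x y => h y x) by move=> x y [] ?; apply: h0; [right|left].
have hC' : lip2 C (fun x y => h y x).
  by move=> x x' y y'; rewrite [X in _ * X]addrC; exact: hC.
have [c c0 [n0 mass]] := sample_mass h0 hC (ex_intro _ a (ex_intro _ b hab)).
(* The main term is at least K^2 c n^4 and twice the Fejer loss is 256 C^2 K n^4; this [K] leaves an
   excess of 2 K n^4. *)
pose K := (Num.truncn ((256 * C ^+ 2 + 2) / c)).+1.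
have Kc : 256 * C ^+ 2 + 2 <= K%:R * c.
  have a0 : 0 <= (256 * C ^+ 2 + 2) / c.
    apply: divr_ge0 (ltW c0); apply: addr_ge0 (ler0n _ 2).
    exact: mulr_ge0 (ler0n _ 256) (sqr_ge0 C).
  by rewrite -ler_pdivrMr//; apply: ltW; have /andP[] := truncn_itv a0.
have K1 : 1 <= K%:R :> R by rewrite ler1n.
have [C1 B1] := chart_bound K dd h0 hC hw.
have [C2 B2] := chart_bound K dd h0' hC' hw'.
(* [C1] and [C2] depend on [K], so [n] comes after it; n > |C1| + |C2| makes the remaining error
   less than the excess. *)
pose n := (n0 + 8 + K + (Num.truncn (`|C1| + `|C2|)).+1)%N.
have nC : `|C1| + `|C2| < n%:R.
  have /andP[_ ltn1] := truncn_itv (addr_ge0 (normr_ge0 C1) (normr_ge0 C2)).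
  by apply: lt_le_trans ltn1 _; rewrite ler_nat leq_addl.
have nb : (n0 + 8 + K <= n)%N by exact: leq_addr.
clearbody n; clearbody K.
have [nn0 n8 Kn] : [/\ n0 <= n, 8 <= n & K <= n]%N.
  by split; apply: leq_trans nb; [rewrite -addnA; exact: leq_addr
    | rewrite addnAC; exact: leq_addl | exact: leq_addl].
have n1 : 1 <= n%:R :> R by rewrite ler1n; exact: leq_trans n8.
have {}mass := mass n nn0; have {}B1 := B1 n n8 Kn; have {}B2 := B2 n n8 Kn.
have energy := sample_energy h0 hC Kn.
pose sw (p : 'I_K * 'I_K) := (p.2, p.1).
have swI : injective sw by apply: inv_inj; case.
(* A frequency outside the chart lies in the chart of the transposed function; those in both are
   merely counted twice. *)
have split : \sum_p \sum_q power (@phase2 R n K) (@sample R n h) p q <=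
    \sum_p \sum_(q | @in_chart R K p q) power (@phase2 R n K) (@sample R n h) p q +
    \sum_p \sum_(q | @in_chart R K p q)
      power (@phase2 R n K) (@sample R n (fun x y => h y x)) p q.
  rewrite [X in _ <= _ + X](reindex_inj swI) -big_split; apply: ler_sum => p _ /=.
  rewrite [X in _ <= _ + X](reindex_inj swI) /= (bigID (@in_chart R K p)) /=.
  rewrite lerD2l big_mkcond [leRHS]big_mkcond; apply: ler_sum => q _.
  rewrite power_swap -/(sw p) -/(sw q).
  have -> : in_chart R (sw p) (sw q) = (`|freq1 R p q| <= `|freq2 R p q|) by [].
  case: ifPn => [|_]; last by case: ifP => // _; exact: power_ge0.
  by rewrite /in_chart -ltNge => /ltW ->.
have sumE : \sum_x (@sample R n (fun x y => h y x)) x ^+ 2 = \sum_x (@sample R n h) x ^+ 2.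
  have sK : involutive (fun x : 'I_n * 'I_n => (x.2, x.1)) by case.
  by rewrite (reindex_inj (inv_inj sK)).
rewrite sumE in B2.
set S := \sum_x (@sample R n h x) ^+ 2 in mass B1 B2 energy.
have PS0 : 0 <= (n%:R * K%:R) ^+ 2 * S.
  by apply: mulr_ge0; [exact: sqr_ge0 | apply: sumr_ge0 => x _; exact: sqr_ge0].
(* The two charts take at most 36 d^2 <= 1/2 of the main term, which is absorbed on the left. *)
have E1 : (n%:R * K%:R) ^+ 2 * S <=
    256 * C ^+ 2 * n%:R ^+ 4 * K%:R + 2 * (C1 + C2) * n%:R ^+ 2.
  have : 36 * d ^+ 2 * ((n%:R * K%:R) ^+ 2 * S) <= 2^-1 * ((n%:R * K%:R) ^+ 2 * S).
    by rewrite ler_wpM2r//; lra.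
  have := le_trans energy (le_trans split (lerD B1 B2)); lra.
have E2 : K%:R ^+ 2 * c * n%:R ^+ 4 <= (n%:R * K%:R) ^+ 2 * S.
  have -> : K%:R ^+ 2 * c * n%:R ^+ 4 = (n%:R * K%:R) ^+ 2 * (c * n%:R ^+ 2) by ring.
  by rewrite ler_wpM2l ?sqr_ge0.
have E3 : 2 * (C1 + C2) * n%:R ^+ 2 < 2 * n%:R ^+ 4.
  have -> : 2 * n%:R ^+ 4 = 2 * n%:R ^+ 2 * n%:R ^+ 2 :> R by ring.
  rewrite ltr_pM2r ?exprn_gt0 ?(lt_le_trans ltr01)// ltr_pM2l//.
  have := ler_norm C1; have := ler_norm C2; nra.
have n4 : 0 < n%:R ^+ 4 :> R by rewrite exprn_gt0// (lt_le_trans ltr01).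
have E4 : (256 * C ^+ 2 + 2) * K%:R * n%:R ^+ 4 <= K%:R ^+ 2 * c * n%:R ^+ 4.
  rewrite ler_pM2r// [K%:R ^+ 2]expr2 -mulrA [leRHS]mulrC.
  by rewrite ler_wpM2r.
have E5 : 2 * n%:R ^+ 4 <= 2 * K%:R * n%:R ^+ 4 :> R
  by rewrite (ler_pM2r n4); lra.
have key : (256 * C ^+ 2 + 2) * K%:R * n%:R ^+ 4 =
    256 * C ^+ 2 * n%:R ^+ 4 * K%:R + 2 * K%:R * n%:R ^+ 4 by ring.
rewrite key in E4; have := le_trans E4 (le_trans E2 E1); rewrite lerD2l => le4.
by have := le_lt_trans le4 (lt_le_trans E3 E5); rewrite ltxx.
Qed.

End PlaneUniqueness.

(** * Matrix-valued functions and linear differential equations *)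

Section ComplexNorm.
Variable R : realType.
Implicit Types (z w : R[i]) (m n p : nat).
Local Notation Re := complex.Re.
Local Notation Im := complex.Im.

Lemma complexP z w : Re z = Re w -> Im z = Im w -> z = w.
Proof. by case: z w => [a b] [c d] /= -> ->. Qed.

Lemma Re_add z w : Re (z + w) = Re z + Re w. Proof. by case: z w => ? ? [? ?]. Qed.
Lemma Im_add z w : Im (z + w) = Im z + Im w. Proof. by case: z w => ? ? [? ?]. Qed.
Lemma Re_opp z : Re (- z) = - Re z. Proof. by case: z. Qed.
Lemma Im_opp z : Im (- z) = - Im z. Proof. by case: z. Qed.
Lemma Re_mul z w : Re (z * w) = Re z * Re w - Im z * Im w.
Proof. by case: z w => ? ? [? ?]. Qed.
Lemma Im_mul z w : Im (z * w) = Re z * Im w + Im z * Re w.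
Proof. by case: z w => ? ? [? ?]. Qed.
Lemma Re_conj z : Re (Num.conj z) = Re z. Proof. by case: z. Qed.
Lemma Im_conj z : Im (Num.conj z) = - Im z. Proof. by case: z. Qed.

Lemma Re_sum (I : finType) (F : I -> R[i]) : Re (\sum_i F i) = \sum_i Re (F i).
Proof. exact: (big_morph (@complex.Re R) Re_add (erefl _)). Qed.
Lemma Im_sum (I : finType) (F : I -> R[i]) : Im (\sum_i F i) = \sum_i Im (F i).
Proof. exact: (big_morph (@complex.Im R) Im_add (erefl _)). Qed.

(* [R[i]] is only normed over itself; estimates use the real-valued l^1 norm,
   which is still submultiplicative. *)
Definition cnorm z : R := `|Re z| + `|Im z|.

Lemma cnorm_ge0 z : 0 <= cnorm z. Proof. exact: addr_ge0. Qed.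
Lemma cnorm0 : cnorm 0 = 0. Proof. by rewrite /cnorm /= normr0 addr0. Qed.
Lemma cnorm_add z w : cnorm (z + w) <= cnorm z + cnorm w.
Proof. by rewrite /cnorm Re_add Im_add addrACA lerD// ler_normD. Qed.
Lemma cnorm_opp z : cnorm (- z) = cnorm z.
Proof. by rewrite /cnorm Re_opp Im_opp !normrN. Qed.
Lemma cnorm_conj z : cnorm (Num.conj z) = cnorm z.
Proof. by rewrite /cnorm Re_conj Im_conj normrN. Qed.
Lemma cnorm_mul z w : cnorm (z * w) <= cnorm z * cnorm w.
Proof.
rewrite /cnorm Re_mul Im_mul.
have := ler_normB (Re z * Re w) (Im z * Im w).
have := ler_normD (Re z * Im w) (Im z * Re w).
rewrite !normrM; lra.
Qed.
Lemma cnorm_sum (I : finType) (F : I -> R[i]) :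
  cnorm (\sum_i F i) <= \sum_i cnorm (F i).
Proof.
elim/big_ind2 : _ => [|? ? ? ? h h'|//]; first by rewrite cnorm0.
by apply: le_trans (cnorm_add _ _) _; exact: lerD.
Qed.
Lemma Re_le_cnorm z : `|Re z| <= cnorm z. Proof. by rewrite lerDl. Qed.
Lemma Im_le_cnorm z : `|Im z| <= cnorm z. Proof. by rewrite lerDr. Qed.

Definition mnorm m n (A : 'M[R[i]]_(m, n)) : R := \sum_i \sum_j cnorm (A i j).

Lemma mnorm_ge0 m n (A : 'M[R[i]]_(m, n)) : 0 <= mnorm A.
Proof. by do 2!apply: sumr_ge0 => ? _; exact: cnorm_ge0. Qed.
Lemma mnorm_add m n (A B : 'M[R[i]]_(m, n)) : mnorm (A + B) <= mnorm A + mnorm B.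
Proof.
rewrite /mnorm -big_split; apply: ler_sum => i _; rewrite -big_split.
by apply: ler_sum => j _; rewrite mxE; exact: cnorm_add.
Qed.
Lemma mnorm_opp m n (A : 'M[R[i]]_(m, n)) : mnorm (- A) = mnorm A.
Proof. by do 2!apply: eq_bigr => ? _; rewrite mxE cnorm_opp. Qed.
Lemma mnorm_scale m n z (A : 'M[R[i]]_(m, n)) :
  mnorm (z *: A) <= cnorm z * mnorm A.
Proof.
rewrite mulr_sumr; apply: ler_sum => i _; rewrite mulr_sumr.
by apply: ler_sum => j _; rewrite mxE; exact: cnorm_mul.
Qed.
Lemma cnorm_le_mnorm m n (A : 'M[R[i]]_(m, n)) i j : cnorm (A i j) <= mnorm A.
Proof.
rewrite /mnorm (bigD1 i)//= (bigD1 j)//= -addrA lerDl.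
by rewrite addr_ge0// !sumr_ge0// => *; rewrite ?sumr_ge0// => *; exact: cnorm_ge0.
Qed.
Lemma mnorm_mul m n p (A : 'M[R[i]]_(m, n)) (B : 'M[R[i]]_(n, p)) :
  mnorm (A *m B) <= mnorm A * mnorm B.
Proof.
rewrite {2}/mnorm mulr_suml; apply: ler_sum => i _.
apply: (@le_trans _ _ (\sum_k cnorm (A i k) * \sum_j cnorm (B k j))).
  under [leRHS]eq_bigr do rewrite mulr_sumr.
  rewrite exchange_big; apply: ler_sum => j _ /=; rewrite mxE.
  by apply: le_trans (cnorm_sum _) _; apply: ler_sum => k _; exact: cnorm_mul.
rewrite mulr_suml; apply: ler_sum => k _; rewrite ler_wpM2l ?cnorm_ge0//.
rewrite /mnorm (bigD1 k)//= lerDl; do 2!apply: sumr_ge0 => ? _.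
exact: cnorm_ge0.
Qed.

Local Open Scope sesquilinear_scope.

Lemma mnorm_adj m n (A : 'M[R[i]]_(m, n)) : mnorm (A ^t* ) = mnorm A.
Proof.
rewrite /mnorm exchange_big; do 2!apply: eq_bigr => ? _.
by rewrite !mxE cnorm_conj.
Qed.

(** Rows have Euclidean length 1, so real and imaginary parts of all entries are at most 1 in
    modulus. *)
Lemma mnorm_unitary n (U : 'M[R[i]]_n) :
  U \is unitarymx -> mnorm U <= 2 * n%:R ^+ 2.
Proof.
move=> /unitarymxP UU.
apply: (@le_trans _ _ (\sum_(i < n) \sum_(j < n) 2)); last first.
  by rewrite !sumr_const !card_ord -mulrnA -(mulr_natr _ (_ * _)%N) natrM expr2.
apply: ler_sum => i _; apply: ler_sum => j _.
have /(congr1 (@complex.Re R)) := congr1 (fun B : 'M[R[i]]_n => B i i) UU.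
rewrite !mxE eqxx Re_sum.
under eq_bigr do rewrite !mxE Re_mul Re_conj Im_conj mulrN opprK.
rewrite (bigD1 j)//= => E.
have : 0 <= \sum_(k < n | k != j)
    (Re (U i k) * Re (U i k) + Im (U i k) * Im (U i k)).
  by apply: sumr_ge0 => k _; rewrite addr_ge0// -expr2 sqr_ge0.
move: E; set s := \sum_(_ < _ | _) _ => E s0.
have sq (r : R) : r * r <= 1 -> `|r| <= 1.
  by move=> h; rewrite ler_norml; apply/andP; split; nra.
by rewrite /cnorm -[leRHS]/(1 + 1) lerD// sq//;
  have := sqr_ge0 (Re (U i j)); have := sqr_ge0 (Im (U i j)); rewrite !expr2; lra.
Qed.

End ComplexNorm.

(** * Entrywise derivatives and continuity of matrix functions *)

Section Calculus.
Variable R : realType.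
Implicit Types (m n p : nat) (t s : R).
Local Notation Re := complex.Re.
Local Notation Im := complex.Im.
Local Open Scope sesquilinear_scope.

Definition cder (f : R -> R[i]) t (d : R[i]) : Prop :=
  is_derive t 1 (fun s => Re (f s)) (Re d) /\
  is_derive t 1 (fun s => Im (f s)) (Im d).

Definition mder m n (X : R -> 'M[R[i]]_(m, n)) t (D : 'M[R[i]]_(m, n)) : Prop :=
  forall i j, cder (fun s => X s i j) t (D i j).

Lemma cder_eq f t d d' : cder f t d -> d = d' -> cder f t d'.
Proof. by move=> ? <-. Qed.

Lemma cder_cst z t : cder (fun=> z) t 0.
Proof. by split; exact: is_derive_cst. Qed.

Lemma cderD f g t d e : cder f t d -> cder g t e ->
  cder (fun s => f s + g s) t (d + e).
Proof.
move=> [f1 f2] [g1 g2]; split.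
  under eq_fun do rewrite Re_add.
  by rewrite Re_add; exact: is_deriveD.
under eq_fun do rewrite Im_add.
by rewrite Im_add; exact: is_deriveD.
Qed.

Lemma cderM f g t d e : cder f t d -> cder g t e ->
  cder (fun s => f s * g s) t (d * g t + f t * e).
Proof.
move=> [f1 f2] [g1 g2]; split.
  under eq_fun do rewrite Re_mul.
  apply: (is_derive_eq (is_deriveB (is_deriveM f1 g1) (is_deriveM f2 g2))).
  by rewrite Re_add !Re_mul /GRing.scale /=; ring.
under eq_fun do rewrite Im_mul.
apply: (is_derive_eq (is_deriveD (is_deriveM f1 g2) (is_deriveM f2 g1))).
by rewrite Im_add !Im_mul /GRing.scale /=; ring.
Qed.

Lemma cder_conj f t d : cder f t d -> cder (fun s => Num.conj (f s)) t (Num.conj d).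
Proof.
move=> [f1 f2]; split.
  by under eq_fun do rewrite Re_conj; rewrite Re_conj.
under eq_fun do rewrite Im_conj; rewrite Im_conj; exact: is_deriveN.
Qed.

Lemma cder_sum k (f : 'I_k -> R -> R[i]) t d : (forall i, cder (f i) t (d i)) ->
  cder (fun s => \sum_i f i s) t (\sum_i d i).
Proof.
elim: k f d => [|k IH] f d fd.
  by under eq_fun do rewrite big_ord0; rewrite big_ord0; exact: cder_cst.
under eq_fun do rewrite big_ord_recr /=; rewrite big_ord_recr /=.
by apply: cderD => //; exact: (IH (fun i => f (widen_ord (leqnSn k) i))).
Qed.

Lemma mder_eq m n (X : R -> 'M[R[i]]_(m, n)) t D D' :
  mder X t D -> D = D' -> mder X t D'.
Proof. by move=> ? <-. Qed.

Lemma mder_cst m n (A : 'M[R[i]]_(m, n)) t : mder (fun=> A) t 0.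
Proof. by move=> i j; rewrite mxE; exact: cder_cst. Qed.

Lemma mderD m n (X Y : R -> 'M[R[i]]_(m, n)) t D E : mder X t D -> mder Y t E ->
  mder (fun s => X s + Y s) t (D + E).
Proof.
by move=> hX hY i j; under eq_fun do rewrite mxE; rewrite mxE; exact: cderD.
Qed.

Lemma mderM m n p (X : R -> 'M[R[i]]_(m, n)) (Y : R -> 'M[R[i]]_(n, p)) t D E :
  mder X t D -> mder Y t E ->
  mder (fun s => X s *m Y s) t (D *m Y t + X t *m E).
Proof.
move=> hX hY i j; under eq_fun do rewrite mxE.
by rewrite !mxE -big_split; apply: cder_sum => k; exact: cderM.
Qed.

Lemma mderZ m n (X : R -> 'M[R[i]]_(m, n)) z t D : mder X t D ->
  mder (fun s => z *: X s) t (z *: D).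
Proof.
move=> hX i j; under eq_fun do rewrite mxE; rewrite mxE.
by apply: cder_eq (cderM (cder_cst z t) (hX i j)) _; rewrite mul0r add0r.
Qed.

Lemma mderN m n (X : R -> 'M[R[i]]_(m, n)) t D : mder X t D ->
  mder (fun s => - X s) t (- D).
Proof.
move=> hX; have := mderZ (-1) hX; rewrite scaleN1r.
by under [in X in X -> _]eq_fun do rewrite scaleN1r.
Qed.

Lemma mder_adj m n (X : R -> 'M[R[i]]_(m, n)) t D : mder X t D ->
  mder (fun s => (X s) ^t* ) t (D ^t* ).
Proof.
by move=> hX i j; under eq_fun do rewrite !mxE; rewrite !mxE; exact: cder_conj.
Qed.

Lemma mder_comp_affine m n (X : R -> 'M[R[i]]_(m, n)) a b t D :
  mder X (a + b * t) D -> mder (fun s => X (a + b * s)) t (b%:C%C *: D).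
Proof.
move=> hX i j; have [h1 h2] := hX i j; rewrite mxE.
have aff : is_derive t 1 (fun s => a + b * s) b.
  apply: (is_derive_eq (is_deriveD (is_derive_cst a t 1)
    (is_deriveZ b (is_derive_id t 1)))).
  by rewrite /GRing.scale /= add0r mulr1.
split.
  by apply: (is_derive_eq (@is_derive1_comp _ _ (fun s => a + b * s) t _ _ h1 aff)); rewrite Re_mul /=; ring.
by apply: (is_derive_eq (@is_derive1_comp _ _ (fun s => a + b * s) t _ _ h2 aff)); rewrite Im_mul /=; ring.
Qed.

Definition mcont m n (S : set R) (X : R -> 'M[R[i]]_(m, n)) : Prop :=
  forall i j, {within S, continuous (fun t => Re (X t i j))} /\
    {within S, continuous (fun t => Im (X t i j))}.

Lemma is_derive_continuous (f : R -> R) t d : is_derive t 1 f d ->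
  {for t, continuous f}.
Proof.
by move=> [fd _]; apply/differentiable_continuous/derivable1_diffP.
Qed.

Lemma mder_mcont m n (X : R -> 'M[R[i]]_(m, n)) (D : R -> 'M[R[i]]_(m, n)) S :
  (forall t, mder X t (D t)) -> mcont S X.
Proof.
by move=> hX i j; split; apply: continuous_subspaceT => t;
  have [h1 h2] := hX t i j; exact: is_derive_continuous.
Qed.

Lemma within_continuous_sum k S (f : 'I_k -> R -> R) :
  (forall i, {within S, continuous (f i)}) ->
  {within S, continuous (fun t => \sum_i f i t)}.
Proof.
elim: k f => [|k IH] f fc.
  by under eq_fun do rewrite big_ord0; move=> x; exact: cvg_cst.
under eq_fun do rewrite big_ord_recr /=.
move=> x; apply: continuousD; last exact: fc.
exact: (IH (fun i => f (widen_ord (leqnSn k) i))).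
Qed.

Lemma mcontM m n p S (X : R -> 'M[R[i]]_(m, n)) (Y : R -> 'M[R[i]]_(n, p)) :
  mcont S X -> mcont S Y -> mcont S (fun t => X t *m Y t).
Proof.
move=> hX hY i j; split.
  under eq_fun do rewrite mxE Re_sum.
  apply: within_continuous_sum => k; under eq_fun do rewrite Re_mul.
  have [a1 a2] := hX i k; have [b1 b2] := hY k j => x.
  exact: (continuousB (continuousM (a1 x) (b1 x)) (continuousM (a2 x) (b2 x))).
under eq_fun do rewrite mxE Im_sum.
apply: within_continuous_sum => k; under eq_fun do rewrite Im_mul.
have [a1 a2] := hX i k; have [b1 b2] := hY k j => x.
exact: (continuousD (continuousM (a1 x) (b2 x)) (continuousM (a2 x) (b1 x))).
Qed.

Lemma mean_value_le (f df : R -> R) a b M : a <= b ->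
  (forall t, a < t < b -> is_derive t 1 f (df t)) ->
  {within `[a, b], continuous f} -> (forall t, a < t < b -> `|df t| <= M) ->
  `|f b - f a| <= M * (b - a).
Proof.
rewrite le_eqVlt => /orP[/eqP->|ab] fd fc fM; first by rewrite !subrr normr0 mulr0.
have fd' x : x \in `]a, b[ -> is_derive x 1 f (df x).
  by rewrite in_itv; exact: fd.
have [c /[!in_itv]/= cab ->] := MVT ab fd' fc.
rewrite normrM (@gtr0_norm _ (b - a)) ?subr_gt0// ler_pM2r ?subr_gt0//.
exact: fM.
Qed.

(** The intermediate point differs from entry to entry, so the theorem is applied to each of the 2 m
    n real components separately. *)
Lemma mnorm_mean_value m n (X D : R -> 'M[R[i]]_(m, n)) a b M : a <= b ->
  (forall t, a < t < b -> mder X t (D t)) -> mcont `[a, b] X ->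
  (forall t, a < t < b -> mnorm (D t) <= M) ->
  mnorm (X b - X a) <= 2 * (m * n)%:R * M * (b - a).
Proof.
move=> ab Xd Xc DM.
apply: (@le_trans _ _ (\sum_(i < m) \sum_(j < n) (M * (b - a) + M * (b - a)))).
  apply: ler_sum => i _; apply: ler_sum => j _; rewrite /cnorm !mxE.
  rewrite Re_add Re_opp Im_add Im_opp; have [c1 c2] := Xc i j; apply: lerD.
    apply: (mean_value_le ab _ c1 (df := fun t => Re (D t i j))) => t tab.
      by have [] := Xd t tab i j.
    by apply: le_trans (DM t tab); apply: le_trans (cnorm_le_mnorm _ i j);
      exact: Re_le_cnorm.
  apply: (mean_value_le ab _ c2 (df := fun t => Im (D t i j))) => t tab.
    by have [] := Xd t tab i j.
  by apply: le_trans (DM t tab); apply: le_trans (cnorm_le_mnorm _ i j);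
    exact: Im_le_cnorm.
rewrite !sumr_const !card_ord -mulrnA -(mulr_natr _ (_ * _)%N) mulnC.
by rewrite le_eqVlt; apply/orP; left; apply/eqP; ring.
Qed.

Lemma mder0_const m n (X : R -> 'M[R[i]]_(m, n)) a b : a <= b ->
  (forall t, a < t < b -> mder X t 0) -> mcont `[a, b] X -> X b = X a.
Proof.
move=> ab Xd Xc; have := mnorm_mean_value (D := fun=> 0) (M := 0) ab Xd Xc.
rewrite mulr0 mul0r => /(_ _)/le_gtF h.
apply/eqP; rewrite -subr_eq0; apply/eqP/matrixP => i j; rewrite [RHS]mxE.
have : cnorm ((X b - X a) i j) <= 0.
  apply: le_trans (cnorm_le_mnorm _ i j) _; rewrite leNgt h// => t _.
  by rewrite /mnorm big1// => k _; rewrite big1// => l _; rewrite mxE cnorm0.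
set z := (X b - X a) i j; rewrite /cnorm => z0.
have := normr_ge0 (Re z); have := normr_ge0 (Im z) => h1 h2.
by apply: complexP => /=; apply/eqP; rewrite -normr_eq0; lra.
Qed.

End Calculus.

(** * Antiderivatives, exponential growth and geometric limits *)

Section ODE.
Variable R : realType.
Implicit Types (t s a b k : R).
Local Notation Re := complex.Re.
Local Notation Im := complex.Im.

Lemma antiderivative_right (f : R -> R) a : continuous f ->
  exists F : R -> R, forall t, a < t -> is_derive t 1 F (f t).
Proof.
move=> fc; pose F t := (\int[lebesgue_measure]_(x in [set` `[a, t]]) f x)%R.
exists F => t at_.
have tu : t < t + 1 by rewrite ltrDl.
have fi : lebesgue_measure.-integrable `[a, t + 1] (EFin \o f).
  apply: continuous_compact_integrable; first exact: segment_compact.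
  exact: continuous_subspaceT.
have [dF F'] := continuous_FTC1_closed tu fi at_ (fc t).
by apply: DeriveDef; [exact: dF|rewrite -derive1E; exact: F'].
Qed.

Lemma derive_zero_const (f : R -> R) a b :
  (forall t, Num.min a b <= t <= Num.max a b -> is_derive t 1 f 0) -> f a = f b.
Proof.
wlog ab : a b / a <= b.
  move=> W H; have [ab|ba] := lerP a b; first by apply: W ab _.
  by symmetry; apply: W (ltW ba) _; rewrite minC maxC.
rewrite min_l// max_r// => H.
have := @mean_value_le R f (fun=> 0) a b 0 ab.
rewrite mul0r normr0 => /(_ _ _ _)/le_trans h.
apply/eqP; rewrite eq_sym -subr_eq0 -normr_le0; apply: h => //.
  by move=> t /andP[at_ tb]; apply: H; rewrite !ltW.
apply: derivable_within_continuous => t; rewrite in_itv/= => /H[]//.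
Qed.

(* Antiderivatives on the half-lines [t > - m], normalised at 0, are glued. *)
Lemma antiderivative (f : R -> R) a : continuous f ->
  exists F : R -> R, (forall t, is_derive t 1 F (f t)) /\ F a = 0.
Proof.
move=> fc; suff [F dF] : exists F : R -> R, forall t, is_derive t 1 F (f t).
  exists (fun t => F t - F a); split=> [t|]; last by rewrite subrr.
  have := is_deriveB (dF t) (is_derive_cst (F a) t 1); rewrite subr0; exact.
have [G dG] := choice (fun m : nat => antiderivative_right (- m%:R) fc).
pose H m t := G m t - G m 0.
have dH m t : - m%:R < t -> is_derive t 1 (H m) (f t).
  move=> /dG dGt; have := is_deriveB dGt (is_derive_cst (G m 0) t 1).
  by rewrite subr0; exact.
have agree m m' t : (0 < m)%N -> (0 < m')%N -> `|t| < m%:R -> `|t| < m'%:R ->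
    H m t = H m' t.
  move=> m0 m0' tm tm'; apply/eqP; rewrite -subr_eq0; apply/eqP.
  have <- : H m 0 - H m' 0 = 0 by rewrite /H !subrr.
  apply: (@derive_zero_const (fun t => H m t - H m' t)) => s.
  rewrite ge_min le_max => /andP[s1 s2].
  have [sm sm'] : - m%:R < s /\ - m'%:R < s.
    move: tm tm'; rewrite !ltr_norml => /andP[? _] /andP[? _].
    have : 0 < m%:R :> R by rewrite ltr0n.
    have : 0 < m'%:R :> R by rewrite ltr0n.
    by case/orP: s1 => ?; split; lra.
  by have := is_deriveB (dH m s sm) (dH m' s sm'); rewrite subrr.
pose idx t := (Num.truncn `|t|).+1.
have idxP t : `|t| < (idx t)%:R.
  by have /andP[_] := truncn_itv (normr_ge0 t).
exists (fun t => H (idx t) t) => t; pose M := (idx t).+1.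
have tM : `|t| + 1 <= M%:R.
  by rewrite /M -[(idx t).+1]addn1 natrD lerD2r ltW.
have D : is_derive t 1 (H M) (f t).
  by apply: dH; have := ler_norm (- t); rewrite normrN; lra.
apply: near_eq_is_derive D.
have : \forall s \near t, `|t - s| < 1 by exact: (nbhsx_ballx t 1).
apply: filterS => s ts; apply: agree => //.
have := ler_normB t (t - s); rewrite subKr; lra.
Qed.

Lemma derive_le_mono (f df : R -> R) a b : a <= b ->
  (forall t, is_derive t 1 f (df t)) -> (forall t, a < t < b -> 0 <= df t) ->
  f a <= f b.
Proof.
rewrite le_eqVlt => /orP[/eqP->//|ab] fd f0.
have [|c /[!in_itv]/= cab E] := MVT ab (fun x _ => fd x).
  by apply: continuous_subspaceT => t; exact: is_derive_continuous.
by rewrite -subr_ge0 E mulr_ge0 ?f0// subr_ge0 ltW.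
Qed.

Lemma exp_growth_right (f df : R -> R) a k c : 0 < c -> 0 <= k ->
  (forall t, is_derive t 1 f (df t)) -> f a = 0 ->
  (forall t, df t <= k * expR (c * `|t - a|)) ->
  forall t, a <= t -> f t <= k / c * expR (c * `|t - a|).
Proof.
move=> c0 k0 fd fa fk t ta.
pose g s := k / c * expR (c * (s - a)).
have gd s : is_derive s 1 g (k * expR (c * (s - a))).
  have d1 : is_derive s 1 (fun s => c * (s - a)) c.
    apply: (is_derive_eq (is_deriveZ c
      (is_deriveB (is_derive_id s 1) (is_derive_cst a s 1)))).
    by rewrite subr0 /GRing.scale /= mulr1.
  apply: (is_derive_eq (is_deriveZ (k / c)
    (@is_derive1_comp _ _ (fun s => c * (s - a)) s _ _ (is_derive_expR _) d1))).
  by rewrite /GRing.scale /=; field; rewrite gt_eqF.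
have gfd s : is_derive s 1 (fun s => g s - f s) (k * expR (c * (s - a)) - df s).
  exact: (is_deriveB (gd s) (fd s)).
have gf0 s : a < s < t -> 0 <= k * expR (c * (s - a)) - df s.
  by move=> /andP[as_ _]; have := fk s; rewrite ger0_norm ?subr_ge0// ltW.
have := derive_le_mono ta gfd gf0.
rewrite fa subr0 /g subrr mulr0 expR0 mulr1 ger0_norm ?subr_ge0// => H.
have : 0 <= k / c by rewrite divr_ge0// ltW.
by lra.
Qed.

(** Integration gains a factor 1/c against the weight exp(c |t - a|). With c large this makes the
    Picard map a contraction on the entire real line at once. *)
Lemma exp_growth (f df : R -> R) a k c : 0 < c -> 0 <= k ->
  (forall t, is_derive t 1 f (df t)) -> f a = 0 ->
  (forall t, `|df t| <= k * expR (c * `|t - a|)) ->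
  forall t, `|f t| <= k / c * expR (c * `|t - a|).
Proof.
move=> c0 k0.
have right (f' df' : R -> R) : (forall t, is_derive t 1 f' (df' t)) -> f' a = 0 ->
    (forall t, `|df' t| <= k * expR (c * `|t - a|)) ->
    forall t, a <= t -> `|f' t| <= k / c * expR (c * `|t - a|).
  move=> fd fa fk t ta; rewrite ler_norml; apply/andP; split.
    rewrite lerNl; apply: (@exp_growth_right (fun s => - f' s) (fun s => - df' s)) => //.
    - by rewrite fa oppr0.
    - by move=> s; apply: le_trans (fk s); rewrite -normrN ler_norm.
  apply: (@exp_growth_right f' df') => // s.
  by apply: le_trans (fk s); rewrite ler_norm.
move=> fd fa fk t; have [ta|ta] := leP a t; first exact: (right f df).
have aff s : is_derive s 1 (fun s : R => 2 * a - s) (-1).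
  apply: (is_derive_eq (is_deriveB (is_derive_cst (2 * a) s 1) (is_derive_id s 1))).
  by rewrite sub0r.
have E : 2 * a - (2 * a - t) = t by ring.
have E' s : `|2 * a - s - a| = `|s - a|.
  by rewrite distrC; congr `|_|; ring.
have := right (fun s => f (2 * a - s)) (fun s => df (2 * a - s) * -1) _ _ _ (2 * a - t).
rewrite E E'; apply.
- by rewrite -[RHS]fa; congr f; ring.
- by move=> s; rewrite mulrN1 normrN -E'.
- lra.
Qed.

(** Nested intervals: [x p] minus and plus 2 E / 2^p are increasing and decreasing, and the limit is
    the supremum of the lower ends. *)
Lemma geometric_limit (x : nat -> R) (E : R) : 
  (forall p, `|x p.+1 - x p| <= E / 2 ^+ p) ->
  exists l, forall p, `|l - x p| <= 2 * E / 2 ^+ p.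
Proof.
move=> xE; pose y p := x p - 2 * E / 2 ^+ p; pose z p := x p + 2 * E / 2 ^+ p.
have half p : E / 2 ^+ p.+1 = E / 2 ^+ p / 2.
  by rewrite exprS invfM mulrA mulrAC.
have E0 p : 0 <= E / 2 ^+ p by exact: le_trans (xE p).
have yS p : y p <= y p.+1.
  have := xE p; rewrite /y -!mulrA half ler_norml => /andP[? ?]; lra.
have zS p : z p.+1 <= z p.
  have := xE p; rewrite /z -!mulrA half ler_norml => /andP[? ?]; lra.
have ymono p q : (p <= q)%N -> y p <= y q.
  by move=> /subnKC <-; elim: (q - p)%N => [|m /le_trans IH];
    rewrite ?addn0// addnS; exact: IH.
have zmono p q : (p <= q)%N -> z q <= z p.
  by move=> /subnKC <-; elim: (q - p)%N => [|m IH];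
    rewrite ?addn0// addnS; exact: le_trans (zS _) IH.
have yz p q : y p <= z q.
  apply: (le_trans (ymono _ _ (leq_maxl p q))).
  apply: le_trans (zmono _ _ (leq_maxr p q)).
  by rewrite /y /z -mulrA; have := E0 (maxn p q); lra.
have sy : has_sup (range y).
  split; first by exists (y 0%N), 0%N.
  by exists (z 0%N) => _ [p _ <-].
exists (sup (range y)) => p; rewrite ler_norml; apply/andP; split.
  have : y p <= sup (range y) by apply: ub_le_sup; [case: sy | exists p].
  by rewrite /y; lra.
have : sup (range y) <= z p by apply: ge_sup; [case: sy | move=> _ [q _ <-]].
by rewrite /z; lra.
Qed.

Lemma small_geometric (C e : R) : 0 < e -> exists p, C / 2 ^+ p <= e.
Proof.
move=> e0; exists (Num.truncn (`|C| / e)).+1.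
have /andP[_ h] := truncn_itv (divr_ge0 (normr_ge0 C) (ltW e0)).
rewrite ler_pdivrMr ?exprn_gt0// mulrC -ler_pdivrMr//.
apply: (@le_trans _ _ (`|C| / e)); first by rewrite ler_pM2r ?invr_gt0// ler_norm.
apply: le_trans (ltW h) _; rewrite -natrX ler_nat; exact: ltnW (ltn_expl _ _).
Qed.

Lemma eq_of_geometric (x y C : R) : (forall p, `|x - y| <= C / 2 ^+ p) -> x = y.
Proof.
move=> H; apply/eqP; rewrite -subr_eq0 -normr_le0 leNgt; apply/negP => h.
have h2 : 0 < `|x - y| / 2 by rewrite divr_gt0.
by have [p] := small_geometric C h2; have := H p; lra.
Qed.

Lemma mantiderivative m n (X : R -> 'M[R[i]]_(m, n)) a : mcont setT X ->
  exists F, (forall t, mder F t (X t)) /\ F a = 0.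
Proof.
move=> Xc.
have H (ij : 'I_m * 'I_n) : exists FG : (R -> R) * (R -> R),
    [/\ forall t, is_derive t 1 FG.1 (Re (X t ij.1 ij.2)), FG.1 a = 0,
        forall t, is_derive t 1 FG.2 (Im (X t ij.1 ij.2)) & FG.2 a = 0].
  have [c1 c2] := Xc ij.1 ij.2.
  have [F [dF F0]] := antiderivative a ((continuous_subspace_setT _).2 c1).
  by have [G [dG G0]] := antiderivative a ((continuous_subspace_setT _).2 c2);
    exists (F, G).
have [FG FGP] := choice H.
exists (fun t => \matrix_(i, j) ((FG (i, j)).1 t +i* (FG (i, j)).2 t)%C).
split=> [t i j|]; last first.
  by apply/matrixP => i j; rewrite !mxE; have [_ -> _ ->] := FGP (i, j).
have [d1 _ d2 _] := FGP (i, j); split; under eq_fun do rewrite mxE /=.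
  exact: d1.
exact: d2.
Qed.

End ODE.

(** * Global solutions by Picard iteration, and their unitarity *)

Section Picard.
Variable R : realType.
Implicit Types (t s a k : R).
Local Notation Re := complex.Re.
Local Notation Im := complex.Im.
Local Open Scope sesquilinear_scope.

Lemma mnormB m n (A B : 'M[R[i]]_(m, n)) : mnorm (A - B) <= mnorm A + mnorm B.
Proof. by rewrite -[mnorm B]mnorm_opp; exact: mnorm_add. Qed.

Lemma Re_mxB m n (A B : 'M[R[i]]_(m, n)) i j :
  Re ((A - B) i j) = Re (A i j) - Re (B i j).
Proof. by rewrite !mxE Re_add Re_opp. Qed.

Lemma Im_mxB m n (A B : 'M[R[i]]_(m, n)) i j :
  Im ((A - B) i j) = Im (A i j) - Im (B i j).
Proof. by rewrite !mxE Im_add Im_opp. Qed.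

Lemma mnorm_growth m n (X D : R -> 'M[R[i]]_(m, n)) a k c : 0 < c -> 0 <= k ->
  (forall t, mder X t (D t)) -> X a = 0 ->
  (forall t, mnorm (D t) <= k * expR (c * `|t - a|)) ->
  forall t, mnorm (X t) <= 2 * (m * n)%:R * (k / c) * expR (c * `|t - a|).
Proof.
move=> c0 k0 dX Xa DM t; set E := expR _.
apply: (@le_trans _ _ (\sum_(i < m) \sum_(j < n) (k / c * E + k / c * E))).
  apply: ler_sum => i _; apply: ler_sum => j _; rewrite /cnorm; apply: lerD.
    have [R0 I0] : Re (X a i j) = 0 /\ Im (X a i j) = 0 by rewrite Xa mxE.
    apply: (@exp_growth _ (fun s => Re (X s i j)) (fun s => Re (D s i j)) _ _ _ c0 k0
      (fun s => (dX s i j).1) R0) => s.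
    apply: le_trans (DM s); apply: le_trans (cnorm_le_mnorm _ i j).
    exact: Re_le_cnorm.
  have [R0 I0] : Re (X a i j) = 0 /\ Im (X a i j) = 0 by rewrite Xa mxE.
  apply: (@exp_growth _ (fun s => Im (X s i j)) (fun s => Im (D s i j)) _ _ _ c0 k0
    (fun s => (dX s i j).2) I0) => s.
  apply: le_trans (DM s); apply: le_trans (cnorm_le_mnorm _ i j).
  exact: Im_le_cnorm.
rewrite !sumr_const !card_ord -mulrnA -(mulr_natr _ (_ * _)%N) mulnC.
by rewrite le_eqVlt; apply/orP; left; apply/eqP; ring.
Qed.

(** Continuity of [E] makes the convergence locally uniform; the rest is the usual division of the
    error into thirds. *)
Lemma continuous_geometric_limit (x : nat -> R -> R) (f E : R -> R) :
  (forall p, continuous (x p)) -> continuous E ->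
  (forall p t, `|f t - x p t| <= E t / 2 ^+ p) -> continuous f.
Proof.
move=> xc Ec fx t; apply/cvgrPdist_le => e e0.
have e3 : 0 < e / 3 by rewrite divr_gt0.
have [p ple] := small_geometric (E t + 1) e3.
have p2 : 0 < 2 ^+ p :> R by rewrite exprn_gt0.
have /cvgrPdist_le/(_ _ e3) h1 := xc p t.
have /cvgrPdist_le/(_ 1 ltr01) h2 := Ec t.
near=> s.
have k1 : `|x p t - x p s| <= e / 3 by near: s.
have k2 : `|E t - E s| <= 1 by near: s.
have hs : E s / 2 ^+ p <= (E t + 1) / 2 ^+ p.
  by rewrite ler_pM2r ?invr_gt0//; move: k2; rewrite ler_norml => /andP[? _]; lra.
have ht : E t / 2 ^+ p <= (E t + 1) / 2 ^+ p.
  by rewrite ler_pM2r ?invr_gt0//; lra.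
have -> : f t - f s = (f t - x p t) + (x p t - x p s) + (x p s - f s) by ring.
apply: le_trans (ler_normD _ _) _.
have := ler_normD (f t - x p t) (x p t - x p s).
have := fx p t; have := fx p s; rewrite (distrC (f s)); lra.
Unshelve. all: by end_near. Qed.

Lemma ode_exists N (A : R -> 'M[R[i]]_N) a M : mcont setT A ->
  (forall t, mnorm (A t) <= M) ->
  exists X, (forall t, mder X t (A t *m X t)) /\ X a = 1%:M.
Proof.
move=> Ac AM; have M0 : 0 <= M by apply: le_trans (AM a); exact: mnorm_ge0.
(* To be iterated the Picard map must be a total function, so its specification is conditional on
   continuity. *)
have step (Y : R -> 'M[R[i]]_N) : exists Z : R -> 'M[R[i]]_N, mcont setT Y ->
    (forall t, mder Z t (A t *m Y t)) /\ Z a = 1%:M.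
  have [Yc|nYc] := pselect (mcont setT Y); last by exists Y => /nYc.
  have [F [dF Fa]] := mantiderivative a (mcontM Ac Yc).
  exists (fun t => 1%:M + F t) => _; split; last by rewrite Fa addr0.
  by move=> t; apply: mder_eq (mderD (mder_cst _ t) (dF t)) _; rewrite add0r.
have [next nextP] := choice step.
pose X p := iter p next (fun=> 1%:M).
have Xc p : mcont setT (X p).
  elim: p => [|p IH].
    by apply: mder_mcont => t; exact: mder_cst.
  by apply: mder_mcont => t; exact: (nextP _ IH).1.
have dX p t : mder (X p.+1) t (A t *m X p t) by exact: (nextP _ (Xc p)).1.
have Xa p : X p a = 1%:M by case: p => // p; exact: (nextP _ (Xc p)).2.
(* Chosen so that 2 N^2 M / c <= 1/2: each iteration halves the weighted norm. *)
pose c : R := 4 * (N * N)%:R * M + 1.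
have c0 : 0 < c by rewrite ltr_wpDl// !mulr_ge0.
have cle k : 0 <= k -> 2 * (N * N)%:R * (M * k / c) <= k / 2.
  move=> k0; rewrite mulrA ler_pdivrMr//.
  by rewrite /c; lra.
pose E t := expR (c * `|t - a|).
have E1 t : 1 <= E t.
  by rewrite -[leLHS]expR0 ler_expR mulr_ge0 ?normr_ge0 ?(ltW c0).
have E0 t : 0 <= E t by apply: le_trans (E1 t).
have diff p t : mnorm (X p.+1 t - X p t) <= E t / 2 ^+ p.
  elim: p t => [|p IH] t.
    have := @mnorm_growth _ _ (fun t => X 1%N t - X 0%N t) (fun t => A t *m X 0%N t)
      a M c c0 M0.
    move=> /(_ _ _ _ t) h; apply: le_trans (h _ _ _) _.
    - move=> s; apply: mder_eq (mderD (dX 0%N s) (mderN (mder_cst _ s))) _.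
      by rewrite oppr0 addr0.
    - by rewrite !Xa subrr.
    - move=> s; rewrite /X /= mulmx1; apply: le_trans (AM s) _.
      by rewrite ler_peMr//; exact: E1.
    - rewrite -/(E t) expr0 divr1; have := cle 1 ler01; rewrite mulr1.
      by have := E1 t => Et h2; rewrite -[leRHS]mul1r ler_wpM2r; lra.
  have k0 : 0 <= 1 / 2 ^+ p :> R by rewrite divr_ge0// exprn_ge0.
  have := @mnorm_growth _ _ (fun t => X p.+2 t - X p.+1 t)
    (fun t => A t *m (X p.+1 t - X p t)) a (M * (1 / 2 ^+ p)) c c0 (mulr_ge0 M0 k0).
  move=> /(_ _ _ _ t) h; apply: le_trans (h _ _ _) _.
  - move=> s; apply: mder_eq (mderD (dX p.+1 s) (mderN (dX p s))) _.
    by rewrite mulmxBr.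
  - by rewrite !Xa subrr.
  - move=> s; apply: le_trans (mnorm_mul _ _) _; rewrite -mulrA mul1r.
    apply: ler_pM; rewrite ?mnorm_ge0 ?AM//.
    by apply: le_trans (IH s) _; rewrite mulrC.
  - rewrite -/(E t); apply: (@le_trans _ _ (1 / 2 ^+ p / 2 * E t)).
      by rewrite ler_wpM2r//; exact: cle.
    by rewrite exprS invfM; lra.
have lim (tij : R * ('I_N * 'I_N)) : exists z : R[i], forall p,
    `|Re z - Re (X p tij.1 tij.2.1 tij.2.2)| <= 2 * E tij.1 / 2 ^+ p /\
    `|Im z - Im (X p tij.1 tij.2.1 tij.2.2)| <= 2 * E tij.1 / 2 ^+ p.
  case: tij => t [i j] /=.
  have hu p : `|Re (X p.+1 t i j) - Re (X p t i j)| <= E t / 2 ^+ p.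
    apply: le_trans (diff p t); apply: le_trans (cnorm_le_mnorm _ i j).
    by rewrite !mxE; apply: le_trans (Re_le_cnorm _); rewrite Re_add Re_opp.
  have hv p : `|Im (X p.+1 t i j) - Im (X p t i j)| <= E t / 2 ^+ p.
    apply: le_trans (diff p t); apply: le_trans (cnorm_le_mnorm _ i j).
    by rewrite !mxE; apply: le_trans (Im_le_cnorm _); rewrite Im_add Im_opp.
  have [u uP] := @geometric_limit R (fun p => Re (X p t i j)) (E t) hu.
  have [v vP] := @geometric_limit R (fun p => Im (X p t i j)) (E t) hv.
  by exists (u +i* v)%C.
have [l lP] := choice lim.
pose L t : 'M[R[i]]_N := \matrix_(i, j) l (t, (i, j)).
have LX p t : mnorm (L t - X p t) <= (N * N)%:R * 4 * E t / 2 ^+ p.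
  apply: (@le_trans _ _ (\sum_(i < N) \sum_(j < N) 4 * E t / 2 ^+ p)).
    apply: ler_sum => i _; apply: ler_sum => j _.
    have [h1 h2] := lP (t, (i, j)) p; rewrite /cnorm !mxE Re_add Re_opp Im_add Im_opp.
    by apply: le_trans (lerD h1 h2) _; lra.
  rewrite !sumr_const !card_ord -mulrnA -(mulr_natr _ (_ * _)%N).
  by rewrite le_eqVlt; apply/orP; left; apply/eqP; ring.
have Ec : continuous (fun t => 2 * E t).
  have Nc : continuous (fun t => c * `|t - a|).
    move=> t; apply: cvgM; first exact: cvg_cst.
    by apply: cvg_norm; apply: cvgB; [exact: cvg_id|exact: cvg_cst].
  move=> t; apply: cvgM; first exact: cvg_cst.
  by apply: (@continuous_comp R R R _ expR t (Nc t)); exact: continuous_expR.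
have Lc : mcont setT L.
  move=> i j; split; apply: continuous_subspaceT.
    apply: (@continuous_geometric_limit (fun p t => Re (X p t i j))
      (fun t => Re (L t i j)) (fun t => 2 * E t) _ Ec).
      by move=> p; have [h1 h2] := Xc p i j; exact: (continuous_subspace_setT _).2.
    by move=> p t; rewrite mxE; have [] := lP (t, (i, j)) p.
  apply: (@continuous_geometric_limit (fun p t => Im (X p t i j))
      (fun t => Im (L t i j)) (fun t => 2 * E t) _ Ec).
    by move=> p; have [h1 h2] := Xc p i j; exact: (continuous_subspace_setT _).2.
  by move=> p t; rewrite mxE; have [] := lP (t, (i, j)) p.
have [dL La] := nextP _ Lc.
(* The iterates approach both [L] and [next L] geometrically, so the limit is a fixed point and
   hence a solution. *)
suff LE : L = next L by exists L; split; [rewrite {1}LE|rewrite LE].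
have close p t : mnorm (L t - next L t) <= (N * N)%:R * 4 * E t / 2 ^+ p.
  have k0 : 0 <= (N * N)%:R * 4 / 2 ^+ p :> R.
    by rewrite divr_ge0 ?mulr_ge0// exprn_ge0.
  have := @mnorm_growth _ _ (fun t => next L t - X p.+1 t)
    (fun t => A t *m (L t - X p t)) a (M * ((N * N)%:R * 4 / 2 ^+ p)) c c0
    (mulr_ge0 M0 k0).
  move=> /(_ _ _ _ t) h.
  have h1 : mnorm (next L t - X p.+1 t) <= (N * N)%:R * 4 * E t / 2 ^+ p / 2.
    apply: le_trans (h _ _ _) _.
    - move=> s; apply: mder_eq (mderD (dL s) (mderN (dX p s))) _.
      by rewrite mulmxBr.
    - by rewrite La Xa subrr.
    - move=> s; apply: le_trans (mnorm_mul _ _) _; rewrite -[leRHS]mulrA.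
      apply: ler_pM; rewrite ?mnorm_ge0 ?AM//.
      by apply: le_trans (LX p s) _; rewrite mulrAC.
    - rewrite -/(E t); apply: (@le_trans _ _ ((N * N)%:R * 4 / 2 ^+ p / 2 * E t)).
        by rewrite ler_wpM2r//; exact: cle.
      by rewrite le_eqVlt; apply/orP; left; apply/eqP; ring.
  have := LX p.+1 t; rewrite exprS invfM mulrCA => h2.
  have -> : L t - next L t = (L t - X p.+1 t) - (next L t - X p.+1 t).
    by rewrite opprB addrA subrK.
  by apply: le_trans (mnormB _ _) _; lra.
apply/funext => t; apply/matrixP => i j; apply: complexP;
  apply: (@eq_of_geometric _ _ _ ((N * N)%:R * 4 * E t)) => p;
  apply: le_trans (close p t); apply: le_trans (cnorm_le_mnorm _ i j).
  by rewrite -Re_mxB; exact: Re_le_cnorm.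
by rewrite -Im_mxB; exact: Im_le_cnorm.
Qed.

Lemma adj_mul m n p (A : 'M[R[i]]_(m, n)) (B : 'M[R[i]]_(n, p)) :
  (A *m B) ^t* = B ^t* *m A ^t*.
Proof. by rewrite trmx_mul map_mxM. Qed.

Lemma skew_ode_unitary N (A : R -> 'M[R[i]]_N) a X :
  (forall t, (A t) ^t* = - A t) -> (forall t, mder X t (A t *m X t)) ->
  X a = 1%:M -> forall t, X t \is unitarymx.
Proof.
move=> Askew dX Xa.
have dXX t : mder (fun s => (X s) ^t* *m X s) t 0.
  apply: mder_eq (mderM (mder_adj (dX t)) (dX t)) _.
  by rewrite adj_mul Askew mulmxN mulNmx mulmxA addNr.
have XX t : (X t) ^t* *m X t = 1%:M.
  have cX S : mcont S (fun s => (X s) ^t* *m X s).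
    by apply: mder_mcont => s; exact: dXX.
  have E : (X a) ^t* *m X a = 1%:M by rewrite Xa mulmx1 trmx1 map_mx1.
  have [ta|/ltW ta] := leP a t.
    by rewrite -E; exact: (mder0_const ta (fun s _ => dXX s) (cX _)).
  by rewrite -E; apply/esym; exact: (mder0_const ta (fun s _ => dXX s) (cX _)).
by move=> t; rewrite -trmxC_unitary; apply/unitarymxP; rewrite trmxCK; exact: XX.
Qed.

End Picard.

(** * Propagators along lines *)

Section Evolution.
Variables (R : realType) (N : nat).
Implicit Types (t s : R).
Local Open Scope sesquilinear_scope.
Local Open Scope complex_scope.

Lemma hermsymmx_adj (A : 'M[R[i]]_N) : (A \is hermsymmx) = (A ^t* == A).
Proof. by rewrite qualifE /= expr0 scale1r eq_sym. Qed.

Lemma skew_of_hermitian (A : 'M[R[i]]_N) (c : R) : A ^t* = A ->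
  (- ('i * c%:C) *: A) ^t* = - (- ('i * c%:C) *: A).
Proof.
move=> hA; rewrite linearZ /= map_mxZ hA -scaleNr; congr (_ *: _).
by rewrite rmorphN rmorphM /= opprK; apply: complexP => /=; ring.
Qed.

Lemma mcont_lip (A : R -> 'M[R[i]]_N) C S :
  (forall s t, mnorm (A s - A t) <= C * `|s - t|) -> mcont S A.
Proof.
move=> AC.
have lip_cont (f : R -> R) : (forall s t, `|f s - f t| <= C * `|s - t|) ->
    continuous f.
  move=> fC t; apply/cvgrPdist_le => e e0.
  have C0 : 0 <= C by have := fC 1 0; rewrite subr0 normr1 mulr1; apply: le_trans.
  have : \forall s \near t, `|t - s| < e / (C + 1).
    by apply: (nbhsx_ballx t); rewrite divr_gt0//; lra.
  apply: filterS => s ts; apply: le_trans (fC t s) _.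
  apply: (@le_trans _ _ (C * (e / (C + 1)))); first by rewrite ler_wpM2l// ltW.
  by rewrite mulrA ler_pdivrMr; nra.
move=> i j; split; apply: continuous_subspaceT; apply: lip_cont => s t;
  apply: le_trans (AC s t); apply: le_trans (cnorm_le_mnorm _ i j).
  by rewrite -Re_mxB; exact: Re_le_cnorm.
by rewrite -Im_mxB; exact: Im_le_cnorm.
Qed.

(** [time_evolution] is obtained by choice, so the candidate must have the defining property and be
    alone in having it. It has it because [X^* Psi] is constant for every solution; it is alone
    because each [X v] is a solution and [X 0] is invertible. *)
Lemma time_evolutionE n (H : 'rV[R]_n -> 'M[R[i]]_N) (T : R)
    (gamma : R -> 'rV[R]_n) (A X : R -> 'M[R[i]]_N) : 0 < T ->
  (forall t, 0 < t < T -> H (gamma t) = A t) ->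
  (forall t, (- 'i *: A t) ^t* = - (- 'i *: A t)) ->
  (forall t, mder X t ((- 'i *: A t) *m X t)) ->
  (forall t, X t \is unitarymx) ->
  time_evolution H T gamma T 0 = X T *m (X 0) ^t*.
Proof.
move=> T0 HA skew dX Xu.
have Xu' t : (X t) ^t* *m X t = 1%:M.
  by have := Xu t; rewrite -trmxC_unitary => /unitarymxP; rewrite trmxCK.
pose P (U : 'M[R[i]]_N) := U \is unitarymx /\
  forall Psi, schrodinger_solution H T gamma Psi -> Psi T = U *m Psi 0.
have P1 U : P U -> U = X T *m (X 0) ^t*.
  move=> [_ UP].
  have E (v : 'cV[R[i]]_N) : X T *m v = U *m X 0 *m v.
    rewrite -mulmxA; apply: (UP (fun t => X t *m v)); split=> [k|t t0T].
      have := mcontM (mder_mcont `[0, T] dX)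
        (mder_mcont `[0, T] (fun t => mder_cst v t)).
      exact.
    exists ((- 'i *: A t) *m (X t *m v)); split.
      move=> k; have := mderM (dX t) (mder_cst v t) k 0.
      by rewrite mulmx0 addr0 mulmxA.
    rewrite HA// -scalemxAl scalerA -[RHS]scale1r; congr (_ *: _).
    by apply: complexP => /=; ring.
  have {E} -> : X T = U *m X 0.
    by apply/matrixP => i j; have /matrixP/(_ i 0) := E (delta_mx j 0);
      rewrite -!colE !mxE.
  by rewrite -mulmxA (unitarymxP (Xu 0)) mulmx1.
have PW : P (X T *m (X 0) ^t*).
  split; first by rewrite mul_unitarymx ?trmxC_unitary.
  move=> Psi [Psic Psid].
  have dXP t : 0 < t < T -> mder (fun s => (X s) ^t* *m Psi s) t 0.
    move=> t0T; have [dPsi [dP eP]] := Psid t t0T.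
    have dP' : mder Psi t ((- 'i *: A t) *m Psi t).
      move=> k j; rewrite ord1; have -> : (- 'i *: A t) *m Psi t = dPsi.
        rewrite -scalemxAl -HA// -eP scalerA -[RHS]scale1r; congr (_ *: _).
        by apply: complexP => /=; ring.
      exact: dP.
    apply: mder_eq (mderM (mder_adj (dX t)) dP') _.
    by rewrite adj_mul skew mulmxN mulNmx mulmxA addNr.
  have Pc : mcont `[0, T] Psi by move=> k j; rewrite ord1; exact: Psic.
  have Xc : mcont `[0, T] (fun s => (X s) ^t* ).
    by apply: mder_mcont => s; exact: mder_adj (dX s).
  have := mder0_const (ltW T0) dXP (mcontM Xc Pc).
  by rewrite -mulmxA => <-; rewrite mulmxA (unitarymxP (Xu T)) mul1mx.
by apply: P1; exact: (@xgetPex _ 1%:M P (ex_intro _ _ PW)).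
Qed.

(** Ideal data give U = z V with z a phase; multiply by [YT^*] on the left and by [X0] on the
    right. *)
Lemma amplitude_phase (I F : set 'cV[R[i]]_N) (U V X0 XT Y0 YT : 'M[R[i]]_N) :
  ideal_data I F ->
  X0 \is unitarymx -> XT \is unitarymx -> Y0 \is unitarymx -> YT \is unitarymx ->
  U = XT *m X0 ^t* -> V = YT *m Y0 ^t* ->
  (forall a b, F a -> I b -> amplitude a U b = amplitude a V b) ->
  exists z : R[i], YT ^t* *m XT = z *: (Y0 ^t* *m X0).
Proof.
move=> IF uX0 uXT uY0 uYT UE VE /IF [||phi UV].
- by rewrite UE; exact: mul_unitarymx uXT (etrans (trmxC_unitary X0) uX0).
- by rewrite VE; exact: mul_unitarymx uYT (etrans (trmxC_unitary Y0) uY0).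
exists (cos phi +i* sin phi).
have adj1 (Z : 'M[R[i]]_N) : Z \is unitarymx -> Z ^t* *m Z = 1%:M.
  by rewrite -trmxC_unitary => /unitarymxP; rewrite trmxCK.
have -> : XT = U *m X0 by rewrite UE -mulmxA adj1 ?mulmx1.
rewrite UV VE -scalemxAl -scalemxAr; congr (_ *: _).
by rewrite !mulmxA (adj1 _ uYT) mul1mx.
Qed.

End Evolution.

(** * Ideal data along a single chord *)

Section Chords.
Variables (R : realType) (n N : nat).
Local Open Scope sesquilinear_scope.
Local Open Scope complex_scope.

Lemma enormZ c (v : 'rV[R]_n) : enorm (c *: v) = `|c| * enorm v.
Proof.
rewrite /enorm; under eq_bigr do rewrite mxE exprMn.
by rewrite -mulr_sumr sqrtrM ?sqr_ge0// sqrtr_sqr.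
Qed.

(** The direction need not be a unit vector, so that a whole pencil of directions can share the
    parameter interval [-1, 1]; the factor [enorm d] restores unit speed. *)
Definition line_ode (A : 'rV[R]_n -> 'M[R[i]]_N) (x d : 'rV[R]_n)
    (X : R -> 'M[R[i]]_N) : Prop :=
  (forall t, mder X t ((- ('i * (enorm d)%:C) *: A (x + t *: d)) *m X t)) /\
  (forall t, X t \is unitarymx).

(* The factor [z] is the phase that ideal data leave undetermined. *)
Lemma chord_scalar (Omega : set 'rV[R]_n) (I F : set 'cV[R[i]]_N)
    (H H' A A' : 'rV[R]_n -> 'M[R[i]]_N) (x d : 'rV[R]_n) (a b : R) X Y :
  ideal_data I F ->
  (forall (u v : 'cV[R[i]]_N) (T : R) (gamma : R -> 'rV[R]_n),
     F u -> I v -> line_through Omega T gamma ->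
     amplitude u (time_evolution H T gamma T 0) v =
     amplitude u (time_evolution H' T gamma T 0) v) ->
  (forall y, closure Omega y -> A y = H y) ->
  (forall y, closure Omega y -> A' y = H' y) ->
  (forall y, (A y) ^t* = A y) -> (forall y, (A' y) ^t* = A' y) ->
  0 < enorm d -> a < b ->
  (forall t, a <= t <= b -> closure Omega (x + t *: d)) ->
  boundary Omega (x + a *: d) -> boundary Omega (x + b *: d) ->
  line_ode A x d X -> line_ode A' x d Y ->
  exists z : R[i], (Y b) ^t* *m X b = z *: ((Y a) ^t* *m X a).
Proof.
move=> IF data AH AH' hA hA' d0 ab cl ba bb [dX uX] [dY uY].
set l := enorm d in d0 dX dY.
(* Unit speed reparametrisation of the chord: time [t] corresponds to the parameter a + t / l. *)
pose gamma t := x + a *: d + t *: (l^-1 *: d); pose T := l * (b - a).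
have T0 : 0 < T by rewrite mulr_gt0// subr_gt0.
have gE t : gamma t = x + (a + l^-1 * t) *: d.
  by rewrite /gamma -addrA; congr (_ + _); rewrite scalerDl scalerA mulrC.
have aT : a + l^-1 * T = b by rewrite /T mulKf ?gt_eqF//; ring.
have itv t : 0 <= t <= T -> a <= a + l^-1 * t <= b.
  move=> /andP[t0 tT]; apply/andP; split.
    by rewrite lerDl mulr_ge0// invr_ge0 ltW.
  by rewrite -aT lerD2l ler_pM2l// invr_gt0.
have lt : line_through Omega T gamma.
  split; first exact: T0.
  - exists (x + a *: d), (l^-1 *: d); split; last by [].
    by rewrite enormZ -/l gtr0_norm ?invr_gt0// mulVf// gt_eqF.
  - by move=> t t0T; rewrite gE; apply: cl; exact: itv.
  - by rewrite gE mulr0 addr0.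
  - by rewrite gE aT.
have ev (B G : 'rV[R]_n -> 'M[R[i]]_N) (Z : R -> 'M[R[i]]_N) :
    (forall y, closure Omega y -> B y = G y) ->
    (forall y, (B y) ^t* = B y) ->
    (forall t, mder Z t ((- ('i * l%:C) *: B (x + t *: d)) *m Z t)) ->
    (forall t, Z t \is unitarymx) ->
    time_evolution G T gamma T 0 = Z b *m (Z a) ^t*.
  move=> BG hB dZ uZ.
  rewrite (@time_evolutionE _ _ _ G T gamma (fun t => B (gamma t))
    (fun t => Z (a + l^-1 * t)) T0); first by rewrite aT mulr0 addr0.
  - by move=> t /andP[t0 tT]; rewrite BG// gE; apply/cl/itv; rewrite !ltW.
  - move=> t; have := @skew_of_hermitian _ _ _ 1 (hB (gamma t)).
    by rewrite mulr1.
  - move=> t; apply: mder_eq (mder_comp_affine (dZ _)) _.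
    rewrite -gE scalemxAl scalerA; congr (_ *: _ *m _).
    by apply: complexP => /=; field; rewrite gt_eqF.
  - by move=> t; exact: uZ.
apply: (amplitude_phase IF (uX a) (uX b) (uY a) (uY b) (ev A H X AH hA dX uX)
  (ev A' H' Y AH' hA' dY uY)).
by move=> u v Fu Iv; exact: data.
Qed.

End Chords.

(** * Stability estimates for unitary propagators *)

Section Propagators.
Variables (R : realType) (N : nat).
Implicit Types (a t s e M : R) (A B X Y G : R -> 'M[R[i]]_N).
Local Notation Re := complex.Re.
Local Open Scope sesquilinear_scope.

Local Notation u := (2 * (N * N)%:R : R).

Lemma mnorm_unitary_le (U : 'M[R[i]]_N) : U \is unitarymx -> mnorm U <= u.
Proof. by move=> /mnorm_unitary; rewrite natrM expr2. Qed.

Lemma unitary_adj_mul (U : 'M[R[i]]_N) : U \is unitarymx -> U ^t* *m U = 1%:M.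
Proof. by rewrite -trmxC_unitary => /unitarymxP; rewrite trmxCK. Qed.

(** Duhamel: [Y^* X] has derivative [Y^* (A - B) X] and starts from the identity. Of the four
    factors [u], two bound the unitary factors there, one is the dimensional constant of
    [mnorm_mean_value], and one comes from multiplying back by [Y t]. *)
Lemma propagator_compare A B X Y a t e : a <= t ->
  (forall s, (B s) ^t* = - B s) ->
  (forall s, mder X s (A s *m X s)) -> (forall s, mder Y s (B s *m Y s)) ->
  (forall s, X s \is unitarymx) -> (forall s, Y s \is unitarymx) ->
  X a = Y a -> (forall s, a < s < t -> mnorm (A s - B s) <= e) ->
  mnorm (X t - Y t) <= u ^+ 4 * e * (t - a).
Proof.
move=> at_ skew dX dY uX uY XYa AB.
pose D s := (Y s) ^t* *m X s.
have dD s : mder D s ((Y s) ^t* *m (A s - B s) *m X s).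
  apply: mder_eq (mderM (mder_adj (dY s)) (dX s)) _.
  by rewrite adj_mul skew mulmxBr mulmxBl mulmxN mulNmx addrC !mulmxA.
have u0 : 0 <= u by rewrite mulr_ge0.
have dDM s : a < s < t -> mnorm ((Y s) ^t* *m (A s - B s) *m X s) <= u * e * u.
  move=> /AB ABs; apply: le_trans (mnorm_mul _ _) _.
  apply: ler_pM; rewrite ?mnorm_ge0 ?mnorm_unitary_le//.
  apply: le_trans (mnorm_mul _ _) _.
  by apply: ler_pM; rewrite ?mnorm_ge0 ?mnorm_adj ?mnorm_unitary_le.
have cD : mcont `[a, t] D by apply: mder_mcont => s; exact: dD.
have := mnorm_mean_value at_ (fun s _ => dD s) cD dDM.
have -> : D a = 1%:M by rewrite /D XYa unitary_adj_mul.
move=> H; have -> : X t - Y t = Y t *m (D t - 1%:M).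
  by rewrite mulmxBr mulmx1 /D mulmxA (unitarymxP (uY t)) mul1mx.
apply: le_trans (mnorm_mul _ _) _.
apply: (@le_trans _ _ (u * (u * (u * e * u) * (t - a)))).
  by apply: ler_pM; rewrite ?mnorm_ge0 ?mnorm_unitary_le.
by rewrite le_eqVlt; apply/orP; left; apply/eqP; ring.
Qed.

Lemma propagator_near1 A X a t M : a <= t ->
  (forall s, mder X s (A s *m X s)) -> (forall s, X s \is unitarymx) ->
  X a = 1%:M -> (forall s, a < s < t -> mnorm (A s) <= M) ->
  mnorm (X t - 1%:M) <= u ^+ 4 * M * (t - a).
Proof.
move=> at_ dX uX Xa AM.
apply: (@propagator_compare A (fun=> 0) X (fun=> 1%:M) _ _ _ at_ _ dX _ uX).
- by move=> s; rewrite trmx0 map_mx0 oppr0.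
- by move=> s; rewrite mul0mx; exact: mder_cst.
- by move=> s; apply/unitarymxP; rewrite trmx1 map_mx1 mulmx1.
- exact: Xa.
- by move=> s /AM; rewrite subr0.
Qed.

Lemma propagator_lip A X a t M : a <= t ->
  (forall s, mder X s (A s *m X s)) -> (forall s, X s \is unitarymx) ->
  (forall s, a < s < t -> mnorm (A s) <= M) ->
  mnorm (X t - X a) <= u * (M * u) * (t - a).
Proof.
move=> at_ dX uX AM; apply: (mnorm_mean_value at_ (fun s _ => dX s)).
  exact: mder_mcont dX.
move=> s /AM As; apply: le_trans (mnorm_mul _ _) _.
by apply: ler_pM; rewrite ?mnorm_ge0 ?mnorm_unitary_le.
Qed.

(** The three factors are changed one at a time. Every Lipschitz or closeness property of the
    weights is an instance of this. *)
Lemma mnorm_conj_diff (X Y X' Y' G G' : 'M[R[i]]_N) (e g M : R) :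
  X \is unitarymx -> Y \is unitarymx -> X' \is unitarymx -> Y' \is unitarymx ->
  mnorm G <= M -> mnorm (X - X') <= e -> mnorm (Y - Y') <= e ->
  mnorm (G - G') <= g ->
  mnorm (Y ^t* *m G *m X - Y' ^t* *m G' *m X') <= 2 * u * M * e + u ^+ 2 * g.
Proof.
move=> uX uY uX' uY' GM Xe Ye Gg.
have -> : Y ^t* *m G *m X - Y' ^t* *m G' *m X' =
    ((Y - Y') ^t* *m G *m X + Y' ^t* *m G *m (X - X')) +
    Y' ^t* *m (G - G') *m X'.
  rewrite linearB map_mxB /= !mulmxBl !mulmxBr !mulmxBl.
  by rewrite !addrA !subrK.
have u0 : 0 <= u by rewrite mulr_ge0.
have bound (A B C : 'M[R[i]]_N) (x y z : R) :
    mnorm A <= x -> mnorm B <= y -> mnorm C <= z ->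
    mnorm (A *m B *m C) <= x * y * z.
  move=> Ax By Cz; apply: le_trans (mnorm_mul _ _) _.
  apply: ler_pM; rewrite ?mnorm_ge0//; apply: le_trans (mnorm_mul _ _) _.
  by apply: ler_pM; rewrite ?mnorm_ge0.
apply: le_trans (mnorm_add _ _) _.
have -> : 2 * u * M * e + u ^+ 2 * g = (e * M * u + u * M * e) + u * g * u by ring.
apply: lerD; last by apply: bound; rewrite ?mnorm_adj ?mnorm_unitary_le.
apply: le_trans (mnorm_add _ _) _; apply: lerD;
  by apply: bound; rewrite ?mnorm_adj ?mnorm_unitary_le.
Qed.

Lemma Re_trace_le (P Q : 'M[R[i]]_N) :
  `|Re (\tr (P *m Q))| <= mnorm P * mnorm Q.
Proof.
apply: le_trans (mnorm_mul _ _); apply: le_trans (Re_le_cnorm _) _.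
apply: le_trans (cnorm_sum _) _; apply: ler_sum => i _.
by rewrite (bigD1 i)//= lerDl sumr_ge0// => j _; exact: cnorm_ge0.
Qed.

End Propagators.

Section EuclideanNorm.
Variables (R : realType) (n : nat).
Implicit Types (v w : 'rV[R]_n).

Lemma enorm_sqr v : enorm v ^+ 2 = \sum_i v 0 i ^+ 2.
Proof. by rewrite sqr_sqrtr// sumr_ge0// => i _; exact: sqr_ge0. Qed.

Lemma enorm_ge0 v : 0 <= enorm v. Proof. exact: sqrtr_ge0. Qed.

Lemma entry_le_norm v i : `|v 0 i| <= `|v|.
Proof.
by rewrite [leRHS]/Num.norm /= mx_normrE; apply/bigmax_geP; right; exists (0, i).
Qed.

Lemma enorm_le_sup v : enorm v <= n%:R * `|v|.
Proof.
have nv : 0 <= n%:R * `|v| by rewrite mulr_ge0.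
rewrite -(ger0_norm nv) -sqrtr_sqr ler_wsqrtr//.
have le1 i : v 0 i ^+ 2 <= `|v| ^+ 2.
  rewrite -[v 0 i ^+ 2]real_normK ?num_real// ler_sqr ?nnegrE//.
  exact: entry_le_norm.
apply: (@le_trans _ _ (\sum_(i < n) `|v| ^+ 2)); first exact: ler_sum.
rewrite sumr_const card_ord exprMn -[leLHS]mulr_natl ler_wpM2r ?sqr_ge0//.
by rewrite -natrX ler_nat expnS expn1; case: (n) => // k; rewrite leq_pmull.
Qed.

End EuclideanNorm.

(** * Construction of the weights in a plane *)

Section Charts.
Variables (R : realType) (n N : nat).
Implicit Types (v : 'rV[R]_n) (A G : 'rV[R]_n -> 'M[R[i]]_N).
Local Notation Re := complex.Re.
Local Open Scope sesquilinear_scope.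
Local Open Scope complex_scope.

Definition dot (v w : 'rV[R]_n) : R := \sum_i v 0 i * w 0 i.

Lemma dot_sqr_le v (w : 'rV[R]_n) : dot v w ^+ 2 <= (enorm v * enorm w) ^+ 2.
Proof.
rewrite exprMn !enorm_sqr -(ler_pM2l (ltr0n R 2)) /dot.
have -> : 2 * ((\sum_i v 0 i ^+ 2) * (\sum_i w 0 i ^+ 2)) =
    \sum_i \sum_j (v 0 i ^+ 2 * w 0 j ^+ 2 + v 0 j ^+ 2 * w 0 i ^+ 2).
  rewrite mulr_natl mulr2n {1}big_distrlr mulrC big_distrlr -big_split /=.
  apply: eq_bigr => i _; rewrite -big_split; apply: eq_bigr => j _ /=.
  by congr (_ + _); rewrite mulrC.
rewrite expr2 big_distrlr mulr_sumr; apply: ler_sum => i _.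
rewrite mulr_sumr; apply: ler_sum => j _ /=.
rewrite -subr_ge0.
have -> : v 0 i ^+ 2 * w 0 j ^+ 2 + v 0 j ^+ 2 * w 0 i ^+ 2 -
    2 * (v 0 i * w 0 i * (v 0 j * w 0 j)) = (v 0 i * w 0 j - v 0 j * w 0 i) ^+ 2.
  by ring.
exact: sqr_ge0.
Qed.

Lemma enorm_sqrD v w :
  enorm (v + w) ^+ 2 = enorm v ^+ 2 + 2 * dot v w + enorm w ^+ 2.
Proof.
rewrite !enorm_sqr /dot mulr_sumr -!big_split /=.
by apply: eq_bigr => i _; rewrite mxE; ring.
Qed.

Lemma enormD v w : enorm (v + w) <= enorm v + enorm w.
Proof.
have h : 0 <= enorm v * enorm w by rewrite mulr_ge0// enorm_ge0.
have dvw : dot v w <= enorm v * enorm w.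
  apply: le_trans (ler_norm _) _; rewrite -ler_sqr ?nnegrE//.
  by rewrite real_normK ?num_real// dot_sqr_le.
rewrite -ler_sqr ?nnegrE ?addr_ge0 ?enorm_ge0// enorm_sqrD; nra.
Qed.

Lemma enormN v : enorm (- v) = enorm v.
Proof. by rewrite -scaleN1r enormZ normrN1 mul1r. Qed.

Lemma enorm_dist v w : `|enorm v - enorm w| <= enorm (v - w).
Proof.
rewrite ler_norml; apply/andP; split.
  have := enormD v (w - v); rewrite addrC subrK -[w - v]opprB enormN; lra.
have := enormD w (v - w); rewrite addrC subrK; lra.
Qed.

(** Required on the whole space, so that the equation has a global unitary solution along every
    line. *)
Definition regular L M A : Prop :=
  [/\ forall x y, mnorm (A x - A y) <= L * `|x - y|,
      forall x, mnorm (A x) <= M & forall x, (A x) ^t* = A x].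

Lemma cnorm_i_real (c : R) : cnorm (- ('i * c%:C)) = `|c|.
Proof.
by rewrite /cnorm /= !(mul0r, mul1r, mulr0, addr0, subr0, oppr0, normr0, add0r) normrN.
Qed.

Lemma line_ode_exists L M A (x d : 'rV[R]_n) a : regular L M A ->
  exists X, line_ode A x d X /\ X a = 1%:M.
Proof.
move=> [AL AM Ah]; set c := - ('i * (enorm d)%:C).
have cc : 0 <= cnorm c by exact: cnorm_ge0.
have Bc : mcont setT (fun t => c *: A (x + t *: d)).
  apply: (@mcont_lip _ _ _ (cnorm c * (L * `|d|))) => s t.
  rewrite -scalerBr; apply: le_trans (mnorm_scale _ _) _.
  rewrite -mulrA ler_wpM2l//; apply: le_trans (AL _ _) _.
  by rewrite opprD addrACA subrr add0r -scalerBl normrZ mulrCA [leRHS]mulrC mulrCA mulrC.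
have BM t : mnorm (c *: A (x + t *: d)) <= cnorm c * M.
  by apply: le_trans (mnorm_scale _ _) _; rewrite ler_wpM2l.
have [X [dX Xa]] := ode_exists a Bc BM.
exists X; split=> //; split=> //.
by apply: (skew_ode_unitary _ dX Xa) => t; exact: skew_of_hermitian.
Qed.

(* [i (Y^* X)] moves along the line with velocity [|d| hh Y^* G X]. *)
Lemma weight_derivative A A' G (hh : 'rV[R]_n -> R) (x d : 'rV[R]_n) X Y P :
  (forall y, A y - A' y = (hh y)%:C *: G y) -> (forall y, (A' y) ^t* = A' y) ->
  0 < enorm d -> line_ode A x d X -> line_ode A' x d Y ->
  forall t : R, is_derive t 1
    (fun t => (enorm d)^-1 * Re (\tr (P *m ('i *: ((Y t) ^t* *m X t)))))
    (hh (x + t *: d) * Re (\tr (P *m ((Y t) ^t* *m G (x + t *: d) *m X t)))).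
Proof.
move=> AA' hA' l0 [dX _] [dY _] t; set l := enorm d in l0 dX dY *.
have dYs : (- ('i * l%:C) *: A' (x + t *: d)) ^t* =
    - (- ('i * l%:C) *: A' (x + t *: d)) by exact: skew_of_hermitian.
have := mderM (mder_cst P t) (mderZ 'i (mderM (mder_adj (dY t)) (dX t))).
rewrite mul0mx add0r adj_mul dYs => dD.
have trE (Q : R -> 'M[R[i]]_N) D : mder Q t D ->
    is_derive t 1 (fun t => l^-1 * Re (\tr (Q t))) (l^-1 * Re (\tr D)).
  move=> dQ; have [d1 _] := cder_sum (fun i => dQ i i).
  exact: (is_deriveZ l^-1 d1).
apply: is_derive_eq (trE _ _ dD) _.
set yy := Y t; set xx := X t; set q := x + t *: d.
have -> : 'i *: (yy ^t* *m - (- ('i * l%:C) *: A' q) *m xx +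
    yy ^t* *m (- ('i * l%:C) *: A q *m xx)) =
    (l * hh q)%:C *: (yy ^t* *m G q *m xx).
  rewrite mulmxA -mulmxDl -mulmxDr.
  have -> : - (- ('i * l%:C) *: A' q) + - ('i * l%:C) *: A q =
      - ('i * l%:C) *: (A q - A' q) by rewrite scalerBr addrC.
  rewrite AA' scalerA -scalemxAr -scalemxAl scalerA; congr (_ *: _).
  by apply: complexP => /=; ring.
by rewrite -scalemxAr linearZ /= Re_mul /= mul0r subr0 -mulrA mulKf ?gt_eqF.
Qed.

Lemma chart_weight_mono d d' C C' h (w : R -> R -> R -> R) : d <= d' -> C <= C' ->
  chart_weight d C h w -> chart_weight d' C' h w.
Proof.
move=> dd CC [w1 w2 w3 w4 w5]; split=> //.
- by move=> *; apply: le_trans dd; exact: w1.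
- by move=> *; apply: le_trans (ler_wpM2r _ dd); [exact: w2|].
- by move=> *; apply: le_trans (ler_wpM2r _ CC); [exact: w3|].
- by move=> *; apply: le_trans (ler_wpM2r _ CC); [exact: w4|].
Qed.

Local Notation u := (2 * (N * N)%:R : R).

(** Serves two estimates at once: closeness to 1, where the propagators contribute 2M and [G] moves
    by at most 3 L rho, and variation in the slope, where they contribute M + 4L. *)
Definition weight_const (L M : R) (P : 'M[R[i]]_N) : R :=
  mnorm P * (2 * u * M * (2 * u ^+ 4 * n%:R * (2 * M + 4 * L)) + 3 * u ^+ 2 * L).

(** All lines have length of order [rho], so the propagators stay near the identity and [G] near
    [G p]; the weight is then near Re tr (P G(p)) = 1, and its variation with the slope carries a
    factor [rho] too. Exchanging [v1] and [v2] gives the second chart. *)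
Lemma chart_weight_exists L M A A' G (hh : 'rV[R]_n -> R) P
    (p x0 v1 v2 : 'rV[R]_n) rho d :
  0 <= L -> 0 <= M ->
  regular L M A -> regular L M A' -> regular L M G ->
  (forall y, A y - A' y = (hh y)%:C *: G y) ->
  \tr P = 0 -> \tr (P *m G p) = 1 ->
  0 < rho <= 1 -> `|v1| <= rho -> `|v2| <= rho -> `|x0 - p| <= rho ->
  (forall t, 0 < enorm (t *: v1 + v2)) ->
  weight_const L M P * rho <= d ->
  (forall (s t : R) X Y, `|t| <= 1 ->
     line_ode A (x0 + s *: v1) (t *: v1 + v2) X ->
     line_ode A' (x0 + s *: v1) (t *: v1 + v2) Y ->
     X (-1) = 1%:M -> Y (-1) = 1%:M ->
     exists z : R[i], (Y 1) ^t* *m X 1 = z%:M) ->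
  exists C w, 0 <= C /\
    chart_weight d C (fun x y => hh (x0 + x *: v1 + y *: v2)) w.
Proof.
move=> L0 M0 rA rA' rG AA' trP trPG /andP[r0 r1] v1r v2r x0p enz dr scal.
have u0 : 0 <= u by rewrite mulr_ge0.
pose dir (t : R) := t *: v1 + v2.
have [X XP] := choice (fun st : R * R =>
  line_ode_exists (x0 + st.1 *: v1) (dir st.2) (-1) rA).
have [Y YP] := choice (fun st : R * R =>
  line_ode_exists (x0 + st.1 *: v1) (dir st.2) (-1) rA').
pose pt (x y : R) := x0 + x *: v1 + y *: v2.
have ptE s t r : x0 + s *: v1 + r *: dir t = pt (s + r * t) r.
  by rewrite /dir /pt scalerDr scalerA scalerDl !addrA.
have ptB x y x' : pt x y - pt x' y = (x - x') *: v1.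
  by rewrite /pt opprD addrACA subrr addr0 opprD addrACA subrr add0r scalerBl.
(* The line of slope [t] through (x, y) has abscissa x - y t at parameter 0 and reaches the point at
   parameter [y]. *)
pose Z x y t := (Y (x - y * t, t) y) ^t* *m G (pt x y) *m X (x - y * t, t) y.
pose w x y t : R := Re (\tr (P *m Z x y t)).
have P0 : 0 <= mnorm P by exact: mnorm_ge0.
have wdiff (Q Q' : 'M[R[i]]_N) e : mnorm (Q - Q') <= e ->
    `|Re (\tr (P *m Q)) - Re (\tr (P *m Q'))| <= mnorm P * e.
  move=> Qe; have -> : Re (\tr (P *m Q)) - Re (\tr (P *m Q')) =
      Re (\tr (P *m (Q - Q'))).
    by rewrite mulmxBr linearB /= Re_add Re_opp.
  by apply: le_trans (Re_trace_le _ _) _; rewrite ler_wpM2l.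
have dirN t : `|t| <= 1 -> `|dir t| <= 2 * rho.
  move=> t1; apply: le_trans (ler_normD _ _) _; rewrite normrZ.
  have := ler_pM (normr_ge0 t) (normr_ge0 v1) t1 v1r; lra.
have dirE t : `|t| <= 1 -> enorm (dir t) <= 2 * n%:R * rho.
  move=> t1; apply: le_trans (enorm_le_sup _) _.
  by rewrite mulrAC [leRHS]mulrC ler_wpM2l// dirN.
have dirB t t' : `|enorm (dir t) - enorm (dir t')| <= n%:R * rho * `|t - t'|.
  apply: le_trans (enorm_dist _ _) _.
  rewrite /dir opprD addrACA subrr addr0 -scalerBl enormZ mulrC ler_wpM2r//.
  by apply: le_trans (enorm_le_sup _) _; rewrite ler_wpM2l.
have [AL AM Ah] := rA; have [AL' AM' Ah'] := rA'; have [GL GM Gh] := rG.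
pose gen B s t r : 'M[R[i]]_N := - ('i * (enorm (dir t))%:C) *: B (x0 + s *: v1 + r *: dir t).
have genM B : regular L M B -> forall s t r, `|t| <= 1 ->
    mnorm (gen B s t r) <= 2 * n%:R * M * rho.
  move=> [_ BM _] s t r t1; apply: le_trans (mnorm_scale _ _) _.
  rewrite cnorm_i_real ger0_norm ?enorm_ge0//.
  have -> : 2 * n%:R * M * rho = 2 * n%:R * rho * M by ring.
  by apply: ler_pM; rewrite ?enorm_ge0 ?mnorm_ge0 ?dirE.
have genB B : regular L M B -> forall s s' t t' r, `|t| <= 1 -> `|t'| <= 1 ->
    mnorm (gen B s t r - gen B s' t' r) <=
    n%:R * rho * (M * `|t - t'| + 2 * L * `|(s + r * t) - (s' + r * t')|).
  move=> [BL BM _] s s' t t' r t1 t1'.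
  have -> : gen B s t r - gen B s' t' r =
      (- ('i * (enorm (dir t) - enorm (dir t'))%:C)) *: B (x0 + s *: v1 + r *: dir t) +
      (- ('i * (enorm (dir t'))%:C)) *:
        (B (x0 + s *: v1 + r *: dir t) - B (x0 + s' *: v1 + r *: dir t')).
    rewrite scalerBr addrA -scalerDl /gen; congr (_ *: _ - _).
    by rewrite rmorphB /=; ring.
  apply: le_trans (mnorm_add _ _) _; rewrite mulrDr; apply: lerD.
    apply: le_trans (mnorm_scale _ _) _; rewrite cnorm_i_real.
    have -> : n%:R * rho * (M * `|t - t'|) = n%:R * rho * `|t - t'| * M by ring.
    by apply: ler_pM; rewrite ?mnorm_ge0 ?dirB.
  apply: le_trans (mnorm_scale _ _) _; rewrite cnorm_i_real ger0_norm ?enorm_ge0//.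
  have -> : n%:R * rho * (2 * L * `|s + r * t - (s' + r * t')|) =
      2 * n%:R * rho * (L * `|s + r * t - (s' + r * t')|) by ring.
  apply: ler_pM; rewrite ?enorm_ge0 ?mnorm_ge0 ?dirE//.
  apply: le_trans (BL _ _) _; rewrite !ptE ptB normrZ ler_wpM2l//.
  by rewrite ler_piMr// (le_trans v1r).
have compare B V : regular L M B -> (forall st,
    line_ode B (x0 + st.1 *: v1) (dir st.2) (V st) /\ V st (-1) = 1%:M) ->
    forall x x' y t t', `|y| <= 1 -> `|t| <= 1 -> `|t'| <= 1 ->
    mnorm (V (x - y * t, t) y - V (x' - y * t', t') y) <=
    2 * u ^+ 4 * n%:R * rho * ((M + 4 * L) * `|t - t'| + 2 * L * `|x - x'|).
  move=> rB VP x x' y t t' y1 t1 t1'.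
  have [[dV uV] Va] := VP (x - y * t, t); have [[dV' uV'] Va'] := VP (x' - y * t', t').
  have y1' : -1 <= y by move: y1; rewrite ler_norml => /andP[].
  have y2' : y <= 1 by move: y1; rewrite ler_norml => /andP[].
  have xt0 : 0 <= n%:R * rho * ((M + 4 * L) * `|t - t'| + 2 * L * `|x - x'|).
    rewrite mulr_ge0 ?mulr_ge0 ?(ltW r0)// addr_ge0 ?mulr_ge0// addr_ge0 ?mulr_ge0//.
  have := @propagator_compare _ _ (gen B (x - y * t) t) (gen B (x' - y * t') t') _ _ _ _
    (n%:R * rho * ((M + 4 * L) * `|t - t'| + 2 * L * `|x - x'|))
    y1' (fun s => skew_of_hermitian _ _) dV dV' uV uV' (etrans Va (esym Va')) _.
  move=> /(_ _ _)/le_trans; apply.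
  - by move=> s; case: rB.
  - move=> s /andP[s1 s2]; apply: le_trans (genB B rB _ _ _ _ _ t1 t1') _.
    rewrite ler_wpM2l ?mulr_ge0 ?(ltW r0)//.
    have E : `|x - y * t + s * t - (x' - y * t' + s * t')| <=
        `|x - x'| + 2 * `|t - t'|.
      have -> : x - y * t + s * t - (x' - y * t' + s * t') =
          (x - x') + (s - y) * (t - t') by ring.
      apply: le_trans (ler_normD _ _) _; rewrite lerD2l normrM ler_wpM2r//.
      by rewrite ler_norml; lra.
    have := ler_wpM2l L0 E; lra.
  - have -> : 2 * u ^+ 4 * n%:R * rho * ((M + 4 * L) * `|t - t'| + 2 * L * `|x - x'|) =
      u ^+ 4 * (n%:R * rho * ((M + 4 * L) * `|t - t'| + 2 * L * `|x - x'|)) * 2 by ring.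
    by apply: ler_wpM2l; [exact: mulr_ge0 (exprn_ge0 _ u0) xt0 | lra].
have near1 B V : regular L M B -> (forall st,
    line_ode B (x0 + st.1 *: v1) (dir st.2) (V st) /\ V st (-1) = 1%:M) ->
    forall s y t, `|y| <= 1 -> `|t| <= 1 ->
    mnorm (V (s, t) y - 1%:M) <= 2 * u ^+ 4 * n%:R * (2 * M) * rho.
  move=> rB VP s y t y1 t1; have [[dV uV] Va] := VP (s, t).
  have y1' : -1 <= y by move: y1; rewrite ler_norml => /andP[].
  have y2' : y <= 1 by move: y1; rewrite ler_norml => /andP[].
  have := @propagator_near1 _ _ (gen B s t) _ _ _ (2 * n%:R * M * rho) y1' dV uV Va.
  move=> /(_ _)/le_trans; apply; first by move=> r _; exact: genM.
  have -> : 2 * u ^+ 4 * n%:R * (2 * M) * rho = u ^+ 4 * (2 * n%:R * M * rho) * 2 by ring.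
  apply: ler_wpM2l; last by lra.
  by rewrite mulr_ge0 ?exprn_ge0// !mulr_ge0 ?(ltW r0).
have uX st y : X st y \is unitarymx by have [[_ ?] _] := XP st.
have uY st y : Y st y \is unitarymx by have [[_ ?] _] := YP st.
have un1 : (1%:M : 'M[R[i]]_N) \is unitarymx.
  by apply/unitarymxP; rewrite trmx1 map_mx1 mulmx1.
have pt_near x y : `|x| <= 1 -> `|y| <= 1 -> `|pt x y - p| <= 3 * rho.
  move=> x1 y1; have -> : pt x y - p = (x0 - p) + (x *: v1 + y *: v2).
    by rewrite /pt -(addrA x0) addrAC.
  apply: le_trans (ler_normD _ _) _; have := ler_normD (x *: v1) (y *: v2).
  rewrite !normrZ.
  have := ler_pM (normr_ge0 x) (normr_ge0 v1) x1 v1r.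
  have := ler_pM (normr_ge0 y) (normr_ge0 v2) y1 v2r; lra.
pose C1 := mnorm P * (2 * u * M * (2 * u ^+ 4 * n%:R * rho * (2 * L)) + u ^+ 2 * L).
pose C2 := mnorm P * (2 * u * M * (u * (2 * n%:R * M * rho * u)) + u ^+ 2 * (L * 2)).
have n0 : 0 <= n%:R :> R by [].
have rho0 := ltW r0.
exists (C1 + C2), w; split.
  by rewrite /C1 /C2 !(addr_ge0, mulr_ge0, exprn_ge0).
apply: (@chart_weight_mono (weight_const L M P * rho) _ (C1 + C2)) => //.
have C10 : 0 <= C1 by rewrite /C1 !(addr_ge0, mulr_ge0, exprn_ge0).
have C20 : 0 <= C2 by rewrite /C2 !(addr_ge0, mulr_ge0, exprn_ge0).
split.
- move=> x y t x1 y1 t1.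
  have -> : 1 = Re (\tr (P *m (1%:M ^t* *m G p *m 1%:M))) :> R.
    by rewrite trmx1 map_mx1 mul1mx mulmx1 trPG.
  have H := mnorm_conj_diff (uX (x - y * t, t) y) (uY (x - y * t, t) y) un1 un1
    (GM _) (near1 A X rA XP _ _ _ y1 t1) (near1 A' Y rA' YP _ _ _ y1 t1)
    (le_trans (GL (pt x y) p) (ler_wpM2l L0 (pt_near x y x1 y1))).
  apply: le_trans (wdiff _ _ _ H) _; rewrite /weight_const -[leRHS]mulrA ler_wpM2l//.
  rewrite -subr_ge0.
  set k := (X in 0 <= X); have -> : k = 2 * u * M * (2 * u ^+ 4 * n%:R * (4 * L)) * rho.
    by rewrite /k; ring.
  by rewrite !(addr_ge0, mulr_ge0, exprn_ge0).
- move=> x y t t' x1 y1 t1 t1'.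
  have H := mnorm_conj_diff (uX (x - y * t, t) y) (uY (x - y * t, t) y)
    (uX (x - y * t', t') y) (uY (x - y * t', t') y) (GM (pt x y))
    (compare A X rA XP x x y t t' y1 t1 t1') (compare A' Y rA' YP x x y t t' y1 t1 t1')
    (le_trans (GL (pt x y) (pt x y)) (lexx _)).
  apply: le_trans (wdiff _ _ _ H) _; rewrite /weight_const !subrr !normr0 !mulr0 !addr0.
  rewrite -[leRHS]mulrA -[leRHS]mulrA ler_wpM2l//.
  rewrite -subr_ge0.
  set k := (X in 0 <= X).
  have -> : k = (2 * u * M * (2 * u ^+ 4 * n%:R * (M)) +
    3 * u ^+ 2 * L) * rho * `|t - t'| by rewrite /k; ring.
  by rewrite !(addr_ge0, mulr_ge0, exprn_ge0).
- move=> x x' y t x1 x1' y1 t1.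
  have GLx : mnorm (G (pt x y) - G (pt x' y)) <= L * `|x - x'|.
    apply: le_trans (GL _ _) _; rewrite ptB normrZ ler_wpM2l// ler_piMr//.
    exact: le_trans v1r r1.
  have H := mnorm_conj_diff (uX (x - y * t, t) y) (uY (x - y * t, t) y)
    (uX (x' - y * t, t) y) (uY (x' - y * t, t) y) (GM (pt x y))
    (compare A X rA XP x x' y t t y1 t1 t1) (compare A' Y rA' YP x x' y t t y1 t1 t1)
    GLx.
  apply: le_trans (wdiff _ _ _ H) _.
  apply: (@le_trans _ _ (C1 * `|x - x'|)).
    rewrite subrr normr0 mulr0 add0r /C1 -[leRHS]mulrA ler_wpM2l//.
    by rewrite le_eqVlt; apply/orP; left; apply/eqP; ring.
  by rewrite ler_wpM2r// lerDl.
- move=> s r t tau tau1 r1' t1 h1 h2.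
  wlog rt : r t r1' t1 h1 h2 / r <= t.
    move=> W; have [rt|/ltW tr] := leP r t; first exact: W.
    by rewrite distrC [`|r - t|]distrC; exact: W.
  have e1 : s + r * tau - r * tau = s by rewrite addrK.
  have e2 : s + t * tau - t * tau = s by rewrite addrK.
  have lipV B V : regular L M B -> (forall st,
      line_ode B (x0 + st.1 *: v1) (dir st.2) (V st) /\ V st (-1) = 1%:M) ->
      mnorm (V (s, tau) r - V (s, tau) t) <= u * (2 * n%:R * M * rho * u) * (t - r).
    move=> rB VP; have [[dV uV] _] := VP (s, tau).
    rewrite -mnorm_opp opprB.
    apply: (@propagator_lip _ _ (gen B s tau)) => // q _; exact: genM.
  have GLr : mnorm (G (pt (s + r * tau) r) - G (pt (s + t * tau) t)) <=
      L * 2 * (t - r).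
    apply: le_trans (GL _ _) _; rewrite -!ptE opprD addrACA subrr add0r -scalerBl.
    rewrite normrZ -mulrA ler_wpM2l// distrC ger0_norm ?subr_ge0// mulrC.
    rewrite ler_wpM2r ?subr_ge0//; apply: le_trans (dirN _ tau1) _; lra.
  rewrite /w /Z e1 e2.
  have H := mnorm_conj_diff (uX (s, tau) r) (uY (s, tau) r)
    (uX (s, tau) t) (uY (s, tau) t) (GM (pt (s + r * tau) r))
    (lipV A X rA XP) (lipV A' Y rA' YP) GLr.
  apply: le_trans (wdiff _ _ _ H) _.
  apply: (@le_trans _ _ (C2 * `|r - t|)).
    rewrite distrC ger0_norm ?subr_ge0// /C2 -[leRHS]mulrA ler_wpM2l//.
    by rewrite le_eqVlt; apply/orP; left; apply/eqP; ring.
  by rewrite ler_wpM2r// lerDr.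
- move=> s tau tau1.
  have [[dX _] Xa] := XP (s, tau); have [[dY _] Ya] := YP (s, tau).
  rewrite /= in dX dY; set l := enorm _ in dX dY.
  have l0 : 0 < l by exact: enz.
  (* The antiderivative is the one of [weight_derivative]. At both ends [Y^* X] is a scalar matrix,
     so its pairing with the traceless [P] is 0 and the unknown phase disappears. *)
  exists (fun t =>
    l^-1 * Re (\tr (P *m ('i *: ((Y (s, tau) t) ^t* *m X (s, tau) t))))).
  split=> [t|]; last first.
    have [z ->] := scal s tau _ _ tau1 (XP (s, tau)).1 (YP (s, tau)).1 Xa Ya.
    rewrite Xa Ya trmx1 map_mx1 mulmx1 -!scalemxAr mulmx1 mul_mx_scalar.
    by rewrite !linearZ /= trP !mulr0.
  have := weight_derivative P AA' Ah' l0 (XP (s, tau)).1 (YP (s, tau)).1 t.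
  by rewrite /w /Z addrK -/(pt (s + t * tau) t) -ptE.
Qed.

End Charts.

(** * Lipschitz functions on strictly convex domains *)

Section Lipschitz.
Variables (R : realType) (n : nat).
Implicit Types (f g : 'rV[R]_n -> R) (U : set 'rV[R]_n).

Lemma is_derive_line f (z v : 'rV[R]_n) (t : R) :
  derivable f (z + t *: v) v ->
  is_derive t 1 (fun s => f (z + s *: v)) ('D_v f (z + t *: v)).
Proof.
move=> fd.
have E : (fun h : R => h^-1 *: (f (z + (h *: 1 + t) *: v) - f (z + t *: v))) =
    (fun h : R => h^-1 *: (f (h *: v + (z + t *: v)) - f (z + t *: v))).
  apply/funext => h; congr (_ *: (f _ - _)).
  have -> : h *: (1 : R) = h by exact: mulr1.
  by rewrite scalerDl addrCA.
apply: DeriveDef; last by rewrite /derive E.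
by rewrite /derivable E.
Qed.

Lemma coord_le_norm (v : 'rV[R]_n) e : 0 <= e -> (forall i, `|v 0 i| <= e) -> `|v| <= e.
Proof.
move=> e0 ve; rewrite /Num.norm /= mx_normrE; apply/bigmax_leP; split=> //.
by move=> [i j] _ /=; rewrite ord1.
Qed.

(* The segment from x to y is replaced by a path along the axes, which stays in
   the cube since cubes are products. *)
Lemma lip_cube f (c : 'rV[R]_n) (r K : R) : 0 <= K ->
  (forall x, `|x - c| < r -> forall i, has_partial i f x /\ `|partial i f x| <= K) ->
  forall x y, `|x - c| < r -> `|y - c| < r ->
    `|f x - f y| <= n%:R * K * `|x - y|.
Proof.
move=> K0 fK x y xc yc.
pose p k : 'rV[R]_n := \row_i (if (i < k)%N then x 0 i else y 0 i).
have r0 : 0 < r by exact: le_lt_trans xc.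
have p_in (k : nat) (hk : (k < n)%N) (t : R) : `|t| <= 1 -> 0 <= t ->
    `|p k + (t * (x - y) 0 (Ordinal hk)) *: delta_mx 0 (Ordinal hk) - c| < r.
  move=> t1 t0; rewrite ger0_norm// in t1.
  set m := Num.max `|x - c| `|y - c|.
  have mr : m < r by rewrite /m gt_max xc yc.
  apply: le_lt_trans mr; apply: coord_le_norm.
    by rewrite /m le_max normr_ge0.
  move=> i; rewrite !mxE eqxx /=.
  have xm : `|x 0 i - c 0 i| <= m.
    by have := entry_le_norm (x - c) i; rewrite !mxE /m le_max => ->.
  have ym : `|y 0 i - c 0 i| <= m.
    by have := entry_le_norm (y - c) i; rewrite !mxE /m le_max orbC => ->.
  have [->|ik] := eqVneq i (Ordinal hk); last first.
    by rewrite mulr0 addr0; case: ifP.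
  rewrite /= ltnn mulr1.
  move: xm ym; rewrite -[Ordinal hk]/(Ordinal hk) => _ _.
  have xm : `|x 0 (Ordinal hk) - c 0 (Ordinal hk)| <= m.
    by have := entry_le_norm (x - c) (Ordinal hk); rewrite !mxE /m le_max => ->.
  have ym : `|y 0 (Ordinal hk) - c 0 (Ordinal hk)| <= m.
    by have := entry_le_norm (y - c) (Ordinal hk); rewrite !mxE /m le_max orbC => ->.
  move: xm ym; rewrite !ler_norml => /andP[? ?] /andP[? ?]; apply/andP; split; nra.
have p0 : p 0%N = y by apply/rowP => i; rewrite mxE.
have pn : p n = x by apply/rowP => i; rewrite mxE ltn_ord.
have pS (k : nat) (hk : (k < n)%N) :
    p k.+1 = p k + (1 * (x - y) 0 (Ordinal hk)) *: delta_mx 0 (Ordinal hk).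
  apply/rowP => i; rewrite !mxE eqxx /=.
  have [->|ik] := eqVneq i (Ordinal hk).
    by rewrite /= ltnSn ltnn; ring.
  rewrite mulr0 addr0 ltnS leq_eqVlt.
  by have -> : (i == k :> nat) = false by apply: contraNF ik => /eqP ik; apply/eqP/val_inj.
have step (k : nat) : (k < n)%N -> `|f (p k.+1) - f (p k)| <= K * `|x - y|.
  move=> hk; set i := Ordinal hk; set d := (x - y) 0 i.
  pose phi t := f (p k + t *: (d *: delta_mx 0 i)).
  have [d0|d0] := eqVneq d 0.
    by rewrite pS -/i -/d d0 mulr0 scale0r addr0 subrr normr0 mulr_ge0.
  pose psi s := f (p k + s *: delta_mx 0 i).
  have dpsi (t : R) : 0 <= t <= 1 -> is_derive (t * d) 1 psi (partial i f (p k + (t * d) *: delta_mx 0 i)).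
    move=> /andP[t0 t1]; apply: is_derive_line.
    have tn : `|t| <= 1 by rewrite ger0_norm.
    by have [dp _] := fK _ (p_in k hk t tn t0) i.
  have dchi (t : R) : 0 <= t <= 1 ->
      is_derive t 1 (fun s => psi (s * d)) (partial i f (p k + (t * d) *: delta_mx 0 i) * d).
    move=> t01; apply: (@is_derive1_comp _ psi (fun s => s * d) t _ _ (dpsi t t01)).
    have -> : (fun s => s * d) = d \*: id by apply/funext => s; exact: mulrC.
    by apply: is_derive_eq (is_deriveZ d (is_derive_id t 1)) _; exact: mulr1.
  have := @mean_value_le R (fun s => psi (s * d))
    (fun t => partial i f (p k + (t * d) *: delta_mx 0 i) * d) 0 1 (K * `|d|) ler01.
  rewrite subr0 mulr1 mul0r => H.
  have -> : f (p k.+1) - f (p k) = psi (1 * d) - psi 0.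
    by rewrite /psi scale0r addr0 pS.
  apply: (@le_trans _ _ (K * `|d|)); last first.
    by rewrite ler_wpM2l// entry_le_norm.
  apply: H.
  - by move=> t /andP[t0 t1]; apply: dchi; rewrite !ltW.
  - apply: derivable_within_continuous => t; rewrite in_itv/= => /dchi[]//.
  - move=> t /andP[t0 t1]; rewrite normrM ler_wpM2r//.
    have tn : `|t| <= 1 by rewrite ger0_norm ltW.
    by have [_ bp] := fK _ (p_in k hk t tn (ltW t0)) i.
have tot k : (k <= n)%N -> `|f (p k) - f y| <= k%:R * K * `|x - y|.
  elim: k => [_|k IH kn]; first by rewrite p0 subrr normr0 !mul0r.
  have -> : f (p k.+1) - f y = (f (p k.+1) - f (p k)) + (f (p k) - f y) by ring.
  apply: le_trans (ler_normD _ _) _.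
  have := step k kn; have := IH (ltnW kn); rewrite -[k.+1]addn1 natrD; lra.
by rewrite -{1}pn tot.
Qed.

(** Continuous induction: the supremum of the t with |phi t - phi 0| <= C t cannot be below 1,
    because the local estimate carries the bound past it. *)
Lemma local_lip_segment (phi : R -> R) (C : R) :
  (forall t, 0 <= t <= 1 -> exists2 e, 0 < e & forall s s',
     `|s - t| < e -> `|s' - t| < e -> `|phi s - phi s'| <= C * `|s - s'|) ->
  `|phi 1 - phi 0| <= C.
Proof.
move=> loc.
pose S := [set t : R | 0 <= t <= 1 /\ `|phi t - phi 0| <= C * t].
have S0 : S 0 by split; rewrite ?lexx ?ler01// subrr normr0 mulr0.
have hS : has_sup S by split; [exists 0 | exists 1 => t [/andP[]]].
pose s := sup S.
have s0 : 0 <= s by apply: ub_le_sup => //; case: hS.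
have s1 : s <= 1 by apply: ge_sup; [exists 0 | move=> t [/andP[]]].
have [e e0 es] := loc s (introT andP (conj s0 s1)).
have [t [/andP[t0 t1] tC] ts] := sup_adherent e0 hS.
have tsup : t <= s by apply: ub_le_sup; [case: hS | split; rewrite ?t0].
pose t' := Num.min 1 (s + e / 2).
have t'1 : t' <= 1 by rewrite /t' ge_min lexx.
have t's : t' <= s + e / 2 by rewrite /t' ge_min lexx orbT.
have st' : s <= t' by rewrite /t' le_min s1; lra.
have St' : S t'.
  split; first by rewrite t'1 (le_trans s0 st').
  have -> : phi t' - phi 0 = (phi t' - phi t) + (phi t - phi 0) by ring.
  apply: le_trans (ler_normD _ _) _.
  have h1 : `|t' - s| < e by rewrite ger0_norm ?subr_ge0//; lra.
  have h2 : `|t - s| < e by rewrite distrC ger0_norm ?subr_ge0//; rewrite -/s in ts; lra.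
  have := es t' t h1 h2.
  rewrite (@ger0_norm _ (t' - t)) ?subr_ge0 ?(le_trans tsup st')//; lra.
have t's' : t' <= s by apply: ub_le_sup => //; case: hS.
have t'E : t' = 1.
  move: t's'; rewrite /t' ge_min => /orP[h|h]; last by lra.
  by rewrite /t' min_l//; lra.
by move: St' => [_]; rewrite t'E mulr1.
Qed.

Definition lip_on U L f := forall x y, U x -> U y -> `|f x - f y| <= L * `|x - y|.

Variable Omega : set 'rV[R]_n.
Hypotheses (Omega_open : open Omega) (Omega_conv : strictly_convex Omega)
  (Omega_bounded : bounded_set Omega).
Variable w0 : 'rV[R]_n.
Hypothesis Omega_w0 : Omega w0.

Lemma closure_bounded : exists2 B, 0 < B & forall x, closure Omega x -> `|x| <= B.
Proof.
have [B [_ BP]] := Omega_bounded.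
have BB : B < `|B| + 1 by have := ler_norm B; lra.
exists (`|B| + 2) => [|x]; first by rewrite ltr_wpDl.
move=> /(_ _ (nbhsx_ballx x 1 ltr01))[y [Oy]]; rewrite -ball_normE /= => xy.
have yB : `|y| <= `|B| + 1 by exact: BP BB y Oy.
by have := ler_normD (x - y) y; rewrite subrK; lra.
Qed.

Lemma closure_compact : compact (closure Omega).
Proof.
have [B B0 BP] := closure_bounded.
apply: bounded_closed_compact; last exact: closed_closure.
by exists B; split=> [|M BM x /BP/le_trans]; [rewrite realE ltW|apply; exact: ltW].
Qed.

Lemma toward_w0 x t : closure Omega x -> 0 < t < 1 -> Omega ((1 - t) *: x + t *: w0).
Proof.
move=> cx t01; have [->|xw] := eqVneq x w0.
  by rewrite -scalerDl subrK scale1r.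
by apply: Omega_conv => //; exact: subset_closure.
Qed.

Lemma Omega_convex x y t : Omega x -> Omega y -> 0 <= t <= 1 ->
  Omega (x + t *: (y - x)).
Proof.
move=> Ox Oy /andP[]; rewrite le_eqVlt => /orP[/eqP<-|t0]; first by rewrite scale0r addr0.
rewrite le_eqVlt => /orP[/eqP->|t1]; first by rewrite scale1r addrC subrK.
have [->|xy] := eqVneq x y; first by rewrite subrr scaler0 addr0.
have := @Omega_conv x y t (subset_closure Ox) (subset_closure Oy) xy.
rewrite t0 t1 => /(_ isT); congr Omega.
by rewrite scalerBl scale1r scalerBr -!addrA [- _ + _]addrC.
Qed.

(** The partial derivatives are bounded since their extensions are continuous on a compact set. This
    gives Lipschitz bounds on small cubes, then along segments inside the convex set, and by
    continuity on the closure. *)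
Lemma C1holder_lip alpha f : C1holder alpha Omega f ->
  exists2 L, 0 <= L & lip_on (closure Omega) L f.
Proof.
move=> [fc fd].
have cl0 : closure Omega !=set0 by exists w0; exact: subset_closure.
have Kex i : exists K, 0 <= K /\ forall x, Omega x -> `|partial i f x| <= K.
  have [_ [g [gE gc _]]] := fd i.
  have [a _ amax] := compact_EVT_max cl0 closure_compact gc.
  have [b _ bmin] := compact_EVT_min cl0 closure_compact gc.
  exists (`|g a| + `|g b|); split=> [|x Ox]; first by rewrite addr_ge0.
  have xcl : x \in closure Omega by rewrite inE; exact: subset_closure.
  have := amax _ xcl; have := bmin _ xcl; rewrite -gE// ler_norml.
  have := ler_norm (g a); have := ler_norm (- g b); rewrite normrN.
  have := normr_ge0 (g a); have := normr_ge0 (g b); lra.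
have [K_ KP] := choice Kex.
pose K := \sum_i K_ i; have K0 : 0 <= K by apply: sumr_ge0 => i _; case: (KP i).
have KK i x : Omega x -> `|partial i f x| <= K.
  move=> Ox; apply: le_trans ((KP i).2 x Ox) _.
  by rewrite /K (bigD1 i)//= lerDl sumr_ge0// => j _; case: (KP j).
have lipO : lip_on Omega (n%:R * K) f.
  move=> x y Ox Oy; rewrite distrC [`|x - y|]distrC.
  have := @local_lip_segment (fun t => f (x + t *: (y - x))) (n%:R * K * `|y - x|).
  rewrite scale1r scale0r addr0 [x + (y - x)]addrC subrK; apply => t t01.
  have /nbhs_ballP[r /= r0 rO] := open_nbhs_nbhs (conj Omega_open (Omega_convex Ox Oy t01)).
  exists (r / (`|y - x| + 1)); first by rewrite divr_gt0// ltr_wpDl.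
  have inr s : `|s - t| < r / (`|y - x| + 1) ->
      `|x + s *: (y - x) - (x + t *: (y - x))| < r.
    move=> st; rewrite opprD addrACA subrr add0r -scalerBl normrZ.
    apply: (@le_lt_trans _ _ (`|s - t| * (`|y - x| + 1))).
      by rewrite ler_wpM2l// lerDl.
    by rewrite -ltr_pdivlMr// ltr_wpDl.
  move=> s s' /inr h /inr h'.
  have := @lip_cube f (x + t *: (y - x)) r K K0 _ _ _ h h'.
  move=> /(_ _)/le_trans; apply.
    move=> z zr i; have Oz : Omega z by apply: rO; rewrite -ball_normE /= distrC.
    by have [/(_ z Oz) h1 _] := fd i; split=> //; exact: KK.
  by rewrite opprD addrACA subrr add0r -scalerBl normrZ -[leRHS]mulrA [`|y - x| * _]mulrC.
exists (n%:R * K) => [|x y cx cy]; first by rewrite mulr_ge0.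
apply/ler_addgt0Pr => e e0.
have near z : closure Omega z -> exists2 r, 0 < r & forall z', Omega z' ->
    `|z - z'| < r -> `|f z - f z'| <= e / 2.
  move=> cz; have e2 : 0 < e / 2 by rewrite divr_gt0.
  have /subspace_continuousP/(_ z cz)/cvgrPdist_le/(_ _ e2) := fc.
  move=> /nbhs_ballP[r /= r0 rP]; exists r => // z' Oz' zz'.
  by apply: rP; [rewrite -ball_normE | exact: subset_closure].
have [r r0 rP] := near x cx; have [r' r'0 r'P] := near y cy.
have [B B0 BP] := closure_bounded.
(* Both points are pulled towards [w0] into the open set; each moves by at most 2 B t, less than
   either radius, and the map does not increase their distance. *)
pose t := Num.min (1 / 2) (Num.min r r' / (4 * B)).
have m0 : 0 < Num.min r r' by rewrite lt_min r0.
have t0 : 0 < t by rewrite /t lt_min !divr_gt0// mulr_gt0.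
have t1 : t <= 1 / 2 by rewrite /t ge_min lexx.
have tr : t * (2 * B) < Num.min r r'.
  have : t <= Num.min r r' / (4 * B) by rewrite /t ge_min lexx orbT.
  rewrite ler_pdivlMr ?mulr_gt0//; lra.
have tt : 0 < t < 1 by rewrite t0 /=; lra.
have close z : closure Omega z -> `|z - ((1 - t) *: z + t *: w0)| <= t * (2 * B).
  move=> cz; have -> : z - ((1 - t) *: z + t *: w0) = t *: (z - w0).
    by rewrite scalerBl scale1r scalerBr opprD opprB addrA addrCA subrr addr0.
  rewrite normrZ gtr0_norm//; apply: (ler_wpM2l (ltW t0)).
  apply: le_trans (ler_normB _ _) _.
  by have := BP z cz; have := BP w0 (subset_closure Omega_w0); lra.
have h1 := rP _ (toward_w0 cx tt) (le_lt_trans (close x cx) (lt_le_trans tr _)).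
have h2 := r'P _ (toward_w0 cy tt) (le_lt_trans (close y cy) (lt_le_trans tr _)).
have {}h1 := h1 _; have {}h1 : `|f x - f ((1 - t) *: x + t *: w0)| <= e / 2.
  by apply: h1; rewrite ge_min lexx.
have {}h2 : `|f y - f ((1 - t) *: y + t *: w0)| <= e / 2.
  by apply: h2; rewrite ge_min lexx orbT.
have h3 := lipO _ _ (toward_w0 cx tt) (toward_w0 cy tt).
have h4 : `|(1 - t) *: x + t *: w0 - ((1 - t) *: y + t *: w0)| <= `|x - y|.
  rewrite opprD addrACA subrr addr0 -scalerBr normrZ ler_piMl//.
  by rewrite ger0_norm; lra.
have := ler_wpM2l (mulr_ge0 (ler0n R n) K0) h4.
move: h1 h2 h3; rewrite !ler_norml => /andP[? ?] /andP[? ?] /andP[? ?] ?.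
by apply/andP; split; lra.
Qed.

End Lipschitz.

(** * Global Lipschitz extensions *)

Section Extension.
Variables (R : realType) (n : nat).
Implicit Types (f : 'rV[R]_n -> R) (U : set 'rV[R]_n).
Local Notation Re := complex.Re.
Local Notation Im := complex.Im.
Local Open Scope sesquilinear_scope.
Local Open Scope complex_scope.

Definition lip_bounded (L M : R) f :=
  (forall x y, `|f x - f y| <= L * `|x - y|) /\ forall x, `|f x| <= M.

Definition clip (M a : R) : R := if a < - M then - M else if M < a then M else a.

Lemma clip_lip M a b : 0 <= M -> `|clip M a - clip M b| <= `|a - b|.
Proof.
move=> M0; wlog ab : a b / b <= a.
  move=> W; have /orP[ba|ab] := le_total b a; first exact: (W a b ba).
  by rewrite distrC [leRHS]distrC; exact: (W b a ab).
have [h1 h2] : clip M b <= clip M a /\ clip M a - clip M b <= a - b.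
  rewrite /clip; case: (ltP b (- M)) => ?; case: (ltP a (- M)) => ?;
    case: (ltP M b) => ?; case: (ltP M a) => ?; by split; lra.
by rewrite !ger0_norm ?subr_ge0.
Qed.

Lemma clip_bound M a : 0 <= M -> `|clip M a| <= M.
Proof.
move=> M0; rewrite /clip ler_norml.
by case: (ltP a (- M)) => ?; case: (ltP M a) => ?; lra.
Qed.

Lemma clip_id M a : `|a| <= M -> clip M a = a.
Proof.
rewrite ler_norml /clip => /andP[h1 h2].
by case: (ltP a (- M)) => ?; case: (ltP M a) => ?; lra.
Qed.

(* McShane's extension, truncated to keep the bound. *)
Lemma lip_extension U L M f : U !=set0 -> 0 <= L -> 0 <= M -> lip_on U L f ->
  (forall x, U x -> `|f x| <= M) ->
  exists2 F, lip_bounded L M F & forall x, U x -> F x = f x.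
Proof.
move=> [u Uu] L0 M0 fL fM.
pose E x := [set f a + L * `|x - a| | a in U].
have lbE x : lbound (E x) (- M).
  move=> _ [a Ua <-]; have := fM a Ua; rewrite ler_norml => /andP[h _].
  by have := mulr_ge0 L0 (normr_ge0 (x - a)); lra.
have E0 x : E x !=set0 by exists (f u + L * `|x - u|), u.
pose F0 x := inf (E x).
have F0le x a : U a -> F0 x <= f a + L * `|x - a|.
  by move=> Ua; apply: ge_inf; [exists (- M); exact: lbE | exists a].
have F0ge x c : (forall a, U a -> c <= f a + L * `|x - a|) -> c <= F0 x.
  by move=> H; apply: lb_le_inf (E0 x) _ => _ [a Ua <-]; exact: H.
have half x y : F0 x - L * `|x - y| <= F0 y.
  apply: F0ge => a Ua; rewrite lerBlDr -addrA -mulrDr.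
  apply: le_trans (F0le x a Ua) _; rewrite lerD2l ler_wpM2l// [leRHS]addrC.
  exact: ler_distD.
exists (fun x => clip M (F0 x)) => [|x Ux].
  split=> [x y|x]; last exact: clip_bound.
  apply: le_trans (clip_lip _ _ M0) _; rewrite ler_norml.
  by have := half x y; have := half y x; rewrite (distrC y); lra.
have -> : F0 x = f x; last by rewrite clip_id// fM.
apply/eqP; rewrite eq_le; apply/andP; split.
  by have := F0le x x Ux; rewrite subrr normr0 mulr0 addr0.
apply: F0ge => a Ua; have := fL x a Ux Ua; rewrite ler_norml; lra.
Qed.

Lemma lip_boundedN L M f : lip_bounded L M f -> lip_bounded L M (fun x => - f x).
Proof.
by move=> [fL fM]; split=> [x y|x]; rewrite -?opprD normrN.
Qed.

Lemma lip_boundedD L M L' M' f g : lip_bounded L M f -> lip_bounded L' M' g ->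
  lip_bounded (L + L') (M + M') (fun x => f x + g x).
Proof.
move=> [fL fM] [gL gM]; split=> [x y|x].
  by rewrite opprD addrACA mulrDl; apply: le_trans (ler_normD _ _) _; exact: lerD.
by apply: le_trans (ler_normD _ _) _; exact: lerD.
Qed.

Variable Omega : set 'rV[R]_n.
Hypotheses (Omega_open : open Omega) (Omega_conv : strictly_convex Omega)
  (Omega_bounded : bounded_set Omega).
Variable w0 : 'rV[R]_n.
Hypothesis Omega_w0 : Omega w0.

Lemma C1holder_extension alpha f : C1holder alpha Omega f ->
  exists F L M, [/\ 0 <= L, 0 <= M, lip_bounded L M F &
    forall x, closure Omega x -> F x = f x].
Proof.
move=> fC; have cw := subset_closure Omega_w0.
have [L L0 fL] := C1holder_lip Omega_open Omega_conv Omega_bounded Omega_w0 fC.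
have [B B0 BP] := closure_bounded Omega_bounded.
have M0 : 0 <= `|f w0| + L * (2 * B) by rewrite addr_ge0// !mulr_ge0// ltW.
have fM x : closure Omega x -> `|f x| <= `|f w0| + L * (2 * B).
  move=> cx; have := fL x w0 cx cw; have := ler_normD (f x - f w0) (f w0).
  rewrite subrK; have : L * `|x - w0| <= L * (2 * B).
    rewrite ler_wpM2l//; apply: le_trans (ler_normB _ _) _.
    by have := BP x cx; have := BP w0 cw; lra.
  lra.
have [F FL FE] := @lip_extension _ L _ f (ex_intro _ w0 cw) L0 M0 fL fM.
by exists F, L, (`|f w0| + L * (2 * B)).
Qed.

Variable N : nat.

Lemma hermitian_extension alpha (H : 'rV[R]_n -> 'M[R[i]]_N) :
  C1holder_mx alpha Omega H ->
  (forall x, closure Omega x -> H x \is hermsymmx) ->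
  exists A L M, [/\ 0 <= L, 0 <= M, regular L M A &
    forall x, closure Omega x -> A x = H x].
Proof.
move=> HC Hh.
have ext (jk : 'I_N * 'I_N) : exists FG : ('rV[R]_n -> R) * ('rV[R]_n -> R) * (R * R),
    [/\ 0 <= FG.2.1, 0 <= FG.2.2, lip_bounded FG.2.1 FG.2.2 FG.1.1,
      lip_bounded FG.2.1 FG.2.2 FG.1.2 & forall x, closure Omega x ->
      FG.1.1 x = Re (H x jk.1 jk.2) /\ FG.1.2 x = Im (H x jk.1 jk.2)].
  have [h1 h2] := HC jk.1 jk.2.
  have [F [L [M [L0 M0 [FL FM] FE]]]] := C1holder_extension h1.
  have [G [L' [M' [L0' M0' [GL GM] GE]]]] := C1holder_extension h2.
  exists ((F, G), (L + L', M + M')) => /=; split; rewrite ?addr_ge0//.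
  - split=> [x y|x]; [apply: le_trans (FL x y) _|apply: le_trans (FM x) _].
      by rewrite ler_wpM2r// lerDl.
    by rewrite lerDl.
  - split=> [x y|x]; [apply: le_trans (GL x y) _|apply: le_trans (GM x) _].
      by rewrite ler_wpM2r// lerDr.
    by rewrite lerDr.
  - by move=> x cx; rewrite FE// GE.
have [e eP] := choice ext.
pose E x : 'M[R[i]]_N := \matrix_(j, k) ((e (j, k)).1.1 x +i* (e (j, k)).1.2 x).
pose L := \sum_(j < N) \sum_(k < N) 2 * (e (j, k)).2.1.
pose M := \sum_(j < N) \sum_(k < N) 2 * (e (j, k)).2.2.
have L0 : 0 <= L.
  apply: sumr_ge0 => j _; apply: sumr_ge0 => k _.
  by have [h _ _ _ _] := eP (j, k); rewrite mulr_ge0.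
have M0 : 0 <= M.
  apply: sumr_ge0 => j _; apply: sumr_ge0 => k _.
  by have [_ h _ _ _] := eP (j, k); rewrite mulr_ge0.
have EL x y : mnorm (E x - E y) <= L * `|x - y|.
  rewrite /L mulr_suml; apply: ler_sum => j _; rewrite mulr_suml; apply: ler_sum => k _.
  have [_ _ [h1 _] [h2 _] _] := eP (j, k).
  rewrite /cnorm Re_mxB Im_mxB !mxE /=; have := h1 x y; have := h2 x y; lra.
have EM x : mnorm (E x) <= M.
  apply: ler_sum => j _; apply: ler_sum => k _.
  have [_ _ [_ h1] [_ h2] _] := eP (j, k).
  by rewrite /cnorm !mxE /=; have := h1 x; have := h2 x; lra.
have c2 : cnorm (2^-1%:C : R[i]) = 2^-1.
  by rewrite /cnorm /= normr0 addr0 ger0_norm// invr_ge0.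
(* Extending the entries independently may lose hermitian symmetry. Averaging with the adjoint
   restores it and changes nothing on the closure. *)
exists (fun x => (2^-1)%:C *: (E x + (E x) ^t* )), L, M; split=> //.
- split=> [x y|x|x].
  + rewrite -scalerBr opprD addrACA -map_mxB -linearB.
    apply: le_trans (mnorm_scale _ _) _; rewrite c2.
    have := mnorm_add (E x - E y) ((E x - E y) ^t* ); rewrite mnorm_adj.
    have := EL x y; lra.
  + apply: le_trans (mnorm_scale _ _) _; rewrite c2.
    have := mnorm_add (E x) ((E x) ^t* ); rewrite mnorm_adj.
    have := EM x; lra.
  + rewrite linearZ /= map_mxZ linearD /= map_mxD /= trmxCK addrC.
    by congr (_ *: _); apply: complexP => /=; rewrite ?oppr0.
- move=> x cx; have EH : E x = H x.
    apply/matrixP => j k; rewrite mxE; have [_ _ _ _ /(_ x cx)[-> ->]] := eP (j, k).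
    exact: complexP.
  rewrite EH; have := Hh x cx; rewrite hermsymmx_adj => /eqP ->.
  have -> : H x + H x = (1 + 1) *: H x by rewrite scalerDl scale1r.
  rewrite scalerA -[RHS]scale1r; congr (_ *: _).
  by apply: complexP => /=; field.
Qed.

Lemma regular_comb L M L' M' l m (A G : 'rV[R]_n -> 'M[R[i]]_N) f :
  0 <= L -> 0 <= M -> 0 <= L' -> 0 <= M' -> 0 <= l -> 0 <= m ->
  regular L M A -> regular L' M' G -> lip_bounded l m f ->
  regular (L + (l * M' + m * L')) (M + m * M') (fun x => A x + (f x)%:C *: G x).
Proof.
move=> L0 M0 L0' M0' l0 m0 [AL AM Ah] [GL GM Gh] [fL fm].
have cR (c : R) : cnorm c%:C = `|c| by rewrite /cnorm /= normr0 addr0.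
split=> [x y|x|x].
- have -> : A x + (f x)%:C *: G x - (A y + (f y)%:C *: G y) =
      (A x - A y) + ((f x - f y)%:C *: G x + (f y)%:C *: (G x - G y)).
    by rewrite rmorphB /= scalerBl scalerBr [X in _ = _ + X]addrA subrK opprD addrACA.
  apply: le_trans (mnorm_add _ _) _; rewrite mulrDl; apply: lerD => //.
  apply: le_trans (mnorm_add _ _) _; rewrite mulrDl; apply: lerD.
    apply: le_trans (mnorm_scale _ _) _; rewrite cR mulrAC.
    by apply: ler_pM; rewrite ?mnorm_ge0.
  apply: le_trans (mnorm_scale _ _) _; rewrite cR -mulrA.
  by apply: ler_pM; rewrite ?mnorm_ge0.
- apply: le_trans (mnorm_add _ _) _; apply: lerD => //.
  apply: le_trans (mnorm_scale _ _) _; rewrite cR.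
  by apply: ler_pM; rewrite ?mnorm_ge0.
- rewrite linearD /= map_mxD /= Ah linearZ /= map_mxZ Gh; congr (_ + _ *: _).
  by apply: complexP => /=; rewrite ?oppr0.
Qed.

(** The last parameter in the closure is attained because the closure is closed; an interior point
    there would allow going further. *)
Lemma exit_point (x y : 'rV[R]_n) : closure Omega x -> ~ closure Omega y ->
  exists2 t, 0 <= t <= 1 &
    closure Omega (x + t *: (y - x)) /\ ~ Omega (x + t *: (y - x)).
Proof.
move=> cx ncy; pose z t := x + t *: (y - x).
pose S := [set t : R | 0 <= t <= 1 /\ closure Omega (z t)].
have S0 : S 0 by split; rewrite ?lexx ?ler01// /z scale0r addr0.
have hS : has_sup S by split; [exists 0 | exists 1 => t [/andP[]]].
have z_dist s t : `|z s - z t| = `|s - t| * `|y - x|.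
  by rewrite /z opprD addrACA subrr add0r -scalerBl normrZ.
set s := sup S.
have s0 : 0 <= s by apply: ub_le_sup => //; case: hS.
have s1 : s <= 1 by apply: ge_sup; [exists 0 | move=> t [/andP[]]].
have yx0 : 0 < `|y - x| + 1 by rewrite ltr_wpDl.
have czs : closure Omega (z s).
  suff : closure (closure Omega) (z s).
    by rewrite -((closure_id _).1 (@closed_closure _ Omega)).
  move=> B /nbhs_ballP[e /= e0 eB].
  have [t [t01 ct] ts] := sup_adherent (divr_gt0 e0 yx0) hS.
  have tsup : t <= s by apply: ub_le_sup; [case: hS | split].
  exists (z t); split=> //; apply: eB; rewrite -ball_normE /= z_dist.
  apply: (@le_lt_trans _ _ ((s - t) * (`|y - x| + 1))).
    by rewrite ger0_norm ?subr_ge0// ler_wpM2l ?subr_ge0// lerDl.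
  by rewrite -ltr_pdivlMr//; rewrite -/s in ts; lra.
exists s; first by rewrite s0.
split=> // Ozs.
have slt1 : s < 1.
  rewrite lt_neqAle s1 andbT; apply/eqP => s_1; apply: ncy.
  by move: czs; rewrite /z s_1 scale1r addrC subrK.
have /nbhs_ballP[e /= e0 eO] := open_nbhs_nbhs (conj Omega_open Ozs).
pose t := Num.min 1 (s + e / (`|y - x| + 1) / 2).
have e'0 : 0 < e / (`|y - x| + 1) by rewrite divr_gt0.
have st : s < t by rewrite /t lt_min slt1; lra.
have ts : t <= s + e / (`|y - x| + 1) / 2 by rewrite /t ge_min lexx orbT.
have : t <= s.
  apply: ub_le_sup; first by case: hS.
  split; first by rewrite /t ge_min lexx (le_trans s0 (ltW st)).
  apply/subset_closure/eO; rewrite -ball_normE /= z_dist distrC gtr0_norm ?subr_gt0//.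
  apply: (@le_lt_trans _ _ ((t - s) * (`|y - x| + 1))).
    by rewrite ler_wpM2l ?subr_ge0 ?(ltW st)// lerDl.
  by rewrite -ltr_pdivlMr//; lra.
by rewrite leNgt st.
Qed.

(** A segment leaving the closure passes a zero of [f] at its exit point, so the Lipschitz constant
    is kept. *)
Lemma zero_extension L M f : 0 <= L -> 0 <= M -> lip_bounded L M f ->
  (forall x, closure Omega x -> ~ Omega x -> f x = 0) ->
  lip_bounded L M (fun x => if pselect (closure Omega x) then f x else 0).
Proof.
move=> L0 M0 [fL fM] f0.
have out x y : closure Omega x -> ~ closure Omega y -> `|f x| <= L * `|x - y|.
  move=> cx ncy; have [t /andP[t0 t1] [cz nz]] := exit_point cx ncy.
  rewrite -[f x]subr0 -(f0 _ cz nz); apply: le_trans (fL _ _) _.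
  rewrite ler_wpM2l// opprD addrA subrr add0r normrN normrZ distrC ger0_norm//.
  by rewrite ler_piMl// distrC.
split=> [x y|x]; last by case: pselect => [?|?] /=; [exact: fM | rewrite normr0].
case: pselect => [cx|ncx]; case: pselect => [cy|ncy] /=.
- exact: fL.
- by rewrite subr0; exact: out.
- by rewrite sub0r normrN distrC; exact: out.
- by rewrite subrr normr0 mulr_ge0.
Qed.

End Extension.

(** * Chords and the boundary values *)

Section TraceFunctional.
Variables (R : realType) (N : nat).

Lemma trace_delta_mul (A : 'M[R[i]]_N) j k : \tr (delta_mx k j *m A) = A j k.
Proof.
rewrite /mxtrace (bigD1 k)//= big1 ?addr0 => [|l lk].
  by rewrite mxE (bigD1 j)//= big1 ?addr0 => [|m mj]; rewrite mxE ?eqxx ?mul1r// (negPf mj) andbF mul0r.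
by rewrite mxE big1// => m _; rewrite mxE (negPf lk) mul0r.
Qed.

Lemma trace_delta j k : \tr (delta_mx k j : 'M[R[i]]_N) = (j == k)%:R.
Proof. by have := trace_delta_mul 1%:M j k; rewrite mulmx1 mxE => ->. Qed.

(** A matrix that is not scalar has a nonzero off-diagonal entry or two distinct diagonal entries; a
    multiple of the matching elementary matrix, or of a difference of two diagonal ones, is [P]. *)
Lemma trace_functional (G : 'M[R[i]]_N) : ~~ is_scalar_mx G ->
  exists P : 'M[R[i]]_N, \tr P = 0 /\ \tr (P *m G) = 1.
Proof.
move=> nG; have [[j [k [jk Gjk]]]|off] :=
    pselect (exists j k, j != k /\ G j k != 0).
  exists ((G j k)^-1 *: delta_mx k j).
  by rewrite -scalemxAl !linearZ /= trace_delta trace_delta_mul (negPf jk) mulr0 mulVf.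
have [[j [k Gjk]]|diag] := pselect (exists j k, G j j != G k k).
  exists ((G j j - G k k)^-1 *: (delta_mx j j - delta_mx k k)).
  rewrite -scalemxAl mulmxBl !linearZ /= !linearB /= !trace_delta !trace_delta_mul.
  by rewrite !eqxx subrr mulr0 mulVf// subr_eq0.
case/negP: nG; apply/is_scalar_mxP; case: N G off diag => [|n] G off diag.
  by exists 0; apply/matrixP => -[].
exists (G 0 0); apply/matrixP => j k; rewrite mxE.
have [<-|jk] := eqVneq j k; rewrite ?mulr1n ?mulr0n.
  by apply/eqP/negPn/negP => h; apply: diag; exists j, 0.
by apply/eqP/negPn/negP => h; apply: off; exists j, k.
Qed.

End TraceFunctional.

(** * Chords of a strictly convex domain *)

Section Geometry.
Variables (R : realType) (n : nat).
Implicit Types (v d : 'rV[R]_n).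

Lemma sup_le_enorm v : `|v| <= enorm v.
Proof.
apply: coord_le_norm (enorm_ge0 v) _ => i.
rewrite -(ger0_norm (enorm_ge0 v)) -ler_sqr ?nnegrE// !real_normK ?num_real//.
rewrite enorm_sqr (bigD1 i)//= lerDl sumr_ge0// => j _; exact: sqr_ge0.
Qed.

Lemma enorm0 : enorm (0 : 'rV[R]_n) = 0.
Proof. by have := enormZ 0 (0 : 'rV[R]_n); rewrite scale0r normr0 mul0r. Qed.

Lemma enorm_gt0 v i : v 0 i != 0 -> 0 < enorm v.
Proof.
move=> vi; apply: lt_le_trans (sup_le_enorm v).
by apply: lt_le_trans (entry_le_norm v i); rewrite normr_gt0.
Qed.

Lemma lip_within_continuous (f : 'rV[R]_n -> R) L U :
  (forall x y, `|f x - f y| <= L * `|x - y|) -> {within U, continuous f}.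
Proof.
move=> fL; apply: continuous_subspaceT => x.
apply/(@cvgrPdist_le _ _ _ _ (nbhs_filter x)) => e e0.
apply/nbhs_ballP; exists (e / (`|L| + 1)) => /=.
  by rewrite divr_gt0// ltr_wpDl.
move=> y; rewrite -ball_normE /= => xy; apply: le_trans (fL x y) _.
apply: (@le_trans _ _ ((`|L| + 1) * `|x - y|)).
  by rewrite ler_wpM2r//; have := ler_norm L; lra.
by rewrite mulrC -ler_pdivlMr ?ltW// ltr_wpDl.
Qed.

Variable Omega : set 'rV[R]_n.
Hypotheses (Omega_open : open Omega) (Omega_conv : strictly_convex Omega)
  (Omega_bounded : bounded_set Omega).

Lemma boundaryP x : boundary Omega x <-> closure Omega x /\ ~ Omega x.
Proof. by rewrite /boundary /setD /= (interior_id _).1. Qed.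

Lemma ray_exit z d : Omega z -> 0 < enorm d ->
  exists2 b, 0 < b & [/\ forall t, 0 <= t <= b -> closure Omega (z + t *: d),
    boundary Omega (z + b *: d) &
    forall t, 0 <= t -> closure Omega (z + t *: d) -> t <= b].
Proof.
move=> Oz d0; have cz := subset_closure Oz.
have [b b0 [cb nb]] : exists2 b, 0 <= b &
    closure Omega (z + b *: d) /\ ~ Omega (z + b *: d).
  have [B B0 BP] := closure_bounded Omega_bounded.
  have T0 : 0 <= (2 * B * n%:R + 1) / enorm d.
    by apply: divr_ge0 (ltW d0); apply: addr_ge0 => //; rewrite !mulr_ge0 ?(ltW B0).
  have TE : enorm (((2 * B * n%:R + 1) / enorm d) *: d) = 2 * B * n%:R + 1.
    by rewrite enormZ ger0_norm// divfK ?gt_eqF.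
  move: {T0 TE}((2 * B * n%:R + 1) / enorm d) T0 TE => T T0 TE.
  have far : ~ closure Omega (z + T *: d).
    move=> cT; have h2 : `|T *: d| <= 2 * B.
      have -> : T *: d = (z + T *: d) - z by rewrite addrC addKr.
      by apply: le_trans (ler_normB _ _) _; have := BP _ cT; have := BP _ cz; lra.
    have h1 := enorm_le_sup (T *: d); rewrite TE in h1.
    by have := ler_wpM2l (ler0n R n) h2; lra.
  have [s /andP[s0 s1]] := exit_point Omega_open cz far.
  rewrite addrAC subrr add0r scalerA => cn.
  by exists (s * T); first exact: mulr_ge0.
have neq t t' : 0 <= t -> t < t' -> z + t *: d != z + t' *: d.
  move=> t0 tt; apply/negP => /eqP/addrI/eqP.
  rewrite -subr_eq0 -scalerBl scaler_eq0 subr_eq0 => /orP[/eqP e|/eqP e].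
    by rewrite e ltxx in tt.
  by rewrite e enorm0 ltxx in d0.
have inside t t' : 0 < t -> t < t' -> closure Omega (z + t' *: d) ->
    Omega (z + t *: d).
  move=> t0 tt ct'; have t'0 : 0 < t' by exact: lt_trans tt.
  have zt : z != z + t' *: d by have := neq 0 t' (lexx 0) t'0; rewrite scale0r addr0.
  have q01 : 0 < t / t' < 1.
    by apply/andP; split; [exact: divr_gt0 | rewrite ltr_pdivrMr// mul1r].
  have := Omega_conv cz ct' zt q01; congr Omega.
  by rewrite scalerDr scalerA divfK ?gt_eqF// addrA -scalerDl subrK scale1r.
exists b.
  move: b0 nb; rewrite le_eqVlt => /orP[/eqP <-|//].
  by rewrite scale0r addr0.
split; [|exact/boundaryP|].
- move=> t /andP[t0]; rewrite le_eqVlt => /orP[/eqP->//|tb].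
  move: t0; rewrite le_eqVlt => /orP[/eqP<-|t0]; first by rewrite scale0r addr0.
  exact/subset_closure/(inside t b).
- move=> t t0 ct; rewrite leNgt; apply/negP => bt; apply: nb.
  move: b0; rewrite le_eqVlt => /orP[/eqP<-|b0]; first by rewrite scale0r addr0.
  exact: (inside b t).
Qed.

Lemma chord_exists x d t0 : Omega (x + t0 *: d) -> 0 < enorm d ->
  exists a b, [/\ a < t0 < b, forall t, a <= t <= b -> closure Omega (x + t *: d),
    boundary Omega (x + a *: d), boundary Omega (x + b *: d) &
    forall t, closure Omega (x + t *: d) -> a <= t <= b].
Proof.
move=> Oz d0; have [b b0 [b1 b2 b3]] := ray_exit Oz d0.
have d0' : 0 < enorm (- d) by rewrite enormN.
have [a a0 [a1 a2 a3]] := ray_exit Oz d0'.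
have E t : x + t0 *: d + t *: d = x + (t0 + t) *: d by rewrite -addrA -scalerDl.
have E' t : x + t0 *: d + t *: - d = x + (t0 - t) *: d.
  by rewrite -addrA scalerN -scalerBl.
exists (t0 - a), (t0 + b); split.
- by apply/andP; split; lra.
- move=> t tab; have [tt|tt] := leP t0 t.
    by have := b1 (t - t0); rewrite E [t0 + _]addrC subrK; apply; lra.
  by have := a1 (t0 - t); rewrite E' subKr; apply; lra.
- by rewrite -(E' a); exact: a2.
- by rewrite -(E b); exact: b2.
- move=> t ct; have [tt|tt] := leP t0 t.
    have := b3 (t - t0); rewrite E [t0 + _]addrC subrK => h.
    by have := h _ ct; rewrite subr_ge0 => /(_ tt); lra.
  have := a3 (t0 - t); rewrite E' subKr => h.
  by have := h _ ct; rewrite subr_ge0 => /(_ (ltW tt)); lra.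
Qed.

End Geometry.

(** * Consequences of the data on lines, and vanishing on the boundary *)

Section Determination.
Variables (R : realType) (n N : nat).
Implicit Types (x d v : 'rV[R]_n) (A G : 'rV[R]_n -> 'M[R[i]]_N).
Local Notation Re := complex.Re.
Local Notation u := (2 * (N * N)%:R : R).
Local Open Scope sesquilinear_scope.
Local Open Scope complex_scope.

Variable Omega : set 'rV[R]_n.
Hypotheses (Omega_open : open Omega) (Omega_conv : strictly_convex Omega)
  (Omega_bounded : bounded_set Omega).
Variables (I F : set 'cV[R[i]]_N) (H H' : 'rV[R]_n -> 'M[R[i]]_N).
Hypothesis IF : ideal_data I F.
Hypothesis data : forall (a b : 'cV[R[i]]_N) (T : R) (gamma : R -> 'rV[R]_n),
  F a -> I b -> line_through Omega T gamma ->
  amplitude a (time_evolution H T gamma T 0) b =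
  amplitude a (time_evolution H' T gamma T 0) b.
Variables (A A' G : 'rV[R]_n -> 'M[R[i]]_N) (hh : 'rV[R]_n -> R) (L M l m : R).
Hypotheses (L0 : 0 <= L) (M0 : 0 <= M).
Hypotheses (rA : regular L M A) (rA' : regular L M A') (rG : regular L M G).
Hypotheses (AH : forall y, closure Omega y -> A y = H y)
  (AH' : forall y, closure Omega y -> A' y = H' y)
  (AA' : forall y, A y - A' y = (hh y)%:C *: G y).
Hypothesis hh_lip : lip_bounded l m hh.

(** Where [hh] vanishes the two generators coincide, and the derivative of [Y^* X] cancels. *)
Lemma conj_const x d X Y (s t : R) : line_ode A x d X -> line_ode A' x d Y ->
  s <= t -> (forall r, s < r < t -> hh (x + r *: d) = 0) ->
  (Y t) ^t* *m X t = (Y s) ^t* *m X s.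
Proof.
move=> [dX _] [dY _] st h0; have [_ _ Ah'] := rA'.
have dD r : mder (fun q => (Y q) ^t* *m X q) r _ :=
  mderM (mder_adj (dY r)) (dX r).
apply: (mder0_const st _ (mder_mcont _ dD)) => r rst.
apply: mder_eq (dD r) _.
have -> : A' (x + r *: d) = A (x + r *: d).
  by apply/esym/eqP; rewrite -subr_eq0 AA' h0// scale0r.
rewrite adj_mul (skew_of_hermitian _ _); first by rewrite mulmxN mulNmx mulmxA addNr.
by case: rA.
Qed.

(** The data concern the chord [a, b], the charts the interval [-1, 1]. Between -1 and a, and
    between b and 1, [hh] vanishes by one of the two support conditions, so [Y^* X] does not change
    there. A line missing the domain gives the identity. *)
Lemma line_identity x d X Y : 0 < enorm d ->
  (forall y, ~ Omega y -> hh y = 0) ->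
  (forall t : R, 1 < `|t| -> hh (x + t *: d) = 0) ->
  line_ode A x d X -> line_ode A' x d Y -> X (-1) = 1%:M -> Y (-1) = 1%:M ->
  exists z : R[i], (Y 1) ^t* *m X 1 = z%:M.
Proof.
move=> d0 hO h1 oX oY Xa Ya.
have D1 : (Y (-1)) ^t* *m X (-1) = 1%:M by rewrite Xa Ya trmx1 map_mx1 mulmx1.
have [[t0 Ot]|nO] := pselect (exists t, Omega (x + t *: d)); last first.
  exists 1; rewrite -D1; apply: (conj_const oX oY); first by lra.
  by move=> r _; apply: hO => Or; apply: nO; exists r.
have [a [b [/andP[at0 t0b] cl ba bb out]]] :=
  chord_exists Omega_open Omega_conv Omega_bounded Ot d0.
have [_ _ Ah] := rA; have [_ _ Ah'] := rA'.
have ab : a < b by exact: lt_trans t0b.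
have [z zE] := chord_scalar IF data AH AH' Ah Ah' d0 ab cl ba bb oX oY.
have hout r : ~ (a <= r <= b) -> hh (x + r *: d) = 0.
  by move=> nr; apply: hO => Or; apply/nr/out/subset_closure.
have Da : (Y a) ^t* *m X a = 1%:M.
  rewrite -D1; have [h|h] := leP a (-1).
    apply/esym/(conj_const oX oY h) => r /andP[_ r1]; apply: h1.
    by rewrite ltr0_norm; lra.
  apply: (conj_const oX oY (ltW h)) => r /andP[_ ra]; apply: hout.
  by move=> /andP[ar _]; lra.
have Db : (Y 1) ^t* *m X 1 = (Y b) ^t* *m X b.
  have [h|h] := leP b 1.
    apply: (conj_const oX oY h) => r /andP[br _]; apply: hout.
    by move=> /andP[_ rb]; lra.
  apply/esym/(conj_const oX oY (ltW h)) => r /andP[r1 _]; apply: h1.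
  by rewrite gtr0_norm; lra.
by exists z; rewrite Db zE Da scalemx1.
Qed.

(** Both propagators start from the identity at [a], and the length covered up to [t] is at most
    [r]. *)
Lemma weight_near1 (P : 'M[R[i]]_N) (p : 'rV[R]_n) x d X Y (a t r : R) :
  a <= t -> 0 <= r ->
  \tr (P *m G p) = 1 -> line_ode A x d X -> line_ode A' x d Y ->
  X a = 1%:M -> Y a = 1%:M -> enorm d * (t - a) <= r ->
  `|x + t *: d - p| <= r ->
  `|Re (\tr (P *m ((Y t) ^t* *m G (x + t *: d) *m X t))) - 1| <=
    mnorm P * (2 * u * M * (u ^+ 4 * M) + u ^+ 2 * L) * r.
Proof.
move=> at_ r0 PG [dX uX] [dY uY] Xa Ya dr pr.
have [_ AM _] := rA; have [_ AM' _] := rA'; have [GL GM _] := rG.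
have near1 (B : 'rV[R]_n -> 'M[R[i]]_N) (V : R -> 'M[R[i]]_N) :
    (forall y, mnorm (B y) <= M) ->
    (forall s, mder V s ((- ('i * (enorm d)%:C) *: B (x + s *: d)) *m V s)) ->
    (forall s, V s \is unitarymx) -> V a = 1%:M ->
    mnorm (V t - 1%:M) <= u ^+ 4 * M * r.
  move=> BM dV uV Va.
  have := @propagator_near1 _ _ _ _ _ _ (enorm d * M) at_ dV uV Va.
  move=> /(_ _)/le_trans; apply.
    move=> s _; apply: le_trans (mnorm_scale _ _) _.
    rewrite cnorm_i_real ger0_norm ?enorm_ge0//.
    by apply: ler_wpM2l; [exact: enorm_ge0 | exact: BM].
  have -> : u ^+ 4 * (enorm d * M) * (t - a) = u ^+ 4 * M * (enorm d * (t - a)) by ring.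
  by rewrite ler_wpM2l// mulr_ge0// exprn_ge0// mulr_ge0.
have un1 : (1%:M : 'M[R[i]]_N) \is unitarymx.
  by apply/unitarymxP; rewrite trmx1 map_mx1 mulmx1.
have Q := mnorm_conj_diff (uX t) (uY t) un1 un1 (GM (x + t *: d))
  (near1 A X AM dX uX Xa) (near1 A' Y AM' dY uY Ya)
  (le_trans (GL (x + t *: d) p) (ler_wpM2l L0 pr)).
have E1 : Re (\tr (P *m (1%:M ^t* *m G p *m 1%:M))) = 1.
  by rewrite trmx1 map_mx1 mul1mx mulmx1 PG.
rewrite -[X in `|_ - X|]E1 -Re_opp -Re_add -linearB /= -mulmxBr.
apply: le_trans (Re_trace_le _ _) _; rewrite -[leRHS]mulrA ler_wpM2l ?mnorm_ge0//.
apply: le_trans Q _; rewrite le_eqVlt; apply/orP; left; apply/eqP; ring.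
Qed.

Variable w0 : 'rV[R]_n.
Hypothesis Omega_w0 : Omega w0.
Hypothesis n2 : (2 <= n)%N.

Lemma orthogonal_direction v : exists2 d, 0 < enorm d & dot d v = 0.
Proof.
case: n n2 v => [//|[//|k]] _ v.
have [v0|v0] := eqVneq (v 0 0) 0.
  exists (delta_mx 0 0); first by apply: (@enorm_gt0 _ _ _ 0); rewrite mxE !eqxx oner_neq0.
  rewrite /dot (bigD1 0)//= v0 mulr0 add0r big1// => i i0.
  by rewrite mxE (negPf i0) andbF mul0r.
pose d : 'rV[R]_k.+2 := v 0 1 *: delta_mx 0 0 - v 0 0 *: delta_mx 0 1.
have d0 : d 0 0 = v 0 1 by rewrite !mxE /= mulr1 mulr0 subr0.
have d1 : d 0 1 = - v 0 0 by rewrite !mxE /= mulr1 mulr0 sub0r.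
exists d; first by apply: (@enorm_gt0 _ _ _ 1); rewrite d1 oppr_eq0.
rewrite /dot (bigD1 0)//= (bigD1 1)//= big1 => [|i /andP[i0 i1]].
  by rewrite d0 d1; ring.
by rewrite !mxE (negPf i0) (negPf i1) !andbF !mulr0 subr0 mul0r.
Qed.

Lemma dotDl v w (z : 'rV[R]_n) : dot (v + w) z = dot v z + dot w z.
Proof. by rewrite /dot -big_split; apply: eq_bigr => i _; rewrite mxE mulrDl. Qed.

Lemma dotZl (c : R) v (z : 'rV[R]_n) : dot (c *: v) z = c * dot v z.
Proof. by rewrite /dot mulr_sumr; apply: eq_bigr => i _; rewrite mxE mulrA. Qed.

Lemma dot_continuous (q v : 'rV[R]_n) U : {within U, continuous (fun x => dot (x - q) v)}.
Proof.
apply: (@lip_within_continuous _ _ _ (n%:R * enorm v)) => x y.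
have -> : dot (x - q) v - dot (y - q) v = dot (x - y) v.
  rewrite -[- dot (y - q) v]mulN1r -dotZl -dotDl; congr (dot _ v).
  by rewrite scaleN1r opprB addrA subrK.
have : `|dot (x - y) v| <= enorm (x - y) * enorm v.
  rewrite -[leRHS]ger0_norm ?mulr_ge0 ?enorm_ge0// -ler_sqr ?nnegrE//.
  by rewrite !real_normK ?num_real// dot_sqr_le.
move=> /le_trans; apply; rewrite mulrAC ler_wpM2r ?enorm_ge0//.
exact: enorm_le_sup.
Qed.

(* Chords orthogonal to the normal [v] and close to [q] are short, so the weight
   along them is close to 1, and Rolle's theorem gives a zero of [hh] nearby. *)
Lemma exposed_zero (q v : 'rV[R]_n) : closure Omega q ->
  ~~ is_scalar_mx (G q) ->
  (forall x, closure Omega x -> x != q -> dot (x - q) v < 0) -> hh q = 0.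
Proof.
move=> cq nG sup; apply/eqP/negPn/negP => hq.
have [P [trP PG]] := trace_functional nG.
have [hL _] := hh_lip.
pose K := mnorm P * (2 * u * M * (u ^+ 4 * M) + u ^+ 2 * L).
have K0 : 0 <= K.
  by rewrite /K mulr_ge0 ?mnorm_ge0// addr_ge0 ?mulr_ge0 ?exprn_ge0.
(* The first bound keeps [hh] nonzero within r of q. The second keeps the weight within less than 1
   of 1, as (2 n + 1) r dominates both the length travelled and the distance to q. *)
pose r := Num.min (`|hh q| / (2 * (`|l| + 1))) (1 / (2 * (2 * n%:R + 1) * (K + 1))).
have l1 : 0 < `|l| + 1 by rewrite ltr_wpDl.
have K1 : 0 < K + 1 by rewrite ltr_wpDl.
have n1 : 0 < 2 * n%:R + 1 :> R by rewrite ltr_wpDl.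
have r0 : 0 < r.
  by rewrite /r lt_min; apply/andP; split; rewrite divr_gt0 ?mulr_gt0 ?normr_gt0.
have hx0 x : `|x - q| <= r -> hh x != 0.
  move=> xr; apply: contraTneq (hL x q) => ->; rewrite sub0r normrN -ltNge.
  have : r <= `|hh q| / (2 * (`|l| + 1)) by rewrite /r ge_min lexx.
  rewrite ler_pdivlMr ?mulr_gt0// => h2.
  have h3 : l * `|x - q| <= (`|l| + 1) * r.
    apply: (@le_trans _ _ (`|l| * r)); last by rewrite ler_wpM2r ?(ltW r0)// lerDl.
    apply: (@le_trans _ _ (`|l| * `|x - q|)); first by rewrite ler_wpM2r// ler_norm.
    by rewrite ler_wpM2l.
  have hq0 : 0 < `|hh q| by rewrite normr_gt0.
  by have := mulr_gt0 l1 r0; nra.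
have rK : K * ((2 * n%:R + 1) * r) < 1.
  have : r <= 1 / (2 * (2 * n%:R + 1) * (K + 1)) by rewrite /r ge_min lexx orbT.
  rewrite ler_pdivlMr ?mulr_gt0// => h2.
  have h3 : 0 < (2 * n%:R + 1) * r by rewrite mulr_gt0.
  by have := mulr_ge0 K0 (ltW h3); nra.
clearbody r.
(* By compactness, a thin cap cut off at the exposed point lies in the ball of radius r. *)
have [c c0 cP] : exists2 c, 0 < c & forall x, closure Omega x ->
    - c < dot (x - q) v -> `|x - q| < r.
  pose S := closure Omega `&` [set x | r <= `|x - q|].
  have [S0|S0] := pselect (S !=set0); last first.
    exists 1 => // x cx _; rewrite ltNge; apply/negP => h; apply: S0.
    by exists x.
  have cS : compact S.
    apply: (subclosed_compact _ (closure_compact Omega_bounded)); last by move=> x [].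
    apply: closedI; first exact: closed_closure.
    have -> : [set x | r <= `|x - q|] = (fun x => `|x - q|) @^-1` [set t | r <= t] by [].
    apply: (@closed_comp _ _ (fun x : 'rV[R]_n => `|x - q|)); last exact: closed_ge.
    move=> x _; have : continuous (fun x : 'rV[R]_n => `|x - q|).
      apply/continuous_subspace_setT; apply: (@lip_within_continuous _ _ _ 1) => y z.
      rewrite mul1r; apply: le_trans (ler_dist_dist _ _) _.
      by rewrite opprB addrA subrK.
    exact.
  have [y yS ymax] := compact_EVT_max S0 cS (@dot_continuous q v S).
  move: yS; rewrite inE => -[cy /= ry].
  have yq : y != q.
    by apply: contraTneq ry => ->; rewrite subrr normr0 -ltNge.
  exists (- dot (y - q) v); first by rewrite oppr_gt0 sup.
  move=> x cx; rewrite opprK => h; rewrite ltNge; apply/negP => rx.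
  have := ymax x; rewrite inE => /(_ (conj cx rx)); lra.
pose D := `|dot (w0 - q) v| + 1.
have D0 : 0 < D by rewrite ltr_wpDl.
pose t := Num.min (1 / 2) (c / D / 2).
have t0 : 0 < t by rewrite /t lt_min; apply/andP; split; rewrite !divr_gt0.
have t1 : t <= 1 / 2 by rewrite /t ge_min lexx.
have tc : t * D < c.
  have : t <= c / D / 2 by rewrite /t ge_min lexx orbT.
  have cD : 0 < c / D by rewrite divr_gt0.
  have cE : c / D * D = c by rewrite divfK ?gt_eqF.
  by move=> h; have := ler_wpM2r (ltW D0) h; rewrite mulrAC cE; lra.
clearbody t.
pose z := (1 - t) *: q + t *: w0.
have Oz : Omega z by apply: toward_w0 => //; rewrite t0 /=; lra.
have zq : z - q = t *: (w0 - q).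
  by rewrite /z scalerBl scale1r scalerBr addrC addrA addrA addNr add0r addrC.
clearbody z.
have [d d0 dv] := orthogonal_direction v.
have z0 : Omega (z + 0 *: d) by rewrite scale0r addr0.
have [a [b [/andP[a0 b0] cl ba bb _]]] :=
  chord_exists Omega_open Omega_conv Omega_bounded z0 d0.
have ab : a < b by exact: lt_trans b0.
have close s : a <= s <= b -> `|z + s *: d - q| < r.
  move=> sab; apply: cP; first exact: cl.
  rewrite addrAC dotDl dotZl dv mulr0 addr0 zq dotZl.
  have := ler_norm (- dot (w0 - q) v); rewrite normrN => h.
  have := ler_wpM2l (ltW t0) h; rewrite /D in tc; nra.
have [X [oX Xa]] := line_ode_exists z d a rA.
have [Y [oY Ya]] := line_ode_exists z d a rA'.
have [_ _ Ah] := rA; have [_ _ Ah'] := rA'.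
have [zz zE] := chord_scalar IF data AH AH' Ah Ah' d0 ab cl ba bb oX oY.
have wd := weight_derivative P AA' Ah' d0 oX oY.
set g := (fun t : R => _) in wd.
have gab : g a = g b.
  rewrite /g zE Xa Ya trmx1 map_mx1 mulmx1 -!scalemxAr !mulmx1 !linearZ /= trP.
  by rewrite !mulr0.
have gc : {within `[a, b], continuous g}.
  by apply: continuous_subspaceT => s; exact: is_derive_continuous (wd s).
(* The derivative of [g] is [hh] times the weight. As [hh] is nonzero on this chord, the weight
   would have to vanish, against its closeness to 1. *)
have [s /[!in_itv]/= /andP[as_ sb] gs] := Rolle ab (fun s _ => @ex_derive _ _ _ _ _ _ _ (wd s)) gc gab.
have : hh (z + s *: d) * Re (\tr (P *m ((Y s) ^t* *m G (z + s *: d) *m X s))) = 0.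
  have := @derive_val _ _ _ _ _ _ _ (wd s).
  by rewrite (@derive_val _ _ _ _ _ _ _ gs) => <-.
have s_r : `|z + s *: d - q| < r by apply: close; rewrite !ltW.
have a_r : `|z + a *: d - q| < r by apply: close; rewrite lexx ltW.
move/eqP; rewrite mulf_eq0 (negPf (hx0 _ (ltW s_r))) /= => /eqP w0'.
have rr : 0 <= (2 * n%:R + 1) * r := mulr_ge0 (ltW n1) (ltW r0).
have sa0 : 0 <= s - a by rewrite subr_ge0; exact: (ltW as_).
have len : enorm d * (s - a) <= (2 * n%:R + 1) * r.
  have -> : enorm d * (s - a) = enorm ((s - a) *: d).
    by rewrite enormZ (ger0_norm sa0) mulrC.
  apply: le_trans (enorm_le_sup _) _.
  have : `|(s - a) *: d| <= 2 * r.
    have -> : (s - a) *: d = (z + s *: d - q) - (z + a *: d - q).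
      by rewrite opprB addrA subrK opprD addrACA subrr add0r scalerBl.
    apply: le_trans (ler_normB _ _) _.
    have -> : 2 * r = r + r by ring.
    exact: lerD (ltW s_r) (ltW a_r).
  move=> h; apply: le_trans (ler_wpM2l (ler0n R n) h) _.
  rewrite mulrA (mulrC n%:R); apply: (ler_wpM2r (ltW r0)).
  by rewrite lerDl; exact: ler01.
have pr : `|z + s *: d - q| <= (2 * n%:R + 1) * r.
  apply: le_trans (ltW s_r) (ler_peMl (ltW r0) _).
  by rewrite lerDr; exact: mulr_ge0 (ler0n _ 2) (ler0n _ n).
have := weight_near1 (ltW as_) rr PG oX oY Xa Ya len pr.
rewrite w0' sub0r normrN normr1 => h; move: rK.
by rewrite ltNge h.
Qed.

(** Exposed points approximate every boundary point: take an exterior point near [q] and project it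
    to the closure. The Lipschitz bound carries the zero there over to [q]. *)
Lemma boundary_zero : (forall x, closure Omega x -> ~~ is_scalar_mx (G x)) ->
  forall q, closure Omega q -> ~ Omega q -> hh q = 0.
Proof.
move=> nG q cq nq; have [hL _] := hh_lip.
apply/eqP; rewrite -normr_le0; apply/ler_addgt0Pr => e e0; rewrite add0r.
pose c := (`|l| + 1) * (n%:R + 1).
have c0 : 0 < c by rewrite mulr_gt0// ltr_wpDl.
pose r := e / c; have r0 : 0 < r by rewrite divr_gt0.
have cr : c * r = e by rewrite /r mulrC divfK// gt_eqF.
clearbody r.
(* Otherwise a ball around [q] lies in the closure, [q] is the midpoint of two of its points, and
   strict convexity makes it interior. *)
have [y [ncy qy]] : exists y, ~ closure Omega y /\ `|y - q| < r.
  apply/not_existsP => all_cl; apply: nq.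
  have i0 : 'I_n by exact: Ordinal n2.
  pose v : 'rV[R]_n := (r / 2) *: delta_mx 0 i0.
  have vr : `|v| < r.
    rewrite normrZ gtr0_norm ?divr_gt0//.
    have : `|delta_mx 0 i0 : 'rV[R]_n| <= 1.
      apply: coord_le_norm => // i; rewrite mxE eqxx /=.
      by case: (i == i0); rewrite ?normr1 ?normr0.
    nra.
  have cl y : `|y - q| < r -> closure Omega y.
    by move=> yr; apply: contrapT => ny; apply: (all_cl y).
  have h1 : closure Omega (q + v) by apply: cl; rewrite addrC addKr.
  have h2 : closure Omega (q - v) by apply: cl; rewrite addrC addKr normrN.
  have ne : q + v != q - v.
    rewrite (inj_eq (addrI q)) -subr_eq0 opprK -mulr2n -scaler_nat scaler_eq0.
    rewrite pnatr_eq0 /= scaler_eq0 negb_or mulf_neq0 ?gt_eqF ?invr_gt0//=.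
    apply/negP => /eqP/matrixP/(_ 0 i0); rewrite !mxE !eqxx /= => /eqP.
    by rewrite oner_eq0.
  have := Omega_conv h1 h2 ne (t := 1 / 2); rewrite divr_gt0//= => /(_ _).
  have -> : (1 - 1 / 2) *: (q + v) + (1 / 2) *: (q - v) = q.
    have -> : 1 - 1 / 2 = 1 / 2 :> R by field.
    have qq : q + q = (1 + 1) *: q by rewrite scalerDl scale1r.
    rewrite -scalerDr addrACA subrr addr0 qq scalerA.
    by rewrite (_ : 1 / 2 * (1 + 1) = 1 :> R) ?scale1r//; field.
  by apply; lra.
have cl0 : closure Omega !=set0 by exists q.
have ec : {within closure Omega, continuous (fun x => enorm (x - y))}.
  apply: (@lip_within_continuous _ _ _ n%:R) => x x'.
  apply: le_trans (enorm_dist _ _) _; rewrite opprB addrA subrK.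
  exact: enorm_le_sup.
have [p] := compact_EVT_min cl0 (closure_compact Omega_bounded) ec.
rewrite inE => cp pmin.
have py : enorm (p - y) <= n%:R * r.
  have := pmin q; rewrite inE => /(_ cq)/le_trans; apply.
  by apply: le_trans (enorm_le_sup _) _; rewrite ler_wpM2l// distrC ltW.
have pq : `|q - p| <= (n%:R + 1) * r.
  have -> : q - p = - (p - y) - (y - q) by rewrite !opprB [RHS]addrC addrA subrK.
  apply: le_trans (ler_normB _ _) _; rewrite normrN.
  by have := sup_le_enorm (p - y); lra.
suff hp : hh p = 0.
  have := hL q p; rewrite hp subr0 => /le_trans; apply.
  apply: (@le_trans _ _ (c * r)); last by rewrite cr.
  rewrite /c -mulrA; apply: (@le_trans _ _ (`|l| * `|q - p|)).
    by rewrite ler_wpM2r// ler_norm.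
  by apply: ler_pM => //; rewrite lerDl.
have yp : y != p by apply: contra_notN ncy => /eqP ->.
have yp0 : 0 < enorm (y - p) ^+ 2.
  rewrite exprn_gt0//; apply: lt_le_trans (sup_le_enorm _).
  by rewrite normr_gt0 subr_eq0.
(* If the product were positive, a short step from [p] towards [x], which stays in the domain, would
   come closer to [y]. *)
have dot_le x : closure Omega x -> dot (x - p) (y - p) <= 0.
  move=> cx; have [->|xp] := eqVneq x p.
    by rewrite subrr /dot big1// => i _; rewrite mxE mul0r.
  rewrite leNgt; apply/negP => pos.
  pose E := enorm (x - p) ^+ 2.
  have E0 : 0 <= E by exact: sqr_ge0.
  pose s := Num.min (1 / 2) (dot (x - p) (y - p) / (E + 1)).
  have s0 : 0 < s by rewrite /s lt_min; apply/andP; split; rewrite divr_gt0// ltr_wpDl.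
  have s1 : s <= 1 / 2 by rewrite /s ge_min lexx.
  have sE : s * (E + 1) <= dot (x - p) (y - p).
    by rewrite -ler_pdivlMr ?ltr_wpDl// /s ge_min lexx orbT.
  have Os : Omega (p + s *: (x - p)).
    have s01 : 0 < s < 1 by rewrite s0 /=; lra.
    have := Omega_conv cp cx _ s01; rewrite eq_sym => /(_ xp); congr Omega.
    by rewrite scalerBl scale1r scalerBr -!addrA [- _ + _]addrC.
  have := pmin (p + s *: (x - p)); rewrite inE => /(_ (subset_closure Os)).
  rewrite -ler_sqr ?nnegrE ?enorm_ge0//.
  have -> : p + s *: (x - p) - y = - (y - p) + s *: (x - p).
    by rewrite opprB addrAC.
  have -> : p - y = - (y - p) by rewrite opprB.
  rewrite enorm_sqrD enormN enormZ exprMn real_normK ?num_real// -/E.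
  have -> : dot (- (y - p)) (s *: (x - p)) = - (s * dot (x - p) (y - p)).
    rewrite /dot mulr_sumr -sumrN; apply: eq_bigr => i _; rewrite !mxE; ring.
  by move=> h; nra.
apply: (exposed_zero cp (nG p cp) (v := y - p)) => x cx xp.
(* A second contact point would put the midpoint [w] of [x] and [p] into the open set and onto the
   supporting hyperplane; a small push along y - p then contradicts [dot_le]. *)
rewrite lt_neqAle dot_le// andbT; apply/negP => /eqP dx0.
have Om : Omega ((1 - 1 / 2) *: x + (1 / 2) *: p).
  by apply: (Omega_conv cx cp xp); apply/andP; split; lra.
set w := (X in Omega X) in Om.
have wp : dot (w - p) (y - p) = 0.
  have -> : w - p = (1 / 2) *: (x - p).
    have e2 : p = (1 / 2) *: p + (1 / 2) *: p.
      by rewrite -scalerDl (_ : 1 / 2 + 1 / 2 = 1 :> R) ?scale1r//; field.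
    rewrite /w (_ : 1 - 1 / 2 = 1 / 2 :> R); last by field.
    by rewrite {2}e2 opprD addrA addrK scalerBr.
  by rewrite dotZl dx0 mulr0.
have /nbhs_ballP[e1 /= e10 eO] := open_nbhs_nbhs (conj Omega_open Om).
pose s := e1 / (`|y - p| + 1) / 2.
have yp1 : 0 < `|y - p| + 1 by rewrite ltr_wpDl.
have s0 : 0 < s by rewrite /s !divr_gt0.
have cs : closure Omega (w + s *: (y - p)).
  apply/subset_closure/eO; rewrite -ball_normE /= opprD addrA subrr add0r normrN normrZ.
  rewrite gtr0_norm//; apply: (@lt_le_trans _ _ (e1 / (`|y - p| + 1) * (`|y - p| + 1))).
    rewrite /s; have : 0 < e1 / (`|y - p| + 1) by rewrite divr_gt0.
    by have := normr_ge0 (y - p); nra.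
  by rewrite divfK ?gt_eqF.
have := dot_le _ cs; rewrite addrAC dotDl wp add0r dotZl.
have -> : dot (y - p) (y - p) = enorm (y - p) ^+ 2.
  by rewrite enorm_sqr /dot; apply: eq_bigr => i _; rewrite expr2.
by rewrite leNgt mulr_gt0.
Qed.

End Determination.

(** * Uniqueness in the domain *)

Section Uniqueness.
Variables (R : realType) (n N : nat).
Implicit Types (x v : 'rV[R]_n) (A G : 'rV[R]_n -> 'M[R[i]]_N).

Lemma tangent_plane x (rho : R) : (3 <= n)%N -> 0 < rho ->
  exists v1 v2 : 'rV[R]_n, [/\ `|v1| <= rho, `|v2| <= rho,
    dot x v1 = 0, dot x v2 = 0 &
    forall s t, rho ^+ 2 * (s ^+ 2 + t ^+ 2) <= enorm (s *: v1 + t *: v2) ^+ 2].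
Proof.
move=> n3 rho0; have i0 : 'I_n by exact: Ordinal (leq_trans (isT : (1 <= 3)%N) n3).
have [i xi] : exists i, forall j, `|x 0 j| <= `|x 0 i|.
  case: (@arg_maxP _ _ _ i0 xpredT (fun i => `|x 0 i|) isT) => i _ ix.
  by exists i => j; exact: ix.
have [j [k [ji ki jk]]] : exists j k, [/\ j != i, k != i & j != k].
  have : (1 < #|[set~ i]%SET|)%N by rewrite cardsC1 card_ord; case: n n3 => [|[|[|]]].
  by move=> /card_gt1P[j [k []]]; rewrite !inE => ji ki jk; exists j, k.
(* The pivot [i] is a coordinate of largest modulus, so the ratio is at most 1 and the sup norm at
   most [rho]. The coordinates [j] and [k] of s v_j + t v_k are rho s and rho t, whence the lower
   bound. For x = 0 the convention 0 / 0 = 0 leaves multiples of basis vectors. *)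
pose v l : 'rV[R]_n := rho *: (delta_mx 0 l - (x 0 l / x 0 i) *: delta_mx 0 i).
have vE l r : v l 0 r = rho * ((r == l)%:R - x 0 l / x 0 i * (r == i)%:R).
  by rewrite !mxE eqxx.
have v_le l : l != i -> `|v l| <= rho.
  move=> li; apply: coord_le_norm (ltW rho0) _ => r; rewrite vE.
  rewrite normrM (gtr0_norm rho0) -[leRHS]mulr1 ler_wpM2l ?(ltW rho0)//.
  have [->|ri] := eqVneq r i.
    rewrite eq_sym (negPf li) sub0r normrN mulr1 normrM normfV.
    have [->|xi0] := eqVneq (x 0 i) 0; first by rewrite normr0 invr0 mulr0.
    by rewrite ler_pdivrMr ?normr_gt0// mul1r.
  by rewrite mulr0 subr0; case: (r == l); rewrite ?normr1 ?normr0.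
have xv l : l != i -> dot x (v l) = 0.
  move=> li; rewrite /dot (bigD1 l)//= (bigD1 i)/=; last by rewrite eq_sym.
  rewrite big1 => [|r /andP[rl ri]].
    rewrite !vE !eqxx (negPf li) eq_sym (negPf li).
    have [xi0|xi0] := eqVneq (x 0 i) 0; first last.
      by rewrite /= !mulr0 !mulr1 sub0r addr0 subr0 mulr1; field.
    have -> : x 0 l = 0.
      by apply/eqP; rewrite -normr_le0; have := xi l; rewrite xi0 normr0.
    by rewrite xi0 !mul0r !addr0.
  by rewrite vE (negPf rl) (negPf ri) !(mulr0, subr0).
exists (v j), (v k); split; rewrite ?v_le ?xv// => s t.
rewrite enorm_sqr (bigD1 j)//= (bigD1 k)/=; last by rewrite eq_sym.
have -> : (s *: v j + t *: v k) 0 j = rho * s.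
  rewrite mxE [X in X + _]mxE [X in _ + X]mxE !vE eqxx (negPf ji) (negPf jk).
  by rewrite !mulr0 !subr0 !mulr0 addr0 mulr1 mulrC.
have -> : (s *: v j + t *: v k) 0 k = rho * t.
  rewrite mxE [X in X + _]mxE [X in _ + X]mxE !vE eqxx (negPf ki).
  by rewrite eq_sym (negPf jk) !mulr0 !subr0 !mulr0 add0r mulr1 mulrC.
rewrite addrA.
have : 0 <= \sum_(r < n | (r != j) && (r != k)) ((s *: v j + t *: v k) 0 r) ^+ 2.
  by apply: sumr_ge0 => r _; exact: sqr_ge0.
rewrite !exprMn; lra.
Qed.

Lemma regular_mono L M L' M' A : L <= L' -> M <= M' -> regular L M A -> regular L' M' A.
Proof.
move=> LL MM [AL AM Ah]; split=> // [x y|x]; last exact: le_trans (AM x) MM.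
by apply: le_trans (AL x y) _; rewrite ler_wpM2r.
Qed.

(** The maximum is taken over the closure of the nonvanishing set, so [hh] may vanish at [p] itself;
    hence the approximation clause. *)
Lemma support_extremum (hh : 'rV[R]_n -> R) Omega x : bounded_set Omega ->
  (forall y, ~ Omega y -> hh y = 0) -> hh x != 0 ->
  exists p, [/\ closure Omega p, forall y, hh y != 0 -> enorm y <= enorm p &
    forall e, 0 < e -> exists2 y, hh y != 0 & `|y - p| <= e].
Proof.
move=> Ob hO hx; pose S := [set y | hh y != 0].
have SO : closure S `<=` closure Omega.
  apply: closure_subset => y /= hy; apply: contrapT => /hO hy0.
  by move: hy; rewrite /S /= hy0 eqxx.
have cS : compact (closure S).
  by apply: subclosed_compact (closure_compact Ob) SO; exact: closed_closure.
have S0 : closure S !=set0 by exists x; exact: subset_closure.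
have ec : {within closure S, continuous (@enorm R n)}.
  apply: (@lip_within_continuous _ _ _ n%:R) => y z.
  by apply: le_trans (enorm_dist _ _) _; exact: enorm_le_sup.
have [p /[!inE] Sp pmax] := compact_EVT_max S0 cS ec.
exists p; split; first exact: SO.
  by move=> y hy; apply: pmax; rewrite inE; exact: subset_closure.
move=> e e0; have [y [hy yp]] := Sp _ (nbhsx_ballx p e e0).
by exists y => //; rewrite distrC ltW//; move: yp; rewrite -ball_normE.
Qed.

End Uniqueness.

(** * Localisation to an almost tangent plane *)

Section DifferenceZero.
Variables (R : realType) (n N : nat).
Implicit Types (x : 'rV[R]_n).
Local Open Scope sesquilinear_scope.
Local Open Scope complex_scope.

Variable Omega : set 'rV[R]_n.
Hypotheses (Omega_open : open Omega) (Omega_conv : strictly_convex Omega)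
  (Omega_bounded : bounded_set Omega).
Variables (I F : set 'cV[R[i]]_N) (H H' : 'rV[R]_n -> 'M[R[i]]_N).
Hypothesis IF : ideal_data I F.
Hypothesis data : forall (a b : 'cV[R[i]]_N) (T : R) (gamma : R -> 'rV[R]_n),
  F a -> I b -> line_through Omega T gamma ->
  amplitude a (time_evolution H T gamma T 0) b =
  amplitude a (time_evolution H' T gamma T 0) b.
Variables (A A' G : 'rV[R]_n -> 'M[R[i]]_N) (hh : 'rV[R]_n -> R) (L M l m : R).
Hypotheses (L0 : 0 <= L) (M0 : 0 <= M).
Hypotheses (rA : regular L M A) (rA' : regular L M A') (rG : regular L M G).
Hypotheses (AH : forall y, closure Omega y -> A y = H y)
  (AH' : forall y, closure Omega y -> A' y = H' y)
  (AA' : forall y, A y - A' y = (hh y)%:C *: G y).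
Hypothesis hh_lip : lip_bounded l m hh.
Hypotheses (n3 : (3 <= n)%N) (hh0 : forall y, ~ Omega y -> hh y = 0)
  (G_nonscalar : forall x, closure Omega x -> ~~ is_scalar_mx (G x)).

(* The support of [hh] lies in the ball through its farthest point [p], so a
   plane tangent to a sphere at a nearby [x0] cuts out a small piece of it. *)
Lemma difference_zero x : hh x = 0.
Proof.
apply/eqP/negPn/negP => hx.
have [p [cp pmax papp]] := support_extremum Omega_bounded hh0 hx.
have [P [trP PG]] := trace_functional (G_nonscalar cp).
pose K := `|weight_const n L M P| + 1; have K0 : 0 < K by rewrite ltr_wpDl.
(* Makes the weights 1/10-close to 1; the value 1/10 meets the condition 72 d^2 <= 1 of
   [plane_uniqueness]. *)
pose rho := Num.min 1 (1 / 10 / K).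
have rho0 : 0 < rho by rewrite lt_min ltr01 !divr_gt0.
have rho1 : rho <= 1 by rewrite ge_min lexx.
have rhoK : weight_const n L M P * rho <= 1 / 10.
  apply: (@le_trans _ _ (K * (1 / 10 / K))); last by rewrite mulrC divfK ?gt_eqF.
  apply: (@le_trans _ _ (K * rho)); last by rewrite ler_wpM2l ?(ltW K0)// ge_min lexx orbT.
  by rewrite ler_wpM2r ?(ltW rho0)//; have := ler_norm (weight_const n L M P); rewrite /K; lra.
clearbody rho.
(* Ensures that |x0 - p| <= rho^2 / D brings the squared Euclidean norms of [p] and [x0] within
   rho^2: one factor dominates their sum of norms, the other compares the Euclidean and sup
   norms. *)
pose D := 2 * (enorm p + 1) * (n%:R + 1).
have D0 : 0 < D by rewrite !mulr_gt0// ltr_wpDl ?enorm_ge0.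
have r'0 : 0 < Num.min rho (rho ^+ 2 / D) by rewrite lt_min rho0 divr_gt0// exprn_gt0.
have [x0 hx0 x0p'] := papp _ r'0.
have x0p : `|x0 - p| <= rho by apply: le_trans x0p' _; rewrite ge_min lexx.
have far : enorm p ^+ 2 - rho ^+ 2 <= enorm x0 ^+ 2.
  have h1 : `|x0 - p| * D <= rho ^+ 2.
    by rewrite -ler_pdivlMr//; apply: le_trans x0p' _; rewrite ge_min lexx orbT.
  have h2 := le_trans (enorm_dist p x0) (enorm_le_sup (p - x0)).
  rewrite distrC in h1; have h3 := normr_ge0 (p - x0); have h4 := enorm_ge0 p.
  have h5 := enorm_ge0 x0; have h6 := pmax x0 hx0.
  have h7 : enorm p - enorm x0 <= (n%:R + 1) * `|p - x0|.
    by apply: le_trans (ler_norm _) _; apply: le_trans h2 _; rewrite ler_wpM2r// lerDl.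
  have h8 : (enorm p - enorm x0) * (enorm p + enorm x0) <=
      (n%:R + 1) * `|p - x0| * (2 * (enorm p + 1)).
    by apply: ler_pM => //; lra.
  have -> : enorm x0 ^+ 2 = enorm p ^+ 2 -
    (enorm p - enorm x0) * (enorm p + enorm x0) by ring.
  rewrite lerD2l lerN2; apply: le_trans h8 _; apply: le_trans h1.
  by rewrite le_eqVlt; apply/orP; left; apply/eqP; rewrite /D; ring.
have [v1 [v2 [v1r v2r xv1 xv2 v12]]] := tangent_plane x0 n3 rho0.
have en (s t : R) : s != 0 \/ t != 0 -> 0 < enorm (s *: v1 + t *: v2).
  move=> st; rewrite lt_neqAle enorm_ge0 andbT eq_sym; apply/negP => /eqP e0.
  have := v12 s t; rewrite e0 expr0n /= leNgt mulr_gt0 ?exprn_gt0//.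
  have := sqr_ge0 s; have := sqr_ge0 t.
  have q (z : R) : z != 0 -> 0 < z ^+ 2 by move=> z0; rewrite exprn_even_gt0.
  by case: st => /q; lra.
pose h (s t : R) := hh (x0 + s *: v1 + t *: v2).
(* By Pythagoras, [x0] being orthogonal to the plane, s^2 + t^2 > 1 gives a squared norm above that
   of [x0] plus rho^2, hence above that of [p]. *)
have hbox : box_supported h.
  move=> s t st; apply/eqP/negPn/negP => /pmax.
  rewrite -ler_sqr ?nnegrE ?enorm_ge0// leNgt => /negP; apply.
  rewrite -addrA enorm_sqrD.
  have -> : dot x0 (s *: v1 + t *: v2) = 0.
    have -> : dot x0 (s *: v1 + t *: v2) = s * dot x0 v1 + t * dot x0 v2.
      rewrite /dot !mulr_sumr -big_split; apply: eq_bigr => i _ /=; rewrite !mxE; ring.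
    by rewrite xv1 xv2 !mulr0 addr0.
  have st1 : 1 < s ^+ 2 + t ^+ 2.
    have q (z : R) : 1 < `|z| -> 1 < z ^+ 2.
      by move=> z1; rewrite -(real_normK (num_real z)) exprn_egt1.
    have := sqr_ge0 s; have := sqr_ge0 t.
    by case: st => /q; lra.
  have r20 : 0 < rho ^+ 2 by rewrite exprn_gt0.
  have := v12 s t; have := mulr_gt0 r20 (_ : 0 < s ^+ 2 + t ^+ 2 - 1).
  rewrite subr_gt0 => /(_ st1) h1 h2; rewrite mulr0 addr0.
  by rewrite mulrBr mulr1 in h1; lra.
have [hL _] := hh_lip.
have hlip C : `|l| <= C -> lip2 C h.
  move=> lC s s' t t'; apply: le_trans (hL _ _) _.
  apply: (@le_trans _ _ (C * `|x0 + s *: v1 + t *: v2 - (x0 + s' *: v1 + t' *: v2)|)).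
    by rewrite ler_wpM2r//; apply: le_trans (ler_norm l) lC.
  rewrite ler_wpM2l ?(le_trans (normr_ge0 l))//.
  have -> : x0 + s *: v1 + t *: v2 - (x0 + s' *: v1 + t' *: v2) =
      (s - s') *: v1 + (t - t') *: v2.
    by rewrite opprD addrACA opprD [x0 + _ + _]addrACA subrr add0r -!scalerBl.
  apply: le_trans (ler_normD _ _) _; rewrite !normrZ.
  by apply: lerD; rewrite ler_piMr// (le_trans _ rho1).
have rho01 : 0 < rho <= 1 by rewrite rho0.
have scal (y d : 'rV[R]_n) X Y : 0 < enorm d ->
    (forall r : R, 1 < `|r| -> hh (y + r *: d) = 0) ->
    line_ode A y d X -> line_ode A' y d Y -> X (-1) = 1%:M -> Y (-1) = 1%:M ->
    exists z : R[i], (Y 1) ^t* *m X 1 = z%:M.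
  move=> d0 yd; exact: (line_identity Omega_open Omega_conv Omega_bounded IF data
    rA rA' AH AH' AA' d0 hh0 yd).
have [C1 [w1 [C10 w1P]]] : exists C w, 0 <= C /\ chart_weight (1 / 10) C h w.
  apply: (chart_weight_exists L0 M0 rA rA' rG AA' trP PG rho01 v1r v2r x0p _ rhoK).
    by move=> t; rewrite -[v2]scale1r; apply: en; right; exact: oner_neq0.
  move=> s t X Y _; apply: scal.
    by rewrite -[v2]scale1r; apply: en; right; exact: oner_neq0.
  move=> r r1; have := hbox (s + r * t) r (or_intror r1); rewrite /h => <-.
  by rewrite scalerDr scalerA scalerDl !addrA.
have [C2 [w2 [C20 w2P]]] : exists C w, 0 <= C /\ chart_weight (1 / 10) C (fun s t => h t s) w.
  have -> : (fun s t => h t s) = (fun s t => hh (x0 + s *: v2 + t *: v1)).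
    by apply/funext => s; apply/funext => t; rewrite /h addrAC.
  apply: (chart_weight_exists L0 M0 rA rA' rG AA' trP PG rho01 v2r v1r x0p _ rhoK).
    by move=> t; rewrite addrC -[v1]scale1r; apply: en; left; exact: oner_neq0.
  move=> s t X Y _; apply: scal.
    by rewrite addrC -[v1]scale1r; apply: en; left; exact: oner_neq0.
  move=> r r1; have := hbox r (s + r * t) (or_introl r1); rewrite /h => <-.
  by rewrite scalerDr scalerA scalerDl [in RHS]addrAC !addrA.
have e10 : 0 < 1 / 10 :> R by rewrite divr_gt0.
have e72 : 72 * (1 / 10) ^+ 2 <= 1 :> R by lra.
pose C := `|l| + C1 + C2.
have := plane_uniqueness e10 e72 hbox (hlip C _)
  (chart_weight_mono (lexx _) _ w1P) (chart_weight_mono (lexx _) _ w2P) 0 0.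
rewrite /h !scale0r !addr0 => h0; move/negP: hx0; apply; apply/eqP/h0.
- by rewrite /C -addrA lerDl addr_ge0.
- by have := normr_ge0 l; rewrite /C; lra.
- by have := normr_ge0 l; rewrite /C; lra.
Qed.

End DifferenceZero.

Local Open Scope complex_scope.

Theorem theorem5p4 (R : realType) (n : nat) (hn : (3 <= n)%N)
    (Omega : set 'rV[R]_n)
    (Omega_domain : domain Omega)
    (Omega_bounded : bounded_set Omega)
    (Omega_smooth : smooth_boundary Omega)
    (Omega_convex : strictly_convex Omega)
    (N : nat) (hN : (2 <= N)%N)
    (I F : set 'cV[R[i]]_N)
    (IF_ideal : ideal_data I F)
    (alpha : R) (alpha_gt0 : 0 < alpha)
    (H0 G : 'rV[R]_n -> 'M[R[i]]_N)
    (H0_reg : C1holder_mx alpha Omega H0)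
    (G_reg : C1holder_mx alpha Omega G)
    (H0_herm : forall x, closure Omega x -> H0 x \is hermsymmx)
    (G_herm : forall x, closure Omega x -> G x \is hermsymmx)
    (G_nonscalar : forall x, closure Omega x -> ~~ is_scalar_mx (G x))
    (f f' : 'rV[R]_n -> R)
    (f_reg : C1holder alpha Omega f)
    (f'_reg : C1holder alpha Omega f')
    (H := fun x => H0 x + (f x)%:C *: G x)
    (H' := fun x => H0 x + (f' x)%:C *: G x) :
  (forall (a b : 'cV[R[i]]_N) (T : R) (gamma : R -> 'rV[R]_n),
     F a -> I b -> line_through Omega T gamma ->
     amplitude a (time_evolution H T gamma T 0) b =
     amplitude a (time_evolution H' T gamma T 0) b) ->
  forall x, closure Omega x -> f x = f' x.
Proof.
move=> data.
case: Omega_domain => Omega_open _ [w0 Omega_w0].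
have [H0e [L1 [M1 [L10 M10 r1 E1]]]] := hermitian_extension Omega_open
  Omega_convex Omega_bounded Omega_w0 H0_reg H0_herm.
have [Ge [L2 [M2 [L20 M20 r2 E2]]]] := hermitian_extension Omega_open
  Omega_convex Omega_bounded Omega_w0 G_reg G_herm.
have [fe [l1 [m1 [l10 m10 b1 e1]]]] := C1holder_extension Omega_open
  Omega_convex Omega_bounded Omega_w0 f_reg.
have [fe' [l2 [m2 [l20 m20 b2 e2]]]] := C1holder_extension Omega_open
  Omega_convex Omega_bounded Omega_w0 f'_reg.
pose l := l1 + l2; pose m := m1 + m2.
have l0 : 0 <= l by exact: addr_ge0.
have m0 : 0 <= m by exact: addr_ge0.
have bd : lip_bounded l m (fun x => fe x - fe' x).
  exact: lip_boundedD b1 (lip_boundedN b2).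
pose L3 := L1 + (l1 * M2 + m1 * L2); pose M3 := M1 + m1 * M2.
have L30 : 0 <= L3 by rewrite /L3 !addr_ge0// mulr_ge0.
have M30 : 0 <= M3 by rewrite /M3 addr_ge0// mulr_ge0.
pose A x := H0e x + (fe x)%:C *: Ge x.
have rA : regular L3 M3 A by exact: regular_comb.
clearbody L3 M3 l m.
pose L := L3 + (l * M2 + m * L2) + L2; pose M := M3 + m * M2 + M2.
have L0 : 0 <= L by rewrite /L !addr_ge0// mulr_ge0.
have M0 : 0 <= M by rewrite /M !addr_ge0// mulr_ge0.
have rA0 : regular L M A.
  apply: regular_mono rA; first by rewrite /L -!addrA lerDl !addr_ge0// mulr_ge0.
  by rewrite /M -!addrA lerDl !addr_ge0// mulr_ge0.
have rG : regular L M Ge.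
  apply: regular_mono r2; first by rewrite /L lerDr !addr_ge0// mulr_ge0.
  by rewrite /M lerDr !addr_ge0// mulr_ge0.
(* The second field is defined as A - hh [Ge], so that A - A' = hh [Ge] holds on the whole space and
   not only on the closure. It is kept general in [hh] because it serves twice, for [fe - fe'] and
   for its cut-off [hz]. *)
have rA' hh : lip_bounded l m hh ->
    regular L M (fun x => A x + (- hh x)%:C *: Ge x).
  move=> bh; have := regular_comb L30 M30 L20 M20 l0 m0 rA r2 (lip_boundedN bh).
  by apply: regular_mono; [rewrite /L lerDl | rewrite /M lerDl].
have AA' hh x : A x - (A x + (- hh x)%:C *: Ge x) = (hh x)%:C *: Ge x.
  by rewrite opprD addrA subrr add0r -scaleNr -rmorphN opprK.
have AH x : closure Omega x -> A x = H x.
  by move=> cx; rewrite /A /H (E1 x cx) (E2 x cx) (e1 x cx).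
have AH' (hh : 'rV[R]_n -> R) :
    (forall x, closure Omega x -> hh x = fe x - fe' x) ->
    forall x, closure Omega x -> A x + (- hh x)%:C *: Ge x = H' x.
  move=> hE x cx; rewrite /A /H' (E1 x cx) (E2 x cx) -addrA -scalerDl -rmorphD /=.
  by rewrite (hE x cx) opprB addrCA subrr addr0 (e2 x cx).
have nG x : closure Omega x -> ~~ is_scalar_mx (Ge x).
  by move=> cx; rewrite E2// G_nonscalar.
have z0 x : closure Omega x -> ~ Omega x -> fe x - fe' x = 0.
  exact: (boundary_zero Omega_open Omega_convex Omega_bounded IF_ideal data L0 M0
    rA0 (rA' _ bd) rG AH (AH' _ (fun _ _ => erefl)) (AA' _) bd Omega_w0
    (ltnW hn) nG).
(* Outside the closure [fe - fe'] is arbitrary. With its boundary values known to vanish, it is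
   replaced there by 0 without losing the Lipschitz bound. *)
have bz := zero_extension Omega_open l0 m0 bd z0.
set hz := (fun x => _) in bz.
have hzE x : closure Omega x -> hz x = fe x - fe' x.
  by rewrite /hz; case: pselect.
have hz0 x : ~ Omega x -> hz x = 0.
  by move=> nx; rewrite /hz; case: pselect => // cx; exact: z0.
move=> x cx; apply/eqP; rewrite -subr_eq0 -e1// -e2// -hzE//; apply/eqP.
exact: (difference_zero Omega_open Omega_convex Omega_bounded IF_ideal data L0 M0
  rA0 (rA' _ bz) rG AH (AH' _ hzE) (AA' _) bz hn hz0 nG).
Qed.
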